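(* Let $(X_i,Y_i)\in\mathbb{R}^{p}\times\mathbb{R}$, $i\ge 1$, be IID samples from a distribution $P$ with $\mathbb{E}[Y^2]<\infty$, let $f_0(x)=\mathbb{E}[Y\mid X=x]$, and assume that the noise $\epsilon_1=Y_1-f_0(X_1)$ satisfies $\mathbb{E}[\epsilon_1^2\mid X_1=x]\le\sigma^2<\infty$ for every $x$ in the support of $X_1$. Let $\{h_i\}$ be a sequence of estimators of $f_0$ for which there are constants $a_h\in[0,1)$, $M_h\in(0,\infty)$, $C_{1,h}\in(0,\infty)$, $C_{2,h}>0$ and $b_h>\tfrac12+\tfrac{a_h}{2}$ such that $$\liminf_{i\to\infty} i^{a_h}\,\mathbb{E}[r(h_i)]=M_h,\qquad \sup_i\mathbb{E}[r(h_i)]<\infty,\qquad \limsup_{i\to\infty} i^{2a_h}\,\mathbb{E}\big[\{h_i(X)-f_0(X)\}^4\big]=C_{1,h},$$ and, for all $i\ge1$ and $j\in[i]$, $\ i^{2b_h}\,\mathbb{E}[\{\nabla_j h_i(X)\}^2\mid F^j]\le C_{2,h}$ almost surely. Let $\{g_i\}$ be a sequence of estimators of $f_0$ with $\limsup_{i\to\infty}\mathbb{E}[r(g_i)]/\mathbb{E}[r(h_i)]<1$ for which there are constants $a_g\in[0,1]$, $M_g\in(0,\infty)$, $C_{1,g}\in(0,\infty)$, $C_{2,g}>0$ and $b_g>\tfrac12+a_h-\tfrac{a_g}{2}$ such that $$\limsup_{i\to\infty} i^{a_g}\,\mathbb{E}[r(g_i)]=M_g,\qquad \sup_i\mathbb{E}[r(g_i)]<\infty,\qquad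 \limsup_{i\to\infty} i^{2a_g}\,\mathbb{E}\big[\{g_i(X)-f_0(X)\}^4\big]=C_{1,g},$$ and, for all $i\ge1$ and $j\in[i]$, $\ i^{2b_g}\,\mathbb{E}[\{\nabla_j g_i(X)\}^2\mid F^j]\le C_{2,g}$ almost surely. Assume further that one of the following holds: (1) $a_g\in(a_h,1]$; or (2) $a_g=a_h<1$ and $M_g<M_h$. Then for every fixed $\xi\ge0$, $$\lim_{n\to\infty}\mathbb{P}\Big[\mathrm{RV}\big(\{g_i,\,i\in[n]\},\xi\big)<\mathrm{RV}\big(\{h_i,\,i\in[n]\},\xi\big)\Big]=1 .$$
   Context: $[n]=\{1,\dots,n\}$. A sequence of estimators $\{\hat f_i, i\in\mathbb{N}\}$ is a sequence of real-valued functions on $\mathbb{R}^p$, where $\hat f_i(\cdot)=\hat f_i(\cdot\,;\boldsymbol Z_i)$ is a (measurable) function of the first $i$ samples $\boldsymbol Z_i=\{(X_l,Y_l):l\in[i]\}$; the estimator with index $0$ (no data) is the zero function. $X$ (and $X_0$) denotes a draw from the marginal law $P_X$ of the covariate independent of everything else. Risk: $r(\hat f)=\mathbb{E}_{X_0}[(\hat f(X_0)-f_0(X_0))^2]$, the expectation being over $X_0$ only, so that $r(\hat f)$ is random through $\hat f$, while $\mathbb{E}[r(\hat f_i)]$ is the unconditional expectation (a number). $F^j$ is the $\sigma$-algebra generated by $(X_1,Y_1),\dots,(X_j,Y_j)$. For $j\in[i]$, $\boldsymbol Z_i^j$ is obtained from $\boldsymbol Z_i$ by replacing $(X_j,Y_j)$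 by an independent IID copy $(X_j',Y_j')$, and $\nabla_j\hat f_i(x)=\hat f_i(x;\boldsymbol Z_i)-\hat f_i(x;\boldsymbol Z_i^j)$. Weighted rolling validation statistic: $\mathrm{RV}(\{\hat f_l,\,l\in[n]\},\xi)=\sum_{l=0}^{n} l^{\xi}\big(\hat f_l(X_{l+1})-Y_{l+1}\big)^2$ (with the same convention for $0^0$ for all sequences). *)

(* Defs.v *)
From HB Require Import structures.
From mathcomp Require Import all_boot all_order all_algebra.
From mathcomp Require Import all_classical all_reals all_analysis.
From mathcomp Require Import measurable_realfun.
Set Implicit Arguments.
Unset Strict Implicit.
Unset Printing Implicit Defensive.
Import Order.TTheory GRing.Theory Num.Theory numFieldNormedType.Exports.
Local Open Scope classical_set_scope.
Local Open Scope ring_scope.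

(* The vectors of R^p are the tuples [p.-tuple R], with the product
   sigma-algebra.  Samples are numbered from 0: [X l] and [Y l] stand for
   X_{l+1} and Y_{l+1}, so that the first i samples are those of number l < i,
   and X_{l+1} is the first covariate that does not enter Z_l. *)

Section CondExp.
Context d (T : measurableType d) (R : realType) (P : probability T R).

(* [W] is a version of the conditional expectation of [U] given the
   sub-sigma-algebra [G]; meaningful for [U] integrable or non-negative. *)
Definition is_cond_exp (G : set (set T)) (U W : T -> \bar R) : Prop :=
  (forall B : set (\bar R), measurable B -> G (W @^-1` B)) /\
  (forall A, G A -> (\int[P]_(w in A) W w = \int[P]_(w in A) U w)%E).

(* [v] is a version of x |-> E[U | V = x]. *)
Definition is_cond_exp_at d' (T' : measurableType d') (V : T -> T')
    (U : T -> \bar R) (v : T' -> \bar R) : Prop :=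
  measurable_fun [set: T'] v /\
  is_cond_exp (g_sigma_algebra_preimage V) U (v \o V).

Definition mutually_independent (I : eqType) (F : I -> set (set T)) : Prop :=
  forall (s : seq I) (E : I -> set T), uniq s ->
    (forall i, i \in s -> F i (E i)) ->
    (P (\big[setI/setT]_(i <- s) E i) = \prod_(i <- s) P (E i))%E.

(* The support of the law of a random vector; sup-norm balls form a basis of
   the topology of R^p. *)
Definition law_support (p : nat) (V : T -> p.-tuple R) : set (p.-tuple R) :=
  [set x | forall e : R, 0 < e ->
    (0 < P [set w | forall k : 'I_p, (`|tnth (V w) k - tnth x k| < e)%R])%E].

End CondExp.

Definition sample d (T : measurableType d) (R : realType) (P : probability T R)
    (p : nat) (X : nat -> {RV P >-> p.-tuple R}) (Y : nat -> {RV P >-> R})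
    (l : nat) (w : T) : p.-tuple R * R := (X l w, Y l w).

Section Model.
Context d (T : measurableType d) (R : realType) (P : probability T R) (p : nat).
Variables (X : nat -> {RV P >-> p.-tuple R}) (Y : nat -> {RV P >-> R}).
Variables (X' : nat -> {RV P >-> p.-tuple R}) (Y' : nat -> {RV P >-> R}).
Variable Xnew : {RV P >-> p.-tuple R}.

(* [X'], [Y'] are the copies used in Z_i^j; [Xnew] is the draw X (or X_0). *)
Definition iid_sampling : Prop :=
  [/\ mutually_independent P (fun k : nat + nat + unit =>
        match k with
        | inl (inl l) => g_sigma_algebra_preimage (sample X Y l)
        | inl (inr l) => g_sigma_algebra_preimage (sample X' Y' l)
        | inr _ => g_sigma_algebra_preimage Xnew
        end),
      forall l (B : set (p.-tuple R * R)), measurable B ->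
        P (sample X Y l @^-1` B) = P (sample X Y 0%N @^-1` B),
      forall l (B : set (p.-tuple R * R)), measurable B ->
        P (sample X' Y' l @^-1` B) = P (sample X Y 0%N @^-1` B) &
      forall B : set (p.-tuple R), measurable B ->
        P (Xnew @^-1` B) = P (X 0%N @^-1` B)].

(* Z_i *)
Definition data (i : nat) (w : T) : i.-tuple (p.-tuple R * R) :=
  [tuple sample X Y k w | k < i].

(* Z_i with the sample of number j replaced by its copy *)
Definition data_swap (i j : nat) (w : T) : i.-tuple (p.-tuple R * R) :=
  [tuple if k == j :> nat then sample X' Y' k w else sample X Y k w | k < i].

(* F^j, generated by the samples of number l < j *)
Definition past (j : nat) : set (set T) :=
  <<s \bigcup_(l in `I_j) g_sigma_algebra_preimage (sample X Y l) >>.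

End Model.

(* [f i z x] is the value at [x] of the estimator with index [i] fitted on the
   data [z]. *)
Definition estimators (R : realType) (p : nat) : Type :=
  forall i : nat, i.-tuple (p.-tuple R * R) -> p.-tuple R -> R.

Definition estimator_sequence (R : realType) (p : nat) (f : estimators R p) :
    Prop :=
  (forall z x, f 0%N z x = 0) /\
  (forall i, measurable_fun [set: i.-tuple (p.-tuple R * R) * p.-tuple R]
     (fun zx => f i zx.1 zx.2)).

Section Risk.
Context d (T : measurableType d) (R : realType) (P : probability T R) (p : nat).
Variables (X : nat -> {RV P >-> p.-tuple R}) (Y : nat -> {RV P >-> R}).
Variables (X' : nat -> {RV P >-> p.-tuple R}) (Y' : nat -> {RV P >-> R}).
Variables (Xnew : {RV P >-> p.-tuple R}) (f0 : p.-tuple R -> R).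
Variable f : estimators R p.

Definition risk (fhat : p.-tuple R -> R) : \bar R :=
  (\int[distribution P Xnew]_x ((fhat x - f0 x) ^+ 2)%:E)%E.

Definition mean_risk (i : nat) : \bar R :=
  (\int[P]_w risk (f (data X Y i w)))%E.

Definition mean_error4 (i : nat) : \bar R :=
  (\int[P]_w ((f (data X Y i w) (Xnew w) - f0 (Xnew w)) ^+ 4)%:E)%E.

Definition nabla (i j : nat) (w : T) (x : p.-tuple R) : R :=
  f (data X Y i w) x - f (data_swap X Y X' Y' i j w) x.

(* With samples numbered from 0, index j of [i] becomes j.-1 < i. *)
Definition stable (b C : R) : Prop :=
  forall i j : nat, (j < i)%N ->
    exists2 W : T -> \bar R,
      is_cond_exp P (past X Y j.+1)
        (fun w => ((nabla i j w (Xnew w)) ^+ 2)%:E) W &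
      {ae P, forall w, ((i%:R `^ (2 * b))%:E * W w <= C%:E)%E}.

(* The term l = 0 has weight 0 `^ xi, with 0 `^ 0 = 1. *)
Definition RV (xi : R) (n : nat) (w : T) : R :=
  \sum_(0 <= l < n.+1)
    l%:R `^ xi * (f (data X Y l w) (X l w) - Y l w) ^+ 2.

End Risk.

(* Main.v *)
(* With [l ^ xi] as weight, the difference RV(h) - RV(g) is a sum over l of
   loss differences L_l = (h_l - Y)^2 - (g_l - Y)^2, and

     L_l = (L_l - E[L_l | F^l]) + (r(h_l) - r(g_l) - E[r(h_l) - r(g_l)])
           + E[r(h_l) - r(g_l)].

   By the ratio hypothesis and the liminf, the last term is at least
   kappa l^(-a_h), so that it contributes s_n = sum l^(xi - a_h) up to a
   constant. The first term is a martingale difference whose second moment is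
   O(l^(-a_h)) by the fourth moment and noise conditions, so its weighted sum has
   variance O(n^xi s_n) = o(s_n^2) because a_h < 1. For the second term,
   decompose the risk of an estimator into the martingale increments
   E[r | F^(j+1)] - E[r | F^j]; Cauchy-Schwarz and stability bound the second
   moment of each by C l^(-2b) E[r], hence the standard deviation of the risk is
   O(l^(1/2 - b - a/2)) = o(l^(-a_h)). The finitely many l for which the
   fourth moments may be infinite contribute a fixed random variable. Markov's
   inequality concludes. *)
Require Import Defs.
From HB Require Import structures.
From mathcomp Require Import all_boot all_order all_algebra.
From mathcomp Require Import all_classical all_reals all_analysis.
From mathcomp Require Import measurable_realfun zify ring lra.
Set Implicit Arguments.
Unset Strict Implicit.
Unset Printing Implicit Defensive.
Import Order.TTheory GRing.Theory Num.Theory numFieldNormedType.Exports.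
Local Open Scope classical_set_scope.
Local Open Scope ring_scope.

(** * Laws on tuples and resampling *)

(** The variance bound has a circularity that dictates its form. The increment [D] brought by sample
    [j] is a conditional mean of a difference of squared errors, which factors as [N * u]: [N] is
    the effect of replacing sample [j], [u] a sum of two errors. The bound E[D^2] <= E[|D| |N u|]
    leaves [D] under the integral. But [D] depends on the samples up to [j] only, and stability is
    assumed conditionally on exactly these, so E[D^2 N^2] <= c E[D^2] and half of E[D^2] is absorbed
    on the left. The absorption needs E[D^2] finite, which the fourth moment gives.

    In the study of the risk, conditioning on the first [j] samples is made concrete: the other
    coordinates are redrawn from an independent copy on a product space and integrated out. To
    depend on the first [j] samples then means to be invariant under this redrawing.

    The rates of both estimators are expressed with the exponent [a_h]; the thresholds on [b_h] and
    [b_g] are exactly what makes both standard deviations o(l^(-a_h)). *)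

Section SameLaw.
Context d1 (T1 : measurableType d1) d2 (T2 : measurableType d2) (R : realType).
Context d (S : measurableType d).
Variables (m1 : {measure set T1 -> \bar R}) (m2 : {measure set T2 -> \bar R}).

(** Both integrals are integrals of [f] against a pushforward. The two maps may live on different
    spaces, which serves to compare [P] with [P \x P]. *)
Lemma ge0_integral_same_law (V1 : T1 -> S) (V2 : T2 -> S) (f : S -> \bar R) :
  measurable_fun setT V1 -> measurable_fun setT V2 ->
  (forall B, measurable B -> m1 (V1 @^-1` B) = m2 (V2 @^-1` B)) ->
  measurable_fun setT f -> (forall s, 0 <= f s)%E ->
  (\int[m1]_x f (V1 x) = \int[m2]_x f (V2 x))%E.
Proof.
move=> mV1 mV2 eqV mf f0.
have e1 := @ge0_integral_pushforward _ _ _ _ _ _ mV1 m1 setT f measurableT mf (fun y _ => f0 y).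
have e2 := @ge0_integral_pushforward _ _ _ _ _ _ mV2 m2 setT f measurableT mf (fun y _ => f0 y).
rewrite !preimage_setT /= in e1 e2.
rewrite -[LHS]e1 -[RHS]e2.
apply: eq_measure_integral => A mA _; exact: eqV.
Qed.

Lemma integral_same_law (V1 : T1 -> S) (V2 : T2 -> S) (f : S -> \bar R) :
  measurable_fun setT V1 -> measurable_fun setT V2 ->
  (forall B, measurable B -> m1 (V1 @^-1` B) = m2 (V2 @^-1` B)) ->
  measurable_fun setT f ->
  (\int[m1]_x f (V1 x) = \int[m2]_x f (V2 x))%E.
Proof.
move=> mV1 mV2 eqV mf; rewrite integralE [RHS]integralE; congr (_ - _)%E.
- have := ge0_integral_same_law mV1 mV2 eqV (measurable_funepos mf)
    (funepos_ge0 f).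
  by rewrite funepos.unlock.
- have := ge0_integral_same_law mV1 mV2 eqV (measurable_funeneg mf)
    (funeneg_ge0 f).
  by rewrite funeneg.unlock.
Qed.

Definition boxset n (B : 'I_n -> set S) : set (n.-tuple S) :=
  [set z | forall k, B k (tnth z k)].

(** Boxes are stable under intersection and generate the product sigma-algebra, so two finite
    measures that agree on them are equal. *)
Lemma eq_law_of_boxes n (V1 : T1 -> n.-tuple S) (V2 : T2 -> n.-tuple S) :
  measurable_fun setT V1 -> measurable_fun setT V2 ->
  (m1 setT < +oo)%E ->
  (forall B, (forall k, measurable (B k)) ->
     m1 (V1 @^-1` boxset B) = m2 (V2 @^-1` boxset B)) ->
  forall B, measurable B -> m1 (V1 @^-1` B) = m2 (V2 @^-1` B).
Proof.
move=> mV1 mV2 fin eqB B mB.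
pose W1 : {mfun T1 >-> n.-tuple S} := mfun_Sub (mem_set mV1).
pose W2 : {mfun T2 >-> n.-tuple S} := mfun_Sub (mem_set mV2).
pose G := [set A : set (n.-tuple S) | exists2 B, (forall k, measurable (B k)) & A = boxset B].
have GT : G setT.
  by exists (fun=> setT) => //; apply/seteqP; split => // z _ k.
have mG : measurable = <<s G >> :> set (set (n.-tuple S)).
  apply/seteqP; split; last first.
    apply: smallest_sub; first exact: sigma_algebra_measurable.
    move=> _ [C mC ->].
    rewrite (_ : boxset C = \bigcap_(k in [set: 'I_n]) ((fun z => tnth z k) @^-1` C k)).
      apply: fin_bigcap_measurable => // k _.
      by rewrite -[X in measurable X]setTI; exact: measurable_tnth.
    by apply/seteqP; split => z /= Bz k; [move=> _; exact: Bz|exact: (Bz k I)].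
  apply: smallest_sub; first exact: smallest_sigma_algebra.
  rewrite -bigcup_seq; apply: bigcup_sub => i _ _ [C mC <-].
  rewrite setTI; apply: sub_sigma_algebra.
  (* A cylinder over coordinate [i] is the box whose other sides are full. *)
  exists (fun k => if k == i then C else setT).
    by move=> k; case: ifP.
  apply/seteqP; split => z /=.
    by move=> Cz k; case: ifPn => // /eqP ->.
  by move=> /(_ i); rewrite eqxx.
have GI : setI_closed G.
  move=> _ _ [C1 mC1 ->] [C2 mC2 ->]; exists (fun k => C1 k `&` C2 k).
    by move=> k; exact: measurableI.
  apply/seteqP; split => z /=; first by move=> [] ? ? k; split.
  by move=> H; split => k; case: (H k).
apply: (measure_unique G (fun=> setT) mG GI (fun=> GT) _
  (pushforward m1 W1) (pushforward m2 W2)) => //=.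
- by rewrite bigcup_const.
- by move=> _ [C mC ->]; exact: eqB.
Qed.
End SameLaw.

Section Splice.
Context d (T : measurableType d) (R : realType) (P : probability T R).
Context d' (S : measurableType d').

(** Testing full boxes is enough: independence of a subfamily is the case where the other sides are
    [setT]. *)
Definition coords_indep n (V : T -> n.-tuple S) : Prop :=
  forall B : 'I_n -> set S, (forall k, measurable (B k)) ->
    P (V @^-1` boxset B) = (\prod_(k < n) P [set w | B k (tnth (V w) k)])%E.

Definition splice n (j : nat) (z z' : n.-tuple S) : n.-tuple S :=
  [tuple if (k < j)%N then tnth z k else tnth z' k | k < n].

Lemma measurable_splice n j d0 (T0 : measurableType d0) (z z' : T0 -> n.-tuple S) :
  measurable_fun setT z -> measurable_fun setT z' ->
  measurable_fun setT (fun w => splice j (z w) (z' w)).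
Proof.
move=> mz mz'; apply/measurable_fun_tnthP => i.
rewrite (_ : _ \o _ = fun w => if (i < j)%N then tnth (z w) i else tnth (z' w) i).
  by case: (i < j)%N; [have := measurableT_comp (measurable_tnth i) mz|have := measurableT_comp (measurable_tnth i) mz'].
by apply/funext => w; rewrite /= tnth_mktuple.
Qed.

Variables (n : nat) (V : T -> n.-tuple S) (mV : measurable_fun setT V).
Hypothesis iV : coords_indep V.

Lemma measurable_coord k B : measurable B -> measurable [set w | B (tnth (V w) k)].
Proof.
move=> mB; rewrite -[X in measurable X]setTI.
exact: (measurableT_comp (measurable_tnth k) mV measurableT mB).
Qed.

(** On a box, the sides of number below [j] constrain the first copy and the others the second. The
    two products of marginals then multiply coordinate by coordinate, one of the two factors being 1
    each time. *)
Lemma splice_law j B : measurable B ->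
  P (V @^-1` B) =
  (P \x P)%E ((fun ww : T * T => splice j (V ww.1) (V ww.2)) @^-1` B).
Proof.
apply: eq_law_of_boxes => //.
- by apply: measurable_splice; apply: measurableT_comp.
- exact: le_lt_trans (@probability_le1 _ _ _ P setT measurableT) (ltry _).
move=> C mC.
pose C1 (k : 'I_n) := if (k < j)%N then C k else setT.
pose C2 (k : 'I_n) := if (k < j)%N then setT else C k.
have mC1 k : measurable (C1 k) by rewrite /C1; case: ifP.
have mC2 k : measurable (C2 k) by rewrite /C2; case: ifP.
have mbox C' : (forall k, measurable (C' k)) -> measurable (V @^-1` boxset C').
  move=> mC'.
  rewrite (_ : _ @^-1` _ = \bigcap_(k in [set: 'I_n]) [set w | C' k (tnth (V w) k)]).
    by apply: fin_bigcap_measurable => // k _; exact: measurable_coord.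
  by apply/seteqP; split => z /= Bz k; [move=> _; exact: Bz|exact: (Bz k I)].
rewrite [X in (_ = (P \x P)%E X)](_ : _ = (V @^-1` boxset C1) `*` (V @^-1` boxset C2)).
  transitivity (P (V @^-1` boxset C1) * P (V @^-1` boxset C2))%E; last first.
    by apply/esym; apply: product_measure1E; exact: mbox.
  rewrite /= !iV// -big_split/=; apply: eq_bigr => k _.
  rewrite /C1 /C2; case: ifP => _.
    by rewrite (_ : [set w | setT _] = setT) ?probability_setT ?mule1//.
  by rewrite (_ : [set w | setT _] = setT) ?probability_setT ?mul1e//.
apply/seteqP; split => -[w w'] /=.
  move=> H; split => k; have := H k; rewrite /C1 /C2 tnth_mktuple; by case: ifP.
move=> [H1 H2] k; have := H1 k; have := H2 k.
by rewrite /C1 /C2 tnth_mktuple; case: ifP.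
Qed.

Lemma measurable_spliceP j :
  measurable_fun setT (fun ww : T * T => splice j (V ww.1) (V ww.2)).
Proof. by apply: measurable_splice; apply: measurableT_comp. Qed.

(* The coordinates from number [j] on may be resampled from an independent copy,
   which turns conditional expectations given the first [j] coordinates into
   inner integrals. *)
Lemma ge0_integral_splice j (psi : n.-tuple S -> \bar R) :
  measurable_fun setT psi -> (forall z, 0 <= psi z)%E ->
  (\int[P]_w psi (V w) = \int[P]_w \int[P]_w' psi (splice j (V w) (V w')))%E.
Proof.
move=> mpsi psi0.
rewrite (ge0_integral_same_law mV (measurable_spliceP j) (splice_law j))//.
rewrite (@fubini_tonelli1 _ _ _ _ _ P P (fun ww => psi (splice j (V ww.1) (V ww.2))))//.
exact: (measurableT_comp mpsi (measurable_spliceP j)).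
Qed.

Lemma integral_splice j (psi : n.-tuple S -> \bar R) :
  measurable_fun setT psi -> P.-integrable setT (psi \o V) ->
  (\int[P]_w psi (V w) = \int[P]_w \int[P]_w' psi (splice j (V w) (V w')))%E.
Proof.
move=> mpsi ipsi.
rewrite (integral_same_law mV (measurable_spliceP j) (splice_law j))//.
have mp := measurableT_comp mpsi (measurable_spliceP j).
rewrite -(integral12_prod_meas1 (f := fun ww => psi (splice j (V ww.1) (V ww.2))))//.
(* Integrability on the product space follows from equality of laws applied to [abse \o psi]. *)
apply/integrableP; split => //.
have /integrableP[_] := ipsi.
rewrite -(@integral_same_law _ _ _ _ _ _ _ P (P \x P)%E V _ (abse \o psi) mV (measurable_spliceP j) (splice_law j))//.
exact: measurableT_comp.
Qed.

End Splice.

Section SameMarginals.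
Context d (T : measurableType d) (R : realType) (P : probability T R).
Context d' (S : measurableType d').

(** Independence and the marginals determine the measure of every box, hence the law of the
    tuple. *)
Lemma integral_indep_coords n (V V' : T -> n.-tuple S) (psi : n.-tuple S -> \bar R) :
  measurable_fun setT V -> measurable_fun setT V' ->
  coords_indep P V -> coords_indep P V' ->
  (forall k B, measurable B ->
    P [set w | B (tnth (V w) k)] = P [set w | B (tnth (V' w) k)]) ->
  measurable_fun setT psi ->
  (\int[P]_w psi (V w) = \int[P]_w psi (V' w))%E.
Proof.
move=> mV mV' iV iV' VV' mpsi; apply: integral_same_law => //.
apply: eq_law_of_boxes => //.
  exact: le_lt_trans (@probability_le1 _ _ _ P setT measurableT) (ltry _).
by move=> B mB; rewrite /= iV// iV'//; apply: eq_bigr => k _; exact: VV'.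
Qed.

Lemma coords_indep_of_family (I : choiceType) (F : I -> set (set T)) n
    (idx : 'I_n -> I) (V : T -> n.-tuple S) :
  mutually_independent P F -> injective idx ->
  (forall k B, measurable B -> F (idx k) [set w | B (tnth (V w) k)]) ->
  coords_indep P V.
Proof.
move=> iF inj mF B mB.
(* [pick] inverts the injection [idx]; an index outside its image receives the sure event. *)
pose E (i : I) := if [pick k | idx k == i] is Some k
  then [set w | B k (tnth (V w) k)] else setT.
have Eidx k : E (idx k) = [set w | B k (tnth (V w) k)].
  rewrite /E; case: pickP => [k' /eqP/inj -> //|/(_ k)]; by rewrite eqxx.
have := iF [seq idx k | k <- enum 'I_n] E.
rewrite map_inj_uniq// enum_uniq => /(_ isT).
have -> : (\big[setI/setT]_(i <- [seq idx k | k <- enum 'I_n]) E i) = V @^-1` boxset B.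
  rewrite -bigcap_seq; apply/seteqP; split => w /=.
    by move=> H k; have := H (idx k); rewrite Eidx; apply; apply: map_f; rewrite mem_enum.
  by move=> H _ /mapP[k _ ->]; rewrite Eidx; exact: H.
rewrite big_map big_enum/= => ->.
  by apply: eq_bigr => k _; rewrite Eidx.
by move=> i /mapP[k _ ->]; rewrite Eidx; exact: mF.
Qed.
End SameMarginals.

(** * Comparison of integrals weighted by a function of [V] *)

Section Compare.
Context d (T : measurableType d) (R : realType) (P : {measure set T -> \bar R}).
Context d0 (S0 : measurableType d0) (V : T -> S0) (mV : measurable_fun setT V).
Import HBNNSimple.

Let measurable_preV B : measurable B -> measurable (V @^-1` B).
Proof. by move=> mB; rewrite -[X in measurable X]setTI; exact: mV. Qed.

Let integral_nnsfunM (g : {nnsfun S0 >-> R}) (U : T -> R) :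
  measurable_fun setT U -> (forall w, 0 <= U w) ->
  (\int[P]_w (g (V w) * U w)%:E =
   \sum_(r \in range g) r%:E * \int[P]_(w in V @^-1` (g @^-1` [set r])) (U w)%:E)%E.
Proof.
move=> mU U0.
have mg r : measurable (V @^-1` (g @^-1` [set r])) by apply: measurable_preV.
have mf r : measurable_fun [set: T]
    (fun w => (\1_(V @^-1` (g @^-1` [set r])) w * U w)%:E).
  apply/measurable_EFinP; apply: measurable_funM => //.
have E w : (g (V w) * U w)%:E = (\sum_(r \in range g)
    r%:E * (\1_(V @^-1` (g @^-1` [set r])) w * U w)%:E)%E.
  rewrite fsumEFin//; congr (_%:E).
  rewrite fimfunE mulrC mulr_fsumr//; apply: eq_fsbigr => r _.
  by rewrite mulrC -mulrA.
rewrite (eq_integral _ _ (fun w _ => E w)) ge0_integral_fsum//; last 2 first.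
- by move=> r; exact: measurable_funeM.
- move=> r w _; rewrite EFinM muleA mule_ge0 ?lee_fin//.
  exact: (nnfun_muleindic_ge0 g r (V w)).
apply: eq_fsbigr => r; rewrite inE => -[z _ <-].
rewrite ge0_integralZl//; last 2 first.
- by move=> w _; rewrite lee_fin mulr_ge0.
- by rewrite lee_fin.
congr (_ * _)%E; rewrite [RHS]integral_mkcond; apply: eq_integral => w _.
rewrite /patch indicE; case: ifPn => _; rewrite ?mul1r ?mul0r//.
Qed.

(** The comparison passes from indicators to simple functions by linearity and to [k] by monotone
    convergence. It plays the role of taking a factor that depends on [V] out of a conditional
    expectation, and allows infinite integrals. *)
Lemma le_integral_of_preimages (U1 U2 : T -> R) (k : S0 -> R) :
  measurable_fun setT U1 -> (forall w, 0 <= U1 w) ->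
  measurable_fun setT U2 -> (forall w, 0 <= U2 w) ->
  (forall B, measurable B ->
    \int[P]_(w in V @^-1` B) (U1 w)%:E <= \int[P]_(w in V @^-1` B) (U2 w)%:E)%E ->
  measurable_fun setT k -> (forall s, 0 <= k s) ->
  (\int[P]_w (k (V w) * U1 w)%:E <= \int[P]_w (k (V w) * U2 w)%:E)%E.
Proof.
move=> mU1 U10 mU2 U20 U12 mk k0.
have mk' : measurable_fun setT (EFin \o k) by exact/measurable_EFinP.
pose g := nnsfun_approx measurableT mk'.
have cvgU (U : T -> R) : measurable_fun setT U -> (forall w, 0 <= U w) ->
    (\int[P]_w (g n (V w) * U w)%:E @[n --> \oo] --> \int[P]_w (k (V w) * U w)%:E)%E.
  move=> mU U0.
  rewrite [X in _ --> X](_ : _ = (\int[P]_w (limn (fun n => (g n (V w) * U w)%:E) : \bar R))%E).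
    apply: cvg_monotone_convergence => //.
    - move=> n; apply/measurable_EFinP; apply: measurable_funM => //.
      exact: measurableT_comp.
    - by move=> n w _; rewrite lee_fin mulr_ge0.
    - move=> w _ m n mn; rewrite lee_fin ler_wpM2r//.
      exact/lefP/nd_nnsfun_approx.
  apply: eq_integral => w _; apply/esym/cvg_lim => //.
  rewrite EFinM; under eq_fun do rewrite EFinM.
  by apply: cvgeZr => //; apply: cvg_nnsfun_approx => // s _; rewrite lee_fin.
apply: (lee_cvg_to (cvgU _ mU1 U10) (cvgU _ mU2 U20)); apply: nearW => n.
rewrite !integral_nnsfunM// !fsbig_finite//= big_seq [leRHS]big_seq.
apply: lee_sum => r; rewrite in_fset_set// inE => -[z _ <-].
by apply: lee_wpmul2l; [rewrite lee_fin|exact: U12].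
Qed.
End Compare.

(** * Tuples extended by independent points *)

Section Snoc.
Context d' (S : measurableType d').

(** A fresh point is appended to the data, so that its independence from them is again
    [coords_indep] of a single tuple. *)
Definition snoc n (z : n.-tuple S) (s : S) : n.+1.-tuple S := [tuple of rcons z s].
Definition init n (u : n.+1.-tuple S) : n.-tuple S :=
  [tuple tnth u (widen_ord (leqnSn n) k) | k < n].

Lemma tnth_snoc n (z : n.-tuple S) s (k : 'I_n.+1) :
  tnth (snoc z s) k = if insub (val k) is Some i then tnth z i else s.
Proof.
rewrite (tnth_nth s) /= nth_rcons size_tuple.
case: insubP => [i kn ik|]; first by rewrite kn (tnth_nth s) ik.
by rewrite -leqNgt => nk; rewrite ltnNge nk /= eqn_leq nk -ltnS ltn_ord.
Qed.

Lemma tnth_snoc_widen n (z : n.-tuple S) s (k : 'I_n) :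
  tnth (snoc z s) (widen_ord (leqnSn n) k) = tnth z k.
Proof. by rewrite tnth_snoc /= valK. Qed.

Lemma tnth_snoc_max n (z : n.-tuple S) s : tnth (snoc z s) ord_max = s.
Proof. by rewrite tnth_snoc insubF //= ltnn. Qed.

Lemma initK n (z : n.-tuple S) s : init (snoc z s) = z.
Proof. by apply: eq_from_tnth => k; rewrite tnth_mktuple tnth_snoc_widen. Qed.

(** Because [j <= n], the appended coordinate is always among the redrawn ones. *)
Lemma splice_snoc n j (z z' : n.-tuple S) s s' : (j <= n)%N ->
  splice j (snoc z s) (snoc z' s') = snoc (splice j z z') s'.
Proof.
move=> jn; apply: eq_from_tnth => k; rewrite tnth_mktuple !tnth_snoc.
case: insubP => [i kn <-|]; first by rewrite tnth_mktuple.
by rewrite -leqNgt => nk; rewrite ltnNge (leq_trans jn nk).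
Qed.

Lemma measurable_init n : measurable_fun setT (@init n).
Proof.
apply/measurable_fun_tnthP => i.
rewrite (_ : _ \o _ = fun u => tnth u (widen_ord (leqnSn n) i)); first exact: measurable_tnth.
by apply/funext => u; rewrite /= tnth_mktuple.
Qed.

Lemma measurable_snoc d0 (T0 : measurableType d0) n (V : T0 -> n.-tuple S) (U : T0 -> S) :
  measurable_fun setT V -> measurable_fun setT U ->
  measurable_fun setT (fun w => snoc (V w) (U w)).
Proof.
move=> mV mU; apply/measurable_fun_tnthP => i.
have [/= k ik|/= ni] := insubP 'I_n i.
  move=> vk; rewrite (_ : _ \o _ = fun w => tnth (V w) k).
    exact: (measurableT_comp (measurable_tnth k) mV).
  by apply/funext => w; rewrite /= tnth_snoc [val i](esym vk) valK.
rewrite (_ : _ \o _ = U)//.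
by apply/funext => w; rewrite /= tnth_snoc insubN//.
Qed.
End Snoc.

Section Pair.
Context d (T : measurableType d) (R : realType) (P : probability T R).
Context d' (S : measurableType d').
Variables (n : nat) (V : T -> n.-tuple S).
Hypothesis (mV : measurable_fun setT V).

(** The pair is read off the tuple of length [n.+1], to which the resampling identity applies; [U]
    is redrawn together with the tail of [V]. *)
Lemma ge0_integral_splice_pair (U : T -> S) j (psi : n.-tuple S * S -> \bar R) :
  measurable_fun setT U -> coords_indep P (fun w => snoc (V w) (U w)) ->
  (j <= n)%N -> measurable_fun setT psi -> (forall z, 0 <= psi z)%E ->
  (\int[P]_w psi (V w, U w) =
   \int[P]_w \int[P]_w' psi (splice j (V w) (V w'), U w'))%E.
Proof.
move=> mU iVU jn mpsi psi0.
have mp : measurable_fun setT (fun u : n.+1.-tuple S => psi (init u, tnth u ord_max)).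
  apply: (measurableT_comp mpsi); apply/measurable_fun_pair => /=.
    exact: measurable_init.
  exact: measurable_tnth.
have := ge0_integral_splice (measurable_snoc mV mU) iVU j mp (fun=> psi0 _).
under eq_integral do rewrite initK tnth_snoc_max.
move=> ->; apply: eq_integral => w _; apply: eq_integral => w' _.
by rewrite splice_snoc// initK tnth_snoc_max.
Qed.

(** The case [j = n] of resampling, where all of [V] is kept: Fubini for the independent [V] and
    [U]. *)
Lemma integral_splice_pair (U : T -> S) (psi : n.-tuple S * S -> \bar R) :
  measurable_fun setT U -> coords_indep P (fun w => snoc (V w) (U w)) ->
  measurable_fun setT psi ->
  P.-integrable setT (fun w => psi (V w, U w)) ->
  (\int[P]_w psi (V w, U w) =
   \int[P]_w \int[P]_w' psi (V w, U w'))%E.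
Proof.
move=> mU iVU mpsi ipsi.
have mp : measurable_fun setT (fun u : n.+1.-tuple S => psi (init u, tnth u ord_max)).
  apply: (measurableT_comp mpsi); apply/measurable_fun_pair => /=.
    exact: measurable_init.
  exact: measurable_tnth.
have E : (fun u : n.+1.-tuple S => psi (init u, tnth u ord_max)) \o
    (fun w => snoc (V w) (U w)) = (fun w => psi (V w, U w)).
  by apply/funext => w /=; rewrite initK tnth_snoc_max.
have := integral_splice (measurable_snoc mV mU) iVU n mp.
rewrite E => /(_ ipsi).
under eq_integral do rewrite initK tnth_snoc_max.
move=> ->; apply: eq_integral => w _; apply: eq_integral => w' _.
rewrite splice_snoc// initK tnth_snoc_max; congr (psi (_, _)).
by apply: eq_from_tnth => k; rewrite tnth_mktuple ltn_ord.
Qed.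

(** Two points are appended because a replacement involves both the new covariate and the copy of
    one sample. *)
Lemma ge0_integral_splice_triple (U1 U2 : T -> S) j
    (psi : n.-tuple S * (S * S) -> \bar R) :
  measurable_fun setT U1 -> measurable_fun setT U2 ->
  coords_indep P (fun w => snoc (snoc (V w) (U1 w)) (U2 w)) ->
  (j <= n)%N -> measurable_fun setT psi -> (forall z, 0 <= psi z)%E ->
  (\int[P]_w psi (V w, (U1 w, U2 w)) =
   \int[P]_w \int[P]_w' psi (splice j (V w) (V w'), (U1 w', U2 w')))%E.
Proof.
move=> mU1 mU2 iVU jn mpsi psi0.
have mp : measurable_fun setT (fun u : n.+2.-tuple S =>
    psi (init (init u), (tnth (init u) ord_max, tnth u ord_max))).
  apply: (measurableT_comp mpsi); apply/measurable_fun_pair => /=.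
    exact: measurableT_comp (@measurable_init _ _ _) (@measurable_init _ _ _).
  apply/measurable_fun_pair => /=; last exact: measurable_tnth.
  exact: measurableT_comp (measurable_tnth _) (@measurable_init _ _ _).
have := ge0_integral_splice (measurable_snoc (measurable_snoc mV mU1) mU2) iVU j mp (fun=> psi0 _).
under eq_integral do rewrite !initK !tnth_snoc_max.
move=> ->; apply: eq_integral => w _; apply: eq_integral => w' _.
by rewrite splice_snoc ?(leq_trans jn)// initK splice_snoc// initK !tnth_snoc_max.
Qed.
End Pair.

(** * Independence of the samples *)

Section ModelLaw.
Context d (T : measurableType d) (R : realType) (P : probability T R) (p : nat).
Variables (X : nat -> {RV P >-> p.-tuple R}) (Y : nat -> {RV P >-> R}).
Variables (X' : nat -> {RV P >-> p.-tuple R}) (Y' : nat -> {RV P >-> R}).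
Variable Xnew : {RV P >-> p.-tuple R}.
Hypothesis iid : iid_sampling X Y X' Y' Xnew.
Notation S := (p.-tuple R * R)%type.

(* The new covariate seen as a sample; its response 0 is a dummy. *)
Definition new_point (w : T) : S := (Xnew w, 0).

(** All draws take values in the one type [S] and are indexed as in [iid_sampling], so that each
    independence statement below reduces to the injectivity of a map of indices. *)
Definition draw (i : nat + nat + unit) : T -> S :=
  match i with
  | inl (inl l) => sample X Y l
  | inl (inr l) => sample X' Y' l
  | inr _ => new_point
  end.

Lemma measurable_sample (X0 : nat -> {RV P >-> p.-tuple R})
    (Y0 : nat -> {RV P >-> R}) l : measurable_fun setT (sample X0 Y0 l).
Proof. by apply/measurable_fun_pair. Qed.

Lemma measurable_new_point : measurable_fun setT new_point.
Proof. by apply/measurable_fun_pair => /=. Qed.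

Lemma draw_indep n (idx : 'I_n -> nat + nat + unit) (V : T -> n.-tuple S) :
  injective idx -> (forall w k, tnth (V w) k = draw (idx k) w) ->
  coords_indep P V.
Proof.
move=> inj VE; have [ind _ _ _] := iid.
apply: (coords_indep_of_family ind inj) => k B mB.
have -> : [set w | B (tnth (V w) k)] = draw (idx k) @^-1` B.
  by apply/seteqP; split => w /=; rewrite VE.
case: (idx k) => [[l|l]|l] /=.
- by exists B => //; rewrite setTI.
- by exists B => //; rewrite setTI.
(* The event must be one of [Xnew] alone: it is the section of [B] at the dummy response 0. *)
exists [set x | B (x, 0)]; last by rewrite setTI.
rewrite -[X in measurable X]setTI.
have m0 : measurable_fun setT (fun x : p.-tuple R => (x, 0 : R)).
  by apply/measurable_fun_pair => /=.
exact: (m0 measurableT B mB).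
Qed.

Lemma draw_law i B : measurable B ->
  P (draw (inl i) @^-1` B) = P (sample X Y 0%N @^-1` B).
Proof. by have [_ l1 l2 _] := iid; case: i => l mB; [exact: l1|exact: l2]. Qed.

Lemma measurable_data n : measurable_fun setT (data X Y n).
Proof.
apply/measurable_fun_tnthP => i.
rewrite (_ : _ \o _ = sample X Y i); first exact: measurable_sample.
by apply/funext => w; rewrite /= tnth_mktuple.
Qed.

Lemma measurable_data_swap n j : measurable_fun setT (data_swap X Y X' Y' n j).
Proof.
apply/measurable_fun_tnthP => i.
rewrite (_ : _ \o _ = if i == j :> nat then sample X' Y' i else sample X Y i).
  by case: ifP => _; exact: measurable_sample.
by apply/funext => w; rewrite /= tnth_mktuple; case: ifP.
Qed.

Let snoc_idx n (f : nat -> nat + nat + unit) i0 (k : 'I_n.+1) :=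
  if (k < n)%N then f k else i0.

Let snoc_idx_inj n f i0 : injective f -> (forall k, (k < n)%N -> f k <> i0) ->
  injective (@snoc_idx n f i0).
Proof.
move=> finj fi0 k k'; rewrite /snoc_idx.
case: ltnP => kn; case: ltnP => k'n.
- by move=> /finj /val_inj.
- by move=> /fi0 -/(_ kn).
- by move=> /esym/fi0 -/(_ k'n).
move=> _; apply/val_inj/eqP => /=; rewrite eqn_leq.
by rewrite (leq_trans (ltn_ord k : (k <= n)%N) k'n) (leq_trans (ltn_ord k' : (k' <= n)%N) kn).
Qed.

Let tnth_snoc_lt n (z : n.-tuple S) s (k : 'I_n.+1) (kn : (k < n)%N) :
  tnth (snoc z s) k = tnth z (Ordinal kn).
Proof.
by rewrite tnth_snoc; case: insubP => [i ? ik|/negP//]; congr tnth; apply/val_inj.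
Qed.

Let tnth_snoc_ge n (z : n.-tuple S) s (k : 'I_n.+1) : (n <= k)%N ->
  tnth (snoc z s) k = s.
Proof. by rewrite leqNgt => nk; rewrite tnth_snoc insubN. Qed.

Lemma data_sample_indep n :
  coords_indep P (fun w => snoc (data X Y n w) (sample X Y n w)).
Proof.
apply: (@draw_indep _ (fun k => inl (inl (val k)))); first by move=> k k' [/val_inj].
move=> w k; case: (ltnP k n) => kn; first by rewrite tnth_snoc_lt tnth_mktuple.
rewrite tnth_snoc_ge//.
by congr (sample _ _ _ _); apply/eqP; rewrite eqn_leq kn -ltnS ltn_ord.
Qed.

Let swap_draw j k : nat + nat + unit := if k == j then inl (inr k) else inl (inl k).

Let swap_draw_inj j : injective (swap_draw j).
Proof.
rewrite /swap_draw => k k'.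
by case: eqP => kj; case: eqP => kj' // [].
Qed.

Lemma data_swap_new_indep n j :
  coords_indep P (fun w => snoc (data_swap X Y X' Y' n j w) (new_point w)).
Proof.
apply: (@draw_indep _ (@snoc_idx n (swap_draw j) (inr tt))).
  apply: snoc_idx_inj; first exact: swap_draw_inj.
  by move=> k _; rewrite /swap_draw; case: ifP.
move=> w k; rewrite /snoc_idx; case: ltnP => kn; last by rewrite tnth_snoc_ge.
by rewrite tnth_snoc_lt tnth_mktuple /= /swap_draw; case: eqP.
Qed.

Lemma data_new_indep n :
  coords_indep P (fun w => snoc (data X Y n w) (new_point w)).
Proof.
apply: (@draw_indep _ (@snoc_idx n (inl \o inl) (inr tt))).
  by apply: snoc_idx_inj => // k k' [].
move=> w k; rewrite /snoc_idx; case: ltnP => kn; last by rewrite tnth_snoc_ge.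
by rewrite tnth_snoc_lt tnth_mktuple.
Qed.

Lemma data_new_copy_indep n j :
  coords_indep P (fun w => snoc (snoc (data X Y n w) (new_point w)) (sample X' Y' j w)).
Proof.
(* Positions below [n] are samples and position [n] is the new covariate. The values beyond [n] only
   keep [f] injective. *)
pose f k : nat + nat + unit := if (k < n)%N then inl (inl k) else
  if k == n then inr tt else inl (inl k).
apply: (@draw_indep _ (@snoc_idx n.+1 f (inl (inr j)))).
  apply: snoc_idx_inj; last by move=> k _; rewrite /f; case: ifP => // _; case: ifP.
  move=> k k'; rewrite /f; case: ltnP => kn; case: ltnP => kn'.
  - by case.
  - by case: eqP => // _ [].
  - by case: eqP => // _ [].
  - by case: eqP => [->|_]; case: eqP => [->|_] // [].
move=> w k; rewrite /snoc_idx; case: ltnP => kn; last by rewrite tnth_snoc_ge.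
rewrite tnth_snoc_lt /f; case: ltnP => kn'.
  by rewrite tnth_snoc_lt tnth_mktuple.
by rewrite tnth_snoc_ge// (_ : (k == n :> nat)) // eqn_leq kn' -ltnS kn.
Qed.

(** A copy has the law of the sample that it replaces and the coordinates stay independent, so the
    joint law with the new covariate is unchanged. *)
Lemma data_swap_new_law n j (psi : n.+1.-tuple S -> \bar R) :
  measurable_fun setT psi ->
  (\int[P]_w psi (snoc (data_swap X Y X' Y' n j w) (new_point w)) =
   \int[P]_w psi (snoc (data X Y n w) (new_point w)))%E.
Proof.
move=> mpsi.
have m1 := measurable_snoc (@measurable_data_swap n j) measurable_new_point.
have m2 := measurable_snoc (@measurable_data n) measurable_new_point.
apply: (integral_indep_coords m1 m2 (@data_swap_new_indep n j) (@data_new_indep n) _ mpsi).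
move=> k B mB.
have E (V : T -> n.+1.-tuple S) u : (forall w, tnth (V w) k = u w) ->
    P [set w | B (tnth (V w) k)] = P (u @^-1` B).
  by move=> VE; congr (P _); apply/seteqP; split => w /=; rewrite VE.
have [kn|nk] := ltnP k n.
  rewrite (E _ (draw (swap_draw j k))); last first.
    by move=> w; rewrite tnth_snoc_lt tnth_mktuple /= /swap_draw; case: eqP.
  rewrite (E _ (draw (inl (inl (val k))))); last first.
    by move=> w; rewrite tnth_snoc_lt tnth_mktuple.
  by rewrite /swap_draw; case: ifP => _; rewrite !draw_law.
by rewrite !(E _ new_point)// => w; rewrite tnth_snoc_ge.
Qed.

Lemma integral_sample_law l (psi : S -> \bar R) : measurable_fun setT psi ->
  (\int[P]_w psi (sample X Y l w) = \int[P]_w psi (sample X Y 0%N w))%E.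
Proof.
move=> mpsi; apply: integral_same_law => //; try exact: measurable_sample.
by move=> B mB; exact: (draw_law (inl l)).
Qed.

Lemma integral_new_law (psi : p.-tuple R -> \bar R) : measurable_fun setT psi ->
  (\int[P]_w psi (Xnew w) = \int[P]_w psi (X 0%N w))%E.
Proof. by move=> mpsi; have [_ _ _ l4] := iid; exact: integral_same_law. Qed.
End ModelLaw.

(** * Integrals of real functions *)

Lemma weighted_amgm (R : realFieldType) (c x y : R) : 0 < c ->
  x * y <= (2 * c)^-1 * x ^+ 2 + c / 2 * y ^+ 2.
Proof.
move=> c0; rewrite -subr_ge0.
rewrite (_ : _ - _ = (2 * c)^-1 * (x - c * y) ^+ 2); last by field; rewrite gt_eqF.
by rewrite mulr_ge0 ?sqr_ge0// invr_ge0 mulr_ge0// ltW.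
Qed.

Section RealIntegrals.
Context d (T : measurableType d) (R : realType) (P : probability T R).
Implicit Types f g : T -> R.

Lemma ge0_integral_add f g : measurable_fun setT f -> (forall w, 0 <= f w) ->
  measurable_fun setT g -> (forall w, 0 <= g w) ->
  (\int[P]_w (f w + g w)%:E = \int[P]_w (f w)%:E + \int[P]_w (g w)%:E)%E.
Proof.
move=> mf f0 mg g0; under eq_integral do rewrite EFinD.
by apply: ge0_integralD => //; try (by move=> w _; rewrite lee_fin);
  exact/measurable_EFinP.
Qed.

Lemma ge0_integral_scale c f : 0 <= c -> measurable_fun setT f ->
  (forall w, 0 <= f w) ->
  (\int[P]_w (c * f w)%:E = c%:E * \int[P]_w (f w)%:E)%E.
Proof.
move=> c0 mf f0; under eq_integral do rewrite EFinM.
by apply: ge0_integralZl_EFin => //; [move=> w _; rewrite lee_fin|exact/measurable_EFinP].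
Qed.

Lemma ge0_integral_le f g : measurable_fun setT f -> (forall w, 0 <= f w) ->
  measurable_fun setT g -> (forall w, f w <= g w) ->
  (\int[P]_w (f w)%:E <= \int[P]_w (g w)%:E)%E.
Proof.
move=> mf f0 mg fg; apply: ge0_le_integral => //;
  by [move=> w _; rewrite lee_fin|exact/measurable_EFinP].
Qed.

Lemma integral_real_cst c : (\int[P]_w c%:E = c%:E)%E.
Proof.
by rewrite (integral_cst _ measurableT) [X in (_ * X)%E](@probability_setT _ _ _ P) mule1.
Qed.

Lemma ge0_integrable f : measurable_fun setT f -> (forall w, 0 <= f w) ->
  (\int[P]_w (f w)%:E < +oo)%E -> P.-integrable setT (EFin \o f).
Proof.
move=> mf f0 foo; apply/integrableP; split; first exact/measurable_EFinP.
by under eq_integral do rewrite /= ger0_norm//.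
Qed.

Lemma integral_ge0_real f : (forall w, 0 <= f w) -> (0 <= \int[P]_w (f w)%:E)%E.
Proof. by move=> f0; apply: integral_ge0 => w _; rewrite lee_fin. Qed.

Lemma ge0_integral_finite f : (forall w, 0 <= f w) ->
  (\int[P]_w (f w)%:E < +oo)%E -> exists2 m : R, 0 <= m & (\int[P]_w (f w)%:E = m%:E)%E.
Proof.
move=> f0 foo; exists (fine (\int[P]_w (f w)%:E)); first exact/fine_ge0/integral_ge0_real.
by rewrite fineK// ge0_fin_numE// integral_ge0_real.
Qed.

(** Jensen for the square, from 2 m f <= f^2 + m^2 with m the mean. If the mean is infinite, [fine]
    is 0 and the bound is trivial. *)
Lemma fine_integral_sqr_le f : measurable_fun setT f -> (forall w, 0 <= f w) ->
  (((fine (\int[P]_w (f w)%:E)) ^+ 2)%:E <= \int[P]_w (f w ^+ 2)%:E)%E.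
Proof.
move=> mf f0; have := integral_ge0_real f0.
case E : (\int[P]_w (f w)%:E)%E => [m| |] //= m0; last first.
  by rewrite expr0n /=; apply: integral_ge0_real => w; exact: sqr_ge0.
rewrite lee_fin in m0.
have mf2 : measurable_fun setT (fun w => f w ^+ 2) by exact: measurable_funX.
have : (\int[P]_w (2 * m * f w)%:E <= \int[P]_w (f w ^+ 2 + m ^+ 2)%:E)%E.
  apply: ge0_integral_le => //.
  - exact: measurable_funM.
  - by move=> w; rewrite !mulr_ge0.
  - exact: measurable_funD.
  - move=> w; have := sqr_ge0 (f w - m).
    by rewrite !expr2 => H; move: H; lra.
rewrite ge0_integral_scale ?mulr_ge0// E ge0_integral_add//; last 2 first.
  by move=> w; exact: sqr_ge0.
  by move=> w; exact: sqr_ge0.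
rewrite integral_real_cst.
have := @integral_ge0_real (fun w => f w ^+ 2) (fun w => sqr_ge0 _).
case: (\int[P]_w (f w ^+ 2)%:E)%E => [q| |] // _; last by move=> _; exact: leey.
by rewrite !lee_fin => H; move: H; rewrite !expr2; lra.
Qed.

(** The hypothesis on the integral of [f * g] says that [g - f] is orthogonal to [f]. The identity
    (g - f)^2 + 2 f g = g^2 + f^2 has non-negative terms only, so that no subtraction of integrals
    occurs. *)
Lemma integral_sqr_pythagoras f g :
  measurable_fun setT f -> (forall w, 0 <= f w) ->
  measurable_fun setT g -> (forall w, 0 <= g w) ->
  (\int[P]_w (f w ^+ 2)%:E < +oo)%E -> (\int[P]_w (g w ^+ 2)%:E < +oo)%E ->
  (\int[P]_w (f w * g w)%:E = \int[P]_w (f w ^+ 2)%:E)%E ->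
  (\int[P]_w (g w ^+ 2)%:E =
   \int[P]_w (f w ^+ 2)%:E + \int[P]_w ((g w - f w) ^+ 2)%:E)%E.
Proof.
move=> mf f0 mg g0 f2 g2 fg.
have mB : measurable_fun setT (fun w => (g w - f w) ^+ 2).
  by apply: measurable_funX; exact: measurable_funB.
have mM : measurable_fun setT (fun w => f w * g w) by exact: measurable_funM.
have mf2 : measurable_fun setT (fun w => f w ^+ 2) by exact: measurable_funX.
have mg2 : measurable_fun setT (fun w => g w ^+ 2) by exact: measurable_funX.
have : (\int[P]_w ((g w - f w) ^+ 2 + 2 * (f w * g w))%:E =
        \int[P]_w (g w ^+ 2 + f w ^+ 2)%:E)%E.
  by apply: eq_integral => w _; congr (_%:E); ring.
rewrite ge0_integral_add//; last 3 first.
- by move=> w; exact: sqr_ge0.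
- exact: measurable_funM.
- by move=> w; rewrite !mulr_ge0.
rewrite ge0_integral_scale//; last by move=> w; rewrite mulr_ge0.
rewrite ge0_integral_add//; last 2 first.
- by move=> w; exact: sqr_ge0.
- by move=> w; exact: sqr_ge0.
rewrite fg.
have [a _ ->] := ge0_integral_finite (fun w => sqr_ge0 (f w)) f2.
have [b _ ->] := ge0_integral_finite (fun w => sqr_ge0 (g w)) g2.
have := @integral_ge0_real (fun w => (g w - f w) ^+ 2) (fun w => sqr_ge0 _).
case: (\int[P]_w ((g w - f w) ^+ 2)%:E)%E => [c| |] //= _.
by move=> [H]; congr (_%:E); lra.
Qed.

(** AM-GM with weight [c] bounds E[D^2] by E[D^2 N^2] / (2 c) + c E[u^2] / 2, hence by E[D^2] / 2 +
    c q / 2. Since E[D^2] is finite, its half can be moved to the left. *)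
Lemma integral_sqr_le_of_weighted (D N u : T -> R) (c q : R) : 0 < c ->
  measurable_fun setT D -> measurable_fun setT N -> measurable_fun setT u ->
  (\int[P]_w (D w ^+ 2)%:E < +oo)%E ->
  (\int[P]_w (D w ^+ 2 * N w ^+ 2)%:E <= \int[P]_w (D w ^+ 2 * c)%:E)%E ->
  (\int[P]_w (u w ^+ 2)%:E <= q%:E)%E ->
  (\int[P]_w (D w ^+ 2)%:E <= \int[P]_w (`|D w| * `|N w * u w|)%:E)%E ->
  (\int[P]_w (D w ^+ 2)%:E <= (c * q)%:E)%E.
Proof.
move=> c0 mD mN mu D2 DN uq Dle.
have c2 : 0 <= (2 * c)^-1 by rewrite invr_ge0 mulr_ge0// ltW.
have c3 : 0 <= c / 2 by rewrite divr_ge0// ltW.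
have mD2 : measurable_fun setT (fun w => D w ^+ 2) by exact: measurable_funX.
have mu2 : measurable_fun setT (fun w => u w ^+ 2) by exact: measurable_funX.
have mDN : measurable_fun setT (fun w => D w ^+ 2 * N w ^+ 2).
  by apply: measurable_funM => //; exact: measurable_funX.
have DN0 w : 0 <= D w ^+ 2 * N w ^+ 2 by rewrite mulr_ge0 ?sqr_ge0.
have : (\int[P]_w (`|D w| * `|N w * u w|)%:E <=
    \int[P]_w ((2 * c)^-1 * (D w ^+ 2 * N w ^+ 2) + c / 2 * u w ^+ 2)%:E)%E.
  apply: ge0_integral_le => //.
  - apply: measurable_funM; first exact: measurableT_comp.
    by apply: measurableT_comp => //; exact: measurable_funM.
  - by apply: measurable_funD; apply: measurable_funM.
  - move=> w; rewrite -normrM mulrA normrM.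
    rewrite -exprMn -[(D w * N w) ^+ 2]real_normK ?num_real//.
    by rewrite -[u w ^+ 2]real_normK ?num_real//; exact: weighted_amgm.
have := Dle; move=> /le_trans /[apply].
rewrite ge0_integral_add//; last 4 first.
- exact: measurable_funM.
- by move=> w; rewrite mulr_ge0.
- exact: measurable_funM.
- by move=> w; rewrite mulr_ge0 ?sqr_ge0.
rewrite ge0_integral_scale// ge0_integral_scale//; last by move=> w; exact: sqr_ge0.
move: DN; under [X in (_ <= X)%E -> _]eq_integral do rewrite mulrC.
rewrite ge0_integral_scale ?(ltW c0)//; last by move=> w; exact: sqr_ge0.
have [a a0 ->] := ge0_integral_finite (fun w => sqr_ge0 (D w)) D2.
move=> DNa.
have DNoo : (\int[P]_w (D w ^+ 2 * N w ^+ 2)%:E < +oo)%E.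
  by apply: le_lt_trans DNa _; rewrite ltry.
have uoo : (\int[P]_w (u w ^+ 2)%:E < +oo)%E by apply: le_lt_trans uq _; rewrite ltry.
have [b b0 E1] := ge0_integral_finite DN0 DNoo.
have [e e0 E2] := ge0_integral_finite (fun w => sqr_ge0 (u w)) uoo.
move: DNa uq; rewrite E1 E2 !lee_fin => bca eq aH.
have : (2 * c)^-1 * b <= a / 2.
  rewrite ler_pdivrMl ?mulr_gt0// (_ : 2 * c * (a / 2) = c * a)//; by field.
have : c / 2 * e <= c / 2 * q by rewrite ler_wpM2l// divr_ge0// ltW.
by lra.
Qed.

Lemma integral_sqr_dev_le f (m q : R) : measurable_fun setT f ->
  (forall w, 0 <= f w) -> (\int[P]_w (f w)%:E = m%:E)%E ->
  (\int[P]_w (f w ^+ 2)%:E <= (m ^+ 2 + q)%:E)%E ->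
  (\int[P]_w ((f w - m) ^+ 2)%:E <= q%:E)%E.
Proof.
move=> mf f0 fm f2.
have m0 : 0 <= m by rewrite -lee_fin -fm integral_ge0_real.
have mf2 : measurable_fun setT (fun w => f w ^+ 2) by exact: measurable_funX.
have mB : measurable_fun setT (fun w => (f w - m) ^+ 2).
  by apply: measurable_funX; exact: measurable_funB.
have : (\int[P]_w ((f w - m) ^+ 2 + 2 * m * f w)%:E =
        \int[P]_w (f w ^+ 2 + m ^+ 2)%:E)%E.
  by apply: eq_integral => w _; congr (_%:E); ring.
rewrite ge0_integral_add//; last 3 first.
- by move=> w; exact: sqr_ge0.
- exact: measurable_funM.
- by move=> w; rewrite !mulr_ge0.
rewrite ge0_integral_scale ?mulr_ge0// fm ge0_integral_add//; last 2 first.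
- by move=> w; exact: sqr_ge0.
- by move=> w; exact: sqr_ge0.
rewrite integral_real_cst.
have f2oo : (\int[P]_w (f w ^+ 2)%:E < +oo)%E by apply: le_lt_trans f2 _; rewrite ltry.
have [a a0 E] := ge0_integral_finite (fun w => sqr_ge0 (f w)) f2oo.
rewrite E lee_fin in f2; rewrite E.
have := @integral_ge0_real (fun w => (f w - m) ^+ 2) (fun w => sqr_ge0 _).
case: (\int[P]_w ((f w - m) ^+ 2)%:E)%E => [c| |] //= _.
by move=> [H]; rewrite lee_fin; move: f2 H; rewrite !expr2; lra.
Qed.

End RealIntegrals.

(** * Variance of the risk of a stable estimator *)

Section StabilityVariance.
Context d (T : measurableType d) (R : realType) (P : probability T R) (p : nat).
Variables (X : nat -> {RV P >-> p.-tuple R}) (Y : nat -> {RV P >-> R}).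
Variables (X' : nat -> {RV P >-> p.-tuple R}) (Y' : nat -> {RV P >-> R}).
Variable Xnew : {RV P >-> p.-tuple R}.
Hypothesis iid : iid_sampling X Y X' Y' Xnew.
Notation S := (p.-tuple R * R)%type.
Variable (n : nat) (F : n.-tuple S -> p.-tuple R -> R).
Hypothesis mF : measurable_fun setT (fun zx : n.-tuple S * p.-tuple R => F zx.1 zx.2).

Let dat := data X Y n.
Let swp := data_swap X Y X' Y' n.
(** [F] is later the error [f z x - f0 x], so that integrating [Phi z] over the new covariate gives
    the risk. *)
Let Phi z x := F z x ^+ 2.
(* [phi j (dat w)] is the conditional expectation of the risk given the first
   [j] samples; [rphi] is its real version, with value 0 where [phi] is
   infinite. *)
Let phi j z : \bar R := (\int[P]_w' (Phi (splice j z (dat w')) (Xnew w'))%:E)%E.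
Let rphi j z : R := fine (phi j z).

Let Phi0 z x : 0 <= Phi z x. Proof. exact: sqr_ge0. Qed.
Let mdat : measurable_fun setT dat. Proof. exact: measurable_data. Qed.
Let mswp j : measurable_fun setT (swp j). Proof. exact: measurable_data_swap. Qed.

Let mFc d0 (T0 : measurableType d0) (z : T0 -> n.-tuple S) (x : T0 -> p.-tuple R) :
  measurable_fun setT z -> measurable_fun setT x ->
  measurable_fun setT (fun w => F (z w) (x w)).
Proof.
by move=> mz mx; exact: (measurableT_comp mF (measurable_fun_pair mz mx)).
Qed.

Let mPhic d0 (T0 : measurableType d0) (z : T0 -> n.-tuple S) (x : T0 -> p.-tuple R) :
  measurable_fun setT z -> measurable_fun setT x ->
  measurable_fun setT (fun w => Phi (z w) (x w)).
Proof. by move=> mz mx; apply: measurable_funX; exact: mFc. Qed.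

Let mphi j : measurable_fun setT (phi j).
Proof.
apply: (@measurable_fun_fubini_tonelli_F _ _ _ _ _ P
  (fun zw : n.-tuple S * T => (Phi (splice j zw.1 (dat zw.2)) (Xnew zw.2))%:E)).
- apply/measurable_EFinP; apply: mPhic; last exact: measurableT_comp.
  by apply: measurable_splice => //; exact: measurableT_comp.
- by move=> zw; rewrite lee_fin.
Qed.

Let mrphi j : measurable_fun setT (rphi j).
Proof. by apply: (measurableT_comp _ (mphi j)). Qed.

Let phi_ge0 j z : (0 <= phi j z)%E.
Proof. by apply: integral_ge0_real => w. Qed.

Let rphi_ge0 j z : 0 <= rphi j z.
Proof. exact/fine_ge0/phi_ge0. Qed.

Let splice_splice i j (z z' y : n.-tuple S) : (j <= i)%N ->
  splice j (splice i z z') y = splice j z y.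
Proof.
move=> ji; apply: eq_from_tnth => k; rewrite !tnth_mktuple.
by case: ltnP => // kj; rewrite (leq_trans kj ji).
Qed.

(** This invariance is the form in which measurability with respect to the first samples is used. *)
Let rphi_splice i j z z' : (j <= i)%N -> rphi j (splice i z z') = rphi j z.
Proof.
move=> ji; congr fine; apply: eq_integral => w _.
by rewrite splice_splice.
Qed.

Let m : R := fine (\int[P]_w (Phi (dat w) (Xnew w))%:E)%E.
Hypothesis F4 : (\int[P]_w ((F (dat w) (Xnew w)) ^+ 4)%:E < +oo)%E.

Let mPhin : measurable_fun setT (fun w => Phi (dat w) (Xnew w)).
Proof. exact: mPhic. Qed.

Let Phi_lty : (\int[P]_w (Phi (dat w) (Xnew w))%:E < +oo)%E.
Proof.
apply: (@le_lt_trans _ _ (\int[P]_w ((F (dat w) (Xnew w)) ^+ 4 + 1)%:E)%E).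
  apply: ge0_integral_le => //.
    by apply: measurable_funD => //; apply: measurable_funX; exact: mFc.
  move=> w; rewrite /Phi; have := sqr_ge0 (F (dat w) (Xnew w) ^+ 2 - 1).
  rewrite (_ : F (dat w) (Xnew w) ^+ 4 = (F (dat w) (Xnew w) ^+ 2) ^+ 2); last by rewrite -exprM.
  have := sqr_ge0 (F (dat w) (Xnew w)).
  by move: (F (dat w) (Xnew w) ^+ 2) => t; rewrite !expr2 => t0 H; nra.
rewrite ge0_integral_add ?integral_real_cst//.
- by rewrite lte_add_pinfty// ltry.
- by apply: measurable_funX; exact: mFc.
- by move=> w; rewrite (_ : 4 = 2 * 2)%N// exprM sqr_ge0.
Qed.

Let mE : (\int[P]_w (Phi (dat w) (Xnew w))%:E)%E = m%:E.
Proof. by rewrite /m fineK// ge0_fin_numE// integral_ge0_real. Qed.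

Let mpair (k : n.-tuple S -> R) :
  measurable_fun setT k ->
  measurable_fun setT (fun zs : n.-tuple S * S => k zs.1 * Phi zs.1 zs.2.1).
Proof.
move=> mk; apply: measurable_funM; first exact: measurableT_comp.
by apply: mPhic => //; exact: measurableT_comp.
Qed.

(** Redrawing the coordinates from [i] on leaves the weight [k] fixed and turns [Phi] into [phi i]:
    this is the defining property of the conditional expectation, tested on non-negative weights. *)
Let integral_phi i (k : n.-tuple S -> R) : (i <= n)%N ->
  measurable_fun setT k -> (forall z, 0 <= k z) ->
  (forall z z', k (splice i z z') = k z) ->
  (\int[P]_w (k (dat w) * Phi (dat w) (Xnew w))%:E =
   \int[P]_w ((k (dat w))%:E * phi i (dat w)))%E.
Proof.
move=> le_in mk k0 kS.
rewrite (@ge0_integral_splice_pair _ _ _ P _ _ _ dat mdat (new_point Xnew) i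
  (fun zs => (k zs.1 * Phi zs.1 zs.2.1)%:E))//.
- apply: eq_integral => w _ /=; under eq_integral do rewrite kS EFinM.
  rewrite ge0_integralZl_EFin//.
  + by move=> w' _; rewrite lee_fin.
  + apply/measurable_EFinP/mPhic => //.
    exact: measurable_splice.
- exact: measurable_new_point.
- exact: data_new_indep iid _.
- by apply/measurable_EFinP; exact: mpair mk.
- by move=> z; rewrite lee_fin mulr_ge0.
Qed.

(** With weight 1, [phi j] has the finite mean [m], so it is finite almost everywhere. *)
Let phi_ae j : (j <= n)%N -> {ae P, forall w, phi j (dat w) = (rphi j (dat w))%:E}.
Proof.
move=> jn.
have E : (\int[P]_w phi j (dat w) = m%:E)%E.
  rewrite -mE; have := @integral_phi j (fun=> 1) jn.
  under eq_integral do rewrite mul1r.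
  move=> -> //; first by apply: eq_integral => w _; rewrite mul1e.
have : P.-integrable setT (phi j \o dat).
  apply/integrableP; split; first exact: measurableT_comp.
  under eq_integral do rewrite /= gee0_abs//.
  by rewrite E ltry.
move=> /(integrable_ae measurableT).
by apply: filterS => w /(_ I) H; rewrite /rphi fineK.
Qed.

Let integral_rphi i (k : n.-tuple S -> R) : (i <= n)%N ->
  measurable_fun setT k -> (forall z, 0 <= k z) ->
  (forall z z', k (splice i z z') = k z) ->
  (\int[P]_w (k (dat w) * Phi (dat w) (Xnew w))%:E =
   \int[P]_w (k (dat w) * rphi i (dat w))%:E)%E.
Proof.
move=> le_in mk k0 kS; rewrite (integral_phi le_in mk k0 kS).
apply: ge0_ae_eq_integral => //.
- apply: emeasurable_funM; last exact: measurableT_comp.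
  by apply/measurable_EFinP; exact: measurableT_comp.
- apply/measurable_EFinP; apply: measurable_funM; exact: measurableT_comp.
- by move=> w _; rewrite mule_ge0// lee_fin.
- by move=> w _; rewrite lee_fin mulr_ge0.
- by have := phi_ae le_in; apply: filterS => w H _; rewrite EFinM H.
Qed.

(** Conditional Jensen: the square of the inner integral is at most the inner integral of [Phi ^ 2],
    whose mean is the fourth moment. *)
Let rphi_sqr_lty j : (j <= n)%N -> (\int[P]_w (rphi j (dat w) ^+ 2)%:E < +oo)%E.
Proof.
move=> jn; apply: le_lt_trans F4.
rewrite [leRHS](_ : _ = \int[P]_w ((Phi (dat w) (Xnew w)) ^+ 2)%:E)%E; last first.
  by apply: eq_integral => w _; rewrite /Phi -exprM.
rewrite (@ge0_integral_splice_pair _ _ _ P _ _ _ dat mdat (new_point Xnew) j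
  (fun zs => (Phi zs.1 zs.2.1 ^+ 2)%:E))//.
- apply: ge0_le_integral => //.
  + by move=> w _; rewrite lee_fin sqr_ge0.
  + by apply/measurable_EFinP; apply: measurable_funX; exact: measurableT_comp.
  + apply: (@measurable_fun_fubini_tonelli_F _ _ _ _ _ P
      (fun ww : T * T => (Phi (splice j (dat ww.1) (dat ww.2)) (Xnew ww.2) ^+ 2)%:E)).
      apply/measurable_EFinP; apply: measurable_funX; apply: mPhic; last exact: measurableT_comp.
      by apply: measurable_splice => //; exact: measurableT_comp.
    by move=> zw; rewrite lee_fin sqr_ge0.
  + move=> w _ /=; apply: fine_integral_sqr_le => //.
    by apply: mPhic => //; apply: measurable_splice.
- exact: measurable_new_point.
- exact: data_new_indep iid _.
- by apply/measurable_EFinP; apply: measurable_funX; apply: mPhic => //; exact: measurableT_comp.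
- by move=> z; rewrite lee_fin sqr_ge0.
Qed.

Let D j z := rphi j.+1 z - rphi j z.

Let mD j : measurable_fun setT (D j).
Proof. exact: measurable_funB. Qed.

Let D_splice j z z' : D j (splice j.+1 z z') = D j z.
Proof. by rewrite /D !rphi_splice. Qed.

(* Orthogonality of the martingale increments [D j (dat w)]. *)
Let rphi_step j : (j < n)%N ->
  (\int[P]_w (rphi j.+1 (dat w) ^+ 2)%:E =
   \int[P]_w (rphi j (dat w) ^+ 2)%:E + \int[P]_w (D j (dat w) ^+ 2)%:E)%E.
Proof.
move=> jn.
have mr i : measurable_fun setT (fun w => rphi i (dat w)) by exact: measurableT_comp.
apply: (integral_sqr_pythagoras (mr j) (fun=> rphi_ge0 _ _) (mr j.+1)
  (fun=> rphi_ge0 _ _) (rphi_sqr_lty (ltnW jn)) (rphi_sqr_lty jn)).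
(* Both [rphi j * rphi j.+1] and [rphi j ^ 2] have the integral of [rphi j * Phi]; this is the
   orthogonality required. *)
rewrite -integral_rphi//; last by move=> z z'; rewrite rphi_splice.
rewrite (integral_rphi (ltnW jn))//.
by move=> z z'; rewrite rphi_splice.
Qed.

Let swp_law j (psi : n.-tuple S -> p.-tuple R -> \bar R) :
  measurable_fun setT (fun zx : n.-tuple S * p.-tuple R => psi zx.1 zx.2) ->
  (\int[P]_w psi (swp j w) (Xnew w) = \int[P]_w psi (dat w) (Xnew w))%E.
Proof.
move=> mpsi.
have mu : measurable_fun setT (fun u : n.+1.-tuple S =>
    psi (init u) (tnth u ord_max).1).
  apply: (measurableT_comp mpsi (measurable_fun_pair _ _)); first exact: measurable_init.
  by apply: (measurableT_comp _ (measurable_tnth _)).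
have := data_swap_new_law iid j mu.
by under eq_integral do rewrite initK tnth_snoc_max;
  under [X in _ = X -> _]eq_integral do rewrite initK tnth_snoc_max.
Qed.

(** Exhibits the swapped data as a function of the data and of one copy, the form needed to redraw
    the tail in both at once. *)
Let setc j (z : n.-tuple S) (s : S) : n.-tuple S :=
  [tuple if k == j :> nat then s else tnth z k | k < n].

Let msetc j d0 (T0 : measurableType d0) (z : T0 -> n.-tuple S) (s : T0 -> S) :
  measurable_fun setT z -> measurable_fun setT s ->
  measurable_fun setT (fun w => setc j (z w) (s w)).
Proof.
move=> mz ms; apply/measurable_fun_tnthP => i.
rewrite (_ : _ \o _ = if i == j :> nat then s else fun w => tnth (z w) i).
  by case: ifP => _ //; exact: (measurableT_comp (measurable_tnth i) mz).
by apply/funext => w; rewrite /= tnth_mktuple; case: ifP.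
Qed.

Let swpE j w : swp j w = setc j (dat w) (sample X' Y' j w).
Proof.
apply: eq_from_tnth => k; rewrite !tnth_mktuple.
by case: eqP => // ->.
Qed.

(** Coordinate [j] is overwritten, so only the first [j] coordinates of [z] survive. This is why the
    swapped data lead to [phi j] rather than [phi j.+1]. *)
Let setc_splice j z z' s : setc j (splice j.+1 z z') s = splice j z (setc j z' s).
Proof.
apply: eq_from_tnth => k; rewrite !tnth_mktuple.
by rewrite ltnS; case: ltngtP.
Qed.

(** At [z = dat w], the conditional expectation of |Phi(dat) - Phi(swp j)| given the first [j.+1]
    samples. *)
Let e j z : \bar R := (\int[P]_w
  (`|Phi (splice j.+1 z (dat w)) (Xnew w) - Phi (splice j z (swp j w)) (Xnew w)|)%:E)%E.

(** The swapped data have the law of the data, so their inner integral is [phi j]. Hence [D j] is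
    the inner integral of the difference of the two values of [Phi], and the absolute value moves
    inside. Finiteness of both terms makes the subtraction legitimate. *)
Let D_le_e j z : phi j z = (rphi j z)%:E -> phi j.+1 z = (rphi j.+1 z)%:E ->
  (`|D j z|%:E <= e j z)%E.
Proof.
move=> fj fj1.
have mA : measurable_fun setT (fun w => Phi (splice j.+1 z (dat w)) (Xnew w)).
  by apply: mPhic => //; exact: measurable_splice.
have mB : measurable_fun setT (fun w => Phi (splice j z (swp j w)) (Xnew w)).
  by apply: mPhic => //; exact: measurable_splice.
have IB : (\int[P]_w (Phi (splice j z (swp j w)) (Xnew w))%:E = (rphi j z)%:E)%E.
  rewrite -fj /phi (@swp_law j (fun y x => (Phi (splice j z y) x)%:E))//.
  apply/measurable_EFinP; apply: mPhic => //.
  by apply: measurable_splice.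
have -> : (`|D j z|%:E = `|\int[P]_w (Phi (splice j.+1 z (dat w)) (Xnew w) -
    Phi (splice j z (swp j w)) (Xnew w))%:E|)%E.
  under eq_integral do rewrite EFinB.
  rewrite integralB_EFin//; first by rewrite IB -/(phi j.+1 z) fj1 -EFinB.
    by apply: ge0_integrable => //; rewrite -/(phi j.+1 z) fj1 ltry.
  by apply: ge0_integrable => //; rewrite IB ltry.
apply: (le_trans (le_abse_integral _ _ _)) => //.
by apply/measurable_EFinP; exact: measurable_funB.
Qed.

(** One factor of [D j ^ 2] is bounded by [e j]. The other is unaffected by redrawing the
    coordinates from [j.+1] on, so it can enter the inner integral, which is then undone. *)
Let D_le_nabla j : (j < n)%N ->
  (\int[P]_w (D j (dat w) ^+ 2)%:E <=
   \int[P]_w (`|D j (dat w)| *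
     `|Phi (dat w) (Xnew w) - Phi (swp j w) (Xnew w)|)%:E)%E.
Proof.
move=> jn.
have me : measurable_fun setT (e j).
  apply: (@measurable_fun_fubini_tonelli_F _ _ _ _ _ P (fun zw : n.-tuple S * T =>
    (`|Phi (splice j.+1 zw.1 (dat zw.2)) (Xnew zw.2) -
       Phi (splice j zw.1 (swp j zw.2)) (Xnew zw.2)|)%:E)) => [|zw]; last by rewrite lee_fin.
  apply/measurable_EFinP; apply: measurableT_comp => //; apply: measurable_funB;
    apply: mPhic; try (by exact: measurableT_comp);
    by apply: measurable_splice => //; exact: measurableT_comp.
have mDd : measurable_fun setT (fun w => D j (dat w)) by exact: measurableT_comp.
have -> : (\int[P]_w (`|D j (dat w)| * `|Phi (dat w) (Xnew w) - Phi (swp j w) (Xnew w)|)%:E =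
    \int[P]_w (`|D j (dat w)|%:E * e j (dat w)))%E.
  under eq_integral do rewrite swpE.
  rewrite (@ge0_integral_splice_triple _ _ _ P _ _ _ dat mdat (new_point Xnew)
    (sample X' Y' j) j.+1 (fun zs => (`|D j zs.1| *
      `|Phi zs.1 zs.2.1.1 - Phi (setc j zs.1 zs.2.2) zs.2.1.1|)%:E))//.
  - apply: eq_integral => w _ /=.
    under eq_integral do rewrite D_splice setc_splice -swpE EFinM.
    rewrite ge0_integralZl_EFin//.
    apply/measurable_EFinP; apply: measurableT_comp => //; apply: measurable_funB;
      by apply: mPhic => //; apply: measurable_splice.
  - exact: measurable_new_point.
  - exact: measurable_sample.
  - exact: data_new_copy_indep iid _ _.
  - apply/measurable_EFinP; apply: measurable_funM.
      by apply: measurableT_comp => //; exact: measurableT_comp.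
    apply: measurableT_comp => //; apply: measurable_funB; apply: mPhic => //.
    + by apply: measurableT_comp => //; exact: measurableT_comp.
    + by apply: msetc => //; exact: measurableT_comp.
    + by apply: measurableT_comp => //; exact: measurableT_comp.
apply: ae_ge0_le_integral => //.
- by move=> w _; rewrite lee_fin sqr_ge0.
- by apply/measurable_EFinP; apply: measurable_funX.
- by move=> w _; rewrite mule_ge0 ?lee_fin//; apply: integral_ge0_real.
- apply: emeasurable_funM; last exact: measurableT_comp.
  by apply/measurable_EFinP; exact: measurableT_comp.
have := phi_ae (ltnW jn); have := phi_ae jn.
apply: filterS2 => w H1 H0 _.
rewrite -real_normK ?num_real// expr2 EFinM; apply: lee_wpmul2l; first by rewrite lee_fin.
exact: D_le_e.
Qed.
Variable c : R.
Hypothesis c_gt0 : 0 < c.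
Let nab j w := F (dat w) (Xnew w) - F (swp j w) (Xnew w).
Hypothesis stab : forall j A, (j < n)%N -> measurable A -> past X Y j.+1 A ->
  (\int[P]_(w in A) (nab j w ^+ 2)%:E <= c%:E * P A)%E.

Let z0 : n.-tuple S := nseq_tuple n (nseq_tuple p 0, 0).
(** The first [j] samples as a tuple of fixed length, padded with constants: its events belong to
    [past X Y j], and [D j] factors through [V j.+1]. *)
Let V j w := splice j (dat w) z0.

Let mV j : measurable_fun setT (V j).
Proof. exact: measurable_splice. Qed.

Let past_V j B : measurable B -> past X Y j (V j @^-1` B).
Proof.
move=> mB; pose G := \bigcup_(l in `I_j) g_sigma_algebra_preimage (sample X Y l).
suff mVG : measurable_fun (T := g_sigma_algebraType G) setT (V j : g_sigma_algebraType G -> _).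
  by have := mVG measurableT B mB; rewrite setTI.
apply/measurable_fun_tnthP => k.
have [kj|jk] := ltnP k j; last first.
  rewrite (_ : _ \o _ = cst (tnth z0 k)); first exact: measurable_cst.
  by apply/funext => w; rewrite /= tnth_mktuple ltnNge jk.
rewrite (_ : _ \o _ = (sample X Y k : g_sigma_algebraType G -> S)).
  move=> _ C mC; rewrite setTI; apply: sub_sigma_algebra; exists (val k) => //.
  by exists C => //; rewrite setTI.
by apply/funext => w; rewrite /= tnth_mktuple kj tnth_mktuple.
Qed.

(* Bound [|D| |N u|] by AM-GM and move the stability bound on [N ^ 2] inside
   the weight [D ^ 2], which depends on the first [j.+1] samples only. *)
Let D_sqr_le j : (j < n)%N -> (\int[P]_w (D j (dat w) ^+ 2)%:E <= (c * (4 * m))%:E)%E.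
Proof.
move=> jn.
have mDd : measurable_fun setT (fun w => D j (dat w)) by exact: measurableT_comp.
have mFd : measurable_fun setT (fun w => F (dat w) (Xnew w)) by exact: mFc.
have mFs : measurable_fun setT (fun w => F (swp j w) (Xnew w)) by exact: mFc.
have mN : measurable_fun setT (nab j) by exact: measurable_funB.
have D2 : (\int[P]_w (D j (dat w) ^+ 2)%:E < +oo)%E.
  apply: le_lt_trans (rphi_sqr_lty jn); rewrite (rphi_step jn) leeDr//.
  by apply: integral_ge0_real => w; exact: sqr_ge0.
apply: (@integral_sqr_le_of_weighted _ _ _ P (fun w => D j (dat w)) (nab j)
   (fun w => F (dat w) (Xnew w) + F (swp j w) (Xnew w)) c (4 * m) c_gt0 mDd mN _ D2).
- exact: measurable_funD.
- have DV w : D j (dat w) = D j (V j.+1 w) by rewrite /V D_splice.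
  rewrite (eq_integral (fun w => (D j (V j.+1 w) ^+ 2 * nab j w ^+ 2)%:E)); last by move=> w _; rewrite -DV.
  rewrite [leRHS](eq_integral (fun w => (D j (V j.+1 w) ^+ 2 * c)%:E)); last by move=> w _; rewrite -DV.
  apply: (@le_integral_of_preimages _ _ _ P _ _ _ (mV j.+1) (fun w => nab j w ^+ 2)
    (fun=> c) (fun z => D j z ^+ 2)).
  + exact: measurable_funX.
  + by move=> w; exact: sqr_ge0.
  + exact: measurable_cst.
  + by move=> _; exact: ltW.
  + move=> B mB.
    have mVB : measurable (V j.+1 @^-1` B).
      by rewrite -[X in measurable X]setTI; exact: mV.
    by rewrite (integral_cst _ mVB); apply: stab => //; exact: past_V.
  + exact: measurable_funX.
  + by move=> z; exact: sqr_ge0.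
(* Source of the factor 4: (s + t)^2 <= 2 s^2 + 2 t^2, and both squared errors have mean [m] because
   the swapped data have the law of the data. *)
- apply: (@le_trans _ _ (\int[P]_w (2 * Phi (dat w) (Xnew w) + 2 * Phi (swp j w) (Xnew w))%:E)%E).
    apply: ge0_integral_le => //.
    + by apply: measurable_funX; exact: measurable_funD.
    + by move=> w; exact: sqr_ge0.
    + by apply: measurable_funD; apply: measurable_funM => //; exact: mPhic.
    + move=> w; rewrite /Phi.
      have := sqr_ge0 (F (dat w) (Xnew w) - F (swp j w) (Xnew w)).
      by move: (F _ _) (F _ _) => s t; rewrite !expr2; lra.
  have mP2 : measurable_fun setT (fun w => Phi (swp j w) (Xnew w)) by exact: mPhic.
  rewrite ge0_integral_add//; last 4 first.
  + exact: measurable_funM.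
  + by move=> w; rewrite mulr_ge0.
  + exact: measurable_funM.
  + by move=> w; rewrite mulr_ge0.
  rewrite (ge0_integral_scale P _ mPhin)// (ge0_integral_scale P _ mP2)//.
  rewrite (@swp_law j (fun y x => (Phi y x)%:E)).
    by rewrite mE -!EFinM -EFinD lee_fin; lra.
  by apply/measurable_EFinP; apply: mPhic.
have := D_le_nabla jn.
(* The difference of squares factors as [nab j] times the sum of the two errors. *)
rewrite [X in (_ <= X)%E -> _](eq_integral (fun w => (`|D j (dat w)| *
  `|nab j w * (F (dat w) (Xnew w) + F (swp j w) (Xnew w))|)%:E))//.
move=> w _; congr ((_ * `|_|)%:E); rewrite /nab /Phi; ring.
Qed.

(** [rphi 0] is the constant [m] and [rphi n] is the risk. By orthogonality the second moments of
    the [n] increments add up, and each is at most [c * (4 * m)]. *)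
Lemma variance_conditional_risk :
  (\int[P]_w ((fine (\int[P]_w' (F (dat w) (Xnew w') ^+ 2)%:E) - m) ^+ 2)%:E
   <= (n%:R * (c * (4 * m)))%:E)%E.
Proof.
have phin z : rphi n z = fine (\int[P]_w' (F z (Xnew w') ^+ 2)%:E)%E.
  congr fine; apply: eq_integral => w _; rewrite /Phi; congr (F _ _ ^+ 2)%:E.
  by apply: eq_from_tnth => k; rewrite tnth_mktuple ltn_ord.
have phi0 z : rphi 0 z = m.
  congr fine; apply: eq_integral => w _; rewrite /Phi; congr (F _ _ ^+ 2)%:E.
  by apply: eq_from_tnth => k; rewrite tnth_mktuple.
under eq_integral do rewrite -phin.
have mr i : measurable_fun setT (fun w => rphi i (dat w)) by exact: measurableT_comp.
apply: (@integral_sqr_dev_le _ _ _ P (fun w => rphi n (dat w)) m) => //.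
  rewrite -mE; have := @integral_rphi n (fun=> 1) (leqnn n).
  under eq_integral do rewrite mul1r.
  move=> -> //; by apply: eq_integral => w _; rewrite mul1r.
suff H j : (j <= n)%N ->
    (\int[P]_w (rphi j (dat w) ^+ 2)%:E <= (m ^+ 2 + j%:R * (c * (4 * m)))%:E)%E.
  exact: H.
elim: j => [_|j IH jn].
  under eq_integral do rewrite phi0.
  by rewrite integral_real_cst mul0r addr0.
rewrite (rphi_step jn); apply: (le_trans (leeD (IH (ltnW jn)) (D_sqr_le jn))).
by rewrite -EFinD lee_fin -natr1; lra.
Qed.
End StabilityVariance.

(** * Martingale differences *)

Section PairZero.
Context d (T : measurableType d) (R : realType) (P : probability T R).
Context d' (S : measurableType d').
Variables (n : nat) (V : T -> n.-tuple S) (U : T -> S).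
Hypotheses (mV : measurable_fun setT V) (mU : measurable_fun setT U).
Hypothesis iVU : coords_indep P (fun w => snoc (V w) (U w)).

Lemma splice_all (z z' : n.-tuple S) : splice n z z' = z.
Proof. by apply: eq_from_tnth => k; rewrite tnth_mktuple ltn_ord. Qed.

Lemma ge0_integral_indep (psi : n.-tuple S * S -> \bar R) :
  measurable_fun setT psi -> (forall z, 0 <= psi z)%E ->
  (\int[P]_w psi (V w, U w) = \int[P]_w \int[P]_w' psi (V w, U w'))%E.
Proof.
move=> mpsi psi0; rewrite (ge0_integral_splice_pair mV mU iVU (leqnn n) mpsi psi0).
by apply: eq_integral => w _; apply: eq_integral => w' _; rewrite splice_all.
Qed.

(** Fubini: the inner integral over the fresh [U] vanishes for almost every value of [V]. *)
Lemma integral_indep_eq0 (psi : n.-tuple S * S -> \bar R) :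
  measurable_fun setT psi -> P.-integrable setT (fun w => psi (V w, U w)) ->
  {ae P, forall w, (\int[P]_w' psi (V w, U w') = 0)%E} ->
  (\int[P]_w psi (V w, U w) = 0)%E.
Proof.
move=> mpsi ipsi psi0; rewrite (integral_splice_pair mV mU iVU)//.
have mpsiVU : measurable_fun setT (fun ww : T * T => psi (V ww.1, U ww.2)).
  apply: (measurableT_comp mpsi); apply: measurable_fun_pair; exact: measurableT_comp.
have int2 : (P \x P)%E.-integrable setT (fun ww : T * T => psi (V ww.1, U ww.2)).
  apply/(integrable12ltyP _ _ mpsiVU).
  have /integrableP[_] := ipsi.
  have mabs : measurable_fun setT (abse \o psi) by exact: measurableT_comp.
  by rewrite (@ge0_integral_indep (abse \o psi) mabs (fun=> abse_ge0 _)).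
have mF := measurable_fubini_F int2.
transitivity (\int[P]_w (cst 0%E w) : \bar R)%E; last by rewrite integral0.
have h : ae_eq P setT (fubini_F P (fun ww : T * T => psi (V ww.1, U ww.2))) (cst 0%E).
  by move: psi0; apply: filterS => w H _.
exact: (ae_eq_integral _ _ measurableT mF (measurable_cst 0%E) h).
Qed.
End PairZero.

Section MartingaleDifferences.
Context d (T : measurableType d) (R : realType) (P : probability T R) (p : nat).
Variables (X : nat -> {RV P >-> p.-tuple R}) (Y : nat -> {RV P >-> R}).
Variables (X' : nat -> {RV P >-> p.-tuple R}) (Y' : nat -> {RV P >-> R}).
Variable Xnew : {RV P >-> p.-tuple R}.
Hypothesis iid : iid_sampling X Y X' Y' Xnew.
Notation S := (p.-tuple R * R)%type.

Lemma data_snoc n w : data X Y n.+1 w = snoc (data X Y n w) (sample X Y n w).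
Proof.
apply: eq_from_tnth => k; rewrite tnth_snoc tnth_mktuple.
case: insubP => [i kn <-|]; first by rewrite tnth_mktuple.
by rewrite -leqNgt => nk; congr sample; apply/eqP; rewrite eqn_leq nk -ltnS ltn_ord.
Qed.

Variable m : forall l : nat, l.-tuple S -> S -> R.
Hypothesis mm : forall l, measurable_fun setT (fun zs : l.-tuple S * S => m zs.1 zs.2).
Let M l w := m (data X Y l w) (sample X Y l w).
Variable q : nat -> R.
Hypothesis Mq : forall l, (\int[P]_w (M l w ^+ 2)%:E <= (q l)%:E)%E.
Hypothesis M0 : forall l, {ae P, forall w,
  P.-integrable setT (fun w' => (m (data X Y l w) (sample X Y l w'))%:E) /\
  (\int[P]_w' (m (data X Y l w) (sample X Y l w'))%:E = 0)%E}.

(** The partial sum recomputed from the data tuple by recursion on its length. The cross term is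
    thus a function of the pair formed by the past data and one fresh sample. *)
Let K := fix K n : n.-tuple S -> R :=
  match n with
  | 0%N => fun=> 0
  | n.+1 => fun u => K n (init u) + m (init u) (tnth u ord_max)
  end.

Let KE n w : K (data X Y n w) = \sum_(0 <= l < n) M l w.
Proof.
elim: n => [|n IH]; first by rewrite big_nil.
by rewrite big_nat_recr//= data_snoc initK tnth_snoc_max IH.
Qed.

Let mK n : measurable_fun setT (@K n).
Proof.
elim: n => [|n IH] /=; first exact: measurable_cst.
apply: measurable_funD; first exact: measurableT_comp IH (@measurable_init _ _ _).
have H : measurable_fun setT (fun u : n.+1.-tuple S => (init u, tnth u ord_max)).
  apply/measurable_fun_pair; first exact: measurable_init.
  exact: measurable_tnth.
exact: (measurableT_comp (@mm n) H).
Qed.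

Let mM l : measurable_fun setT (M l).
Proof.
exact: (measurableT_comp (@mm l)
  (measurable_fun_pair (@measurable_data _ _ _ _ _ X Y l) (@measurable_sample _ _ _ _ _ X Y l))).
Qed.

(** In the square of the partial sum, the cross term of the past sum with the next difference has
    mean zero, since [m] is centered once the data are fixed. *)
Lemma integral_sqr_martingale n :
  (\int[P]_w ((\sum_(0 <= l < n) M l w) ^+ 2)%:E <= (\sum_(0 <= l < n) q l)%:E)%E.
Proof.
elim: n => [|n IH].
  by rewrite big_nil; under eq_integral do rewrite big_nil expr0n /=; rewrite integral0.
have mKd : measurable_fun setT (fun w => K (data X Y n w)).
  exact: (measurableT_comp (@mK n) (@measurable_data _ _ _ _ _ X Y n)).
pose k w := K (data X Y n w).
have IHk : (\int[P]_w (k w ^+ 2)%:E <= (\sum_(0 <= l < n) q l)%:E)%E.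
  by under eq_integral do rewrite /k KE.
have k2 : (\int[P]_w (k w ^+ 2)%:E < +oo)%E by apply: le_lt_trans IHk _; rewrite ltry.
have M2 : (\int[P]_w (M n w ^+ 2)%:E < +oo)%E by apply: le_lt_trans (Mq n) _; rewrite ltry.
have mk2 : measurable_fun setT (fun w => k w ^+ 2) by exact: measurable_funX.
have mM2 : measurable_fun setT (fun w => M n w ^+ 2) by exact: measurable_funX.
have mkM : measurable_fun setT (fun w => k w * M n w) by exact: measurable_funM.
have ikM : P.-integrable setT (fun w => (k w * M n w)%:E).
  apply: (@le_integrable _ _ _ P setT measurableT _ (fun w => (k w ^+ 2 + M n w ^+ 2)%:E)).
  - exact/measurable_EFinP.
  - move=> w _; rewrite lee_fin normrM [leRHS]ger0_norm ?addr_ge0 ?sqr_ge0//.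
    rewrite -[k w ^+ 2]real_normK ?num_real// -[M n w ^+ 2]real_normK ?num_real//.
    have := sqr_ge0 (`|k w| - `|M n w|); have := normr_ge0 (k w); have := normr_ge0 (M n w).
    by move: `|k w| `|M n w| => a b a0 b0; rewrite !expr2; nra.
  - apply: ge0_integrable; first exact: measurable_funD.
      by move=> w; rewrite addr_ge0 ?sqr_ge0.
    rewrite ge0_integral_add//; first by rewrite lte_add_pinfty.
      by move=> w; exact: sqr_ge0.
    by move=> w; exact: sqr_ge0.
have kM0 : (\int[P]_w (k w * M n w)%:E = 0)%E.
  apply: (@integral_indep_eq0 _ _ _ P _ _ n (data X Y n) (sample X Y n) _ _ _
    (fun zs => (K zs.1 * m zs.1 zs.2)%:E)) => //.
  - exact: measurable_data.
  - exact: measurable_sample.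
  - exact: data_sample_indep iid _.
  - apply/measurable_EFinP; apply: measurable_funM; last exact: (@mm n).
    exact: (measurableT_comp (@mK n) measurable_fst).
  - have := M0 n; apply: filterS => w [im m0] /=.
    under eq_integral do rewrite EFinM.
    by rewrite integralZl// m0 mule0.
have E : (\int[P]_w ((\sum_(0 <= l < n.+1) M l w) ^+ 2)%:E =
    \int[P]_w ((k w ^+ 2 + M n w ^+ 2)%:E + 2%:E * (k w * M n w)%:E))%E.
  apply: eq_integral => w _; rewrite big_nat_recr//= -KE -/(k w) -EFinM -EFinD.
  by congr (_%:E); ring.
have ikk : P.-integrable setT (fun w => (k w ^+ 2 + M n w ^+ 2)%:E).
  apply: ge0_integrable; first exact: measurable_funD.
    by move=> w; rewrite addr_ge0 ?sqr_ge0.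
  rewrite ge0_integral_add//; first by rewrite lte_add_pinfty.
    by move=> w; exact: sqr_ge0.
  by move=> w; exact: sqr_ge0.
rewrite E integralD//; last exact: integrableZl.
rewrite integralZl// kM0 mule0 adde0 ge0_integral_add//; last 2 first.
  by move=> w; exact: sqr_ge0.
  by move=> w; exact: sqr_ge0.
by rewrite big_nat_recr//= EFinD leeD.
Qed.
End MartingaleDifferences.

(** * Conditional expectations *)

Section MaxZero.
Variable R : realDomainType.

(** The positive part of a product in terms of the parts of its factors; it reduces signed weights
    to non-negative ones. *)
Lemma maxr0M (a b : R) : Num.max (a * b) 0 =
  Num.max a 0 * Num.max b 0 + Num.max (- a) 0 * Num.max (- b) 0.
Proof.
have M0 (x : R) : 0 <= x -> Num.max x 0 = x by move=> ?; rewrite max_l.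
have m0 (x : R) : x <= 0 -> Num.max x 0 = 0 by move=> ?; rewrite max_r.
have [a0|a0] : 0 <= a \/ a < 0 by case: (ltP a 0) => ?; [right|left].
all: have [b0|b0] : 0 <= b \/ b < 0 by case: (ltP b 0) => ?; [right|left].
- rewrite (M0 (a * b)) ?mulr_ge0// (M0 a)// (M0 b)// (m0 (- a)) ?oppr_le0//.
  by rewrite mul0r addr0.
- rewrite (m0 (a * b)) ?mulr_ge0_le0// ?(ltW b0)// (m0 b) ?(ltW b0)//.
  by rewrite (m0 (- a)) ?oppr_le0// mul0r mulr0 addr0.
- rewrite (m0 (a * b)) ?mulr_le0_ge0// ?(ltW a0)// (m0 a) ?(ltW a0)//.
  by rewrite (m0 (- b)) ?oppr_le0// mul0r mulr0 addr0.
rewrite (M0 (a * b)) ?mulr_le0// ?(ltW a0) ?(ltW b0)// (m0 a) ?(ltW a0)//.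
by rewrite (M0 (- a)) ?(M0 (- b)) ?oppr_ge0 ?(ltW a0) ?(ltW b0)// mul0r add0r mulrNN.
Qed.

Lemma maxr0NM (a b : R) : Num.max (- (a * b)) 0 =
  Num.max a 0 * Num.max (- b) 0 + Num.max (- a) 0 * Num.max b 0.
Proof. by rewrite -mulrN maxr0M opprK. Qed.
End MaxZero.

Section CondExpBound.
Context d (T : measurableType d) (R : realType) (P : probability T R).

Lemma cond_exp_integral_le (G : set (set T)) (U : T -> R) (W : T -> \bar R) (c : R) :
  (forall A, G A -> measurable A) -> 0 <= c ->
  is_cond_exp P G (fun w => (U w)%:E) W -> {ae P, forall w, (W w <= c%:E)%E} ->
  forall A, G A -> (\int[P]_(w in A) (U w)%:E <= c%:E * P A)%E.
Proof.
move=> Gm c0 [mW intW] Wc A GA; have mA := Gm _ GA; rewrite -intW//.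
have mWT : measurable_fun setT W by move=> _ B mB; rewrite setTI; apply/Gm/mW.
rewrite -(integral_cst _ mA) [leLHS]integralE.
(* [W] may be negative; dropping its negative part only increases the integral, and the positive
   part is still at most [c] since [c] is non-negative. *)
apply: (@le_trans _ _ (\int[P]_(w in A) W^\+ w)%E).
  rewrite -[leRHS]adde0; apply: leeD => //.
  by rewrite leeNl oppe0 integral_ge0.
apply: ae_ge0_le_integral => //.
- exact/measurable_funTS/measurable_funepos.
- by move: Wc; apply: filterS => w Ww _; rewrite funeposE ge_max Ww lee_fin c0.
Qed.
End CondExpBound.

Section CondExpOfReal.
Context d (T : measurableType d) (R : realType) (P : probability T R).
Context d0 (S0 : measurableType d0) (V : T -> S0) (mV : measurable_fun setT V).

Lemma measurable_sigma_preimage A : g_sigma_algebra_preimage V A -> measurable A.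
Proof. by move=> [B mB <-]; exact: mV. Qed.

Variables (U : T -> R) (v : S0 -> R).
Hypothesis iU : P.-integrable setT (EFin \o U).
Hypothesis cU : is_cond_exp_at P V (fun w => (U w)%:E) (fun x => (v x)%:E).

Let mv : measurable_fun setT v.
Proof. by have [/measurable_EFinP] := cU. Qed.

Let intv B : measurable B ->
  (\int[P]_(w in V @^-1` B) (v (V w))%:E = \int[P]_(w in V @^-1` B) (U w)%:E)%E.
Proof.
move=> mB; have [_ [_]] := cU; apply.
by exists B => //; rewrite setTI.
Qed.

Let mpre B : measurable B -> measurable (V @^-1` B).
Proof. by move=> mB; rewrite -[X in measurable X]setTI; exact: mV. Qed.

Let mvV : measurable_fun setT (fun w => v (V w)).
Proof. exact: measurableT_comp. Qed.

(** On each of the events [v >= 0] and [v < 0], which are preimages under [V], the integral of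
    |v(V)| is up to sign that of [U], hence finite. *)
Lemma cond_exp_integrable : P.-integrable setT (fun w => (v (V w))%:E).
Proof.
pose B := [set s | 0 <= v s].
have mB : measurable B.
  rewrite (_ : B = setT `&` v @^-1` `[0, +oo[%classic); first exact: mv.
  by apply/seteqP; split => s /=; rewrite /B /= in_itv/= andbT; [split|case].
have fin A : measurable A -> (\int[P]_(w in A) (U w)%:E)%E \is a fin_num.
  by move=> mA; apply: integrable_fin_num => //; apply: (integrableS measurableT).
apply/integrableP; split; first exact/measurable_EFinP.
have mC : measurable (~` B) by exact: measurableC.
rewrite -(setvU (V @^-1` B)) ge0_integral_setU//; last 4 first.
- exact/measurableC/mpre.
- exact: mpre.
- apply/measurable_funTS; apply: measurableT_comp => //; exact/measurable_EFinP.
- by rewrite disj_set2E setICl.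
rewrite lte_add_pinfty//.
  rewrite [ltLHS](_ : _ = - \int[P]_(w in V @^-1` (~` B)) (v (V w))%:E)%E.
    by rewrite intv// ltey_eq fin_numN fin//; exact: mpre.
  rewrite -[LHS]oppeK -integral_ge0N//; congr (- _)%E.
  apply: eq_integral => w; rewrite inE /= => /negP; rewrite -ltNge => Bw.
  by rewrite /= ltr0_norm// opprK.
rewrite [ltLHS](_ : _ = \int[P]_(w in V @^-1` B) (v (V w))%:E)%E.
  by rewrite intv// ltey_eq fin//; exact: mpre.
by apply: eq_integral => w; rewrite inE => Bw; rewrite gee0_abs.
Qed.
Let eps w := U w - v (V w).

Let ieps : P.-integrable setT (fun w => (eps w)%:E).
Proof.
have := integrableB measurableT iU cond_exp_integrable.
by apply: eq_integrable.
Qed.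

Let meps : measurable_fun setT eps.
Proof. by have /integrableP[/measurable_EFinP] := ieps. Qed.

Let mM (f g : T -> R) : measurable_fun setT f -> measurable_fun setT g ->
  measurable_fun setT (fun w => f w * g w).
Proof. exact: measurable_funM. Qed.

Let ppart (f : T -> R) w := Num.max (f w) 0.
Let npart (f : T -> R) w := Num.max (- f w) 0.

Let mp (f : T -> R) : measurable_fun setT f -> measurable_fun setT (ppart f).
Proof. by move=> mf; apply: measurable_maxr. Qed.

Let mn (f : T -> R) : measurable_fun setT f -> measurable_fun setT (npart f).
Proof. by move=> mf; apply: measurable_maxr => //; exact: measurable_funN. Qed.

Let p0 f w : 0 <= ppart f w. Proof. by rewrite /ppart le_max lexx orbT. Qed.
Let n0 f w : 0 <= npart f w. Proof. by rewrite /npart le_max lexx orbT. Qed.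

Let integral_parts (f : T -> R) A :
  (\int[P]_(w in A) (f w)%:E =
   \int[P]_(w in A) (ppart f w)%:E - \int[P]_(w in A) (npart f w)%:E)%E.
Proof.
rewrite integralE; congr (_ - _)%E; apply: eq_integral => w _.
  by rewrite funeposE EFin_max.
by rewrite funenegE EFin_max EFinN.
Qed.

Let parts_fin f A : measurable A -> P.-integrable setT (EFin \o f) ->
  (\int[P]_(w in A) (npart f w)%:E)%E \is a fin_num /\
  (\int[P]_(w in A) (ppart f w)%:E)%E \is a fin_num.
Proof.
move=> mA /(integrableS measurableT mA (@subsetT _ _)) iA; split.
- have := integrable_neg_fin_num mA iA; congr (_ \is a _).
  by apply: eq_integral => w _; rewrite funenegE EFin_max EFinN.
- have := integrable_pos_fin_num mA iA; congr (_ \is a _).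
  by apply: eq_integral => w _; rewrite funeposE EFin_max.
Qed.

Let eps_parts B : measurable B ->
  (\int[P]_(w in V @^-1` B) (ppart eps w)%:E = \int[P]_(w in V @^-1` B) (npart eps w)%:E)%E.
Proof.
move=> mB; have mVB := mpre mB.
have [nfin pfin] := parts_fin mVB ieps.
have e0 : (\int[P]_(w in V @^-1` B) (eps w)%:E = 0)%E.
  rewrite (_ : (\int[P]_(w in V @^-1` B) (eps w)%:E =
      \int[P]_(w in V @^-1` B) ((U w)%:E - (v (V w))%:E))%E)//.
  rewrite integralB_EFin//; last 2 first.
  - exact: (integrableS measurableT).
  - exact: (integrableS measurableT _ _ cond_exp_integrable).
  rewrite intv// subee//; apply: integrable_fin_num => //.
  exact: (integrableS measurableT).
move: e0; rewrite integral_parts -(fineK nfin) -(fineK pfin) -EFinB => -[H].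
by congr (_%:E); lra.
Qed.

Let eps_weighted (k : S0 -> R) : measurable_fun setT k -> (forall s, 0 <= k s) ->
  (\int[P]_w (k (V w) * ppart eps w)%:E = \int[P]_w (k (V w) * npart eps w)%:E)%E.
Proof.
move=> mk k0; apply/le_anti/andP; split.
- by apply: (le_integral_of_preimages mV (mp meps) (p0 _) (mn meps) (n0 _) _ mk k0)
    => B mB; rewrite eps_parts.
- by apply: (le_integral_of_preimages mV (mn meps) (n0 _) (mp meps) (p0 _) _ mk k0)
    => B mB; rewrite eps_parts.
Qed.

(** The residual has equally weighted positive and negative parts for every non-negative weight in
    [V]. Splitting [k] by sign as well, the positive and negative parts of the product have equal
    integrals, finite by integrability. *)
Lemma cond_exp_centered (k : S0 -> R) : measurable_fun setT k ->
  P.-integrable setT (fun w => (k (V w) * (U w - v (V w)))%:E) ->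
  (\int[P]_w (k (V w) * (U w - v (V w)))%:E = 0)%E.
Proof.
move=> mk ike.
pose ke w := k (V w) * eps w.
pose kp s := Num.max (k s) 0; pose kn s := Num.max (- k s) 0.
have mkp : measurable_fun setT kp by exact: measurable_maxr.
have mkn : measurable_fun setT kn by apply: measurable_maxr => //; exact: measurable_funN.
have kp0 s : 0 <= kp s by rewrite /kp le_max lexx orbT.
have kn0 s : 0 <= kn s by rewrite /kn le_max lexx orbT.
have mkpV : measurable_fun setT (fun w => kp (V w)) by exact: measurableT_comp.
have mknV : measurable_fun setT (fun w => kn (V w)) by exact: measurableT_comp.
rewrite (integral_parts ke).
have [nfin pfin] := parts_fin measurableT (ike : P.-integrable setT (EFin \o ke)).
suff -> : (\int[P]_w (ppart ke w)%:E = \int[P]_w (npart ke w)%:E)%E by rewrite subee.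
have E1 : (\int[P]_w (ppart ke w)%:E =
    \int[P]_w (kp (V w) * ppart eps w + kn (V w) * npart eps w)%:E)%E.
  apply: eq_integral => w _; congr (_%:E); rewrite /ppart /npart /kp /kn /ke.
  move: (k (V w)) (eps w) => a b.
  exact: maxr0M.
have E2 : (\int[P]_w (npart ke w)%:E =
    \int[P]_w (kp (V w) * npart eps w + kn (V w) * ppart eps w)%:E)%E.
  apply: eq_integral => w _; congr (_%:E); rewrite /ppart /npart /kp /kn /ke.
  move: (k (V w)) (eps w) => a b.
  exact: maxr0NM.
rewrite E1 E2 !ge0_integral_add ?eps_weighted//.
all: try (by move=> w; rewrite mulr_ge0).
all: try (apply: mM => //; by [exact: mp|exact: mn]).
Qed.
End CondExpOfReal.

(** * The support has full measure *)

Section Support.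
Context d (T : measurableType d) (R : realType) (P : probability T R) (p : nat).
Variable V : {RV P >-> p.-tuple R}.

Let box (x : p.-tuple R) (e : R) := [set w | forall k : 'I_p, (`|tnth (V w) k - tnth x k| < e)%R].

Let mbox x e : measurable (box x e).
Proof.
rewrite (_ : box x e = \bigcap_(k in [set: 'I_p]) [set w | (`|tnth (V w) k - tnth x k| < e)%R]).
  apply: fin_bigcap_measurable => // k _.
  rewrite -[X in measurable X]setTI.
  apply: measurable_fun_ltr => //; apply: measurableT_comp => //.
  apply: measurable_funB => //.
  exact: (measurableT_comp (measurable_tnth k)).
by apply/seteqP; split => w /= H k; [move=> _; exact: H|exact: (H k I)].
Qed.

(** A point outside the support has a null box around it, hence lies in a null box with rational
    center and radius 1/(k+1). There are countably many of these. *)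
Lemma ae_in_law_support : {ae P, forall w, law_support P V (V w)}.
Proof.
pose ctr (q : p.-tuple rat) : p.-tuple R := map_tuple ratr q.
pose A (i : nat) := if @unpickle (p.-tuple rat * nat)%type i is Some qk
  then if P (box (ctr qk.1) qk.2.+1%:R^-1) == 0%E then box (ctr qk.1) qk.2.+1%:R^-1 else set0
  else set0.
apply: (@negligibleS _ _ _ _ (\bigcup_i A i)); last first.
  apply: negligible_bigcup => i; rewrite /A.
  case: unpickle => [qk|]; last exact: negligible_set0.
  case: ifPn => [/eqP P0|_]; last exact: negligible_set0.
  by apply/negligibleP.
move=> w /= /existsNP[e /not_implyP[e0 /negP]].
rewrite -leNgt => Pe.
have {}Pe : P (box (V w) e) = 0%E by apply/eqP; rewrite eq_le measure_ge0 andbT.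
(* The radius is below e / 2, so that a rational box of this radius containing [V w] lies inside the
   null box of radius [e] around it. *)
have [k ke] : exists k : nat, k.+1%:R^-1 < e / 2.
  have e2 : 0 < e / 2 by rewrite divr_gt0.
  exists (Num.truncn (e / 2)^-1).
  by rewrite -[ltRHS]invrK ltf_pV2 ?posrE ?invr_gt0// truncnS_gt.
have k0 : 0 < k.+1%:R^-1 :> R by rewrite invr_gt0.
have H (i : 'I_p) : exists q : rat, `|tnth (V w) i - ratr q| < k.+1%:R^-1.
  have /rat_in_itvoo[q] : tnth (V w) i - k.+1%:R^-1 < tnth (V w) i + k.+1%:R^-1.
    by rewrite ltrBlDr -addrA ltrDl addr_gt0.
  rewrite in_itv /= => /andP[q1 q2]; exists q.
  by rewrite distrC ltr_distl q1 q2.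
pose q : p.-tuple rat := [tuple sval (cid (H i)) | i < p].
have qE i : `|tnth (V w) i - tnth (ctr q) i| < k.+1%:R^-1.
  by rewrite tnth_map tnth_mktuple; case: cid.
exists (pickle (q, k)) => //; rewrite /A pickleK /=.
rewrite ifT//.
apply/eqP/(subset_measure0 (mbox _ _) (mbox _ _) _ Pe).
move=> w' H' i.
rewrite -[_ - _](subrKA (tnth (ctr q) i)); apply: (le_lt_trans (ler_normD _ _)).
have h2 := qE i; rewrite distrC in h2.
apply: lt_trans (ltrD (H' i) h2) _; by rewrite [ltRHS]splitr ltrD.
Qed.
End Support.

(** * Moments of the errors and of the loss differences *)

Section Estimates.
Context d (T : measurableType d) (R : realType) (P : probability T R) (p : nat).
Variables (X : nat -> {RV P >-> p.-tuple R}) (Y : nat -> {RV P >-> R}).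
Variables (X' : nat -> {RV P >-> p.-tuple R}) (Y' : nat -> {RV P >-> R}).
Variables (Xnew : {RV P >-> p.-tuple R}) (f0 : p.-tuple R -> R) (sigma : R).
Hypothesis iid : iid_sampling X Y X' Y' Xnew.
Hypothesis Y_L2 : (\int[P]_w ((Y 0%N w) ^+ 2)%:E < +oo)%E.
Hypothesis f0_reg : is_cond_exp_at P (X 0%N) (fun w => (Y 0%N w)%:E) (fun x => (f0 x)%:E).
Hypothesis noise : exists2 v : p.-tuple R -> \bar R,
     is_cond_exp_at P (X 0%N) (fun w => ((Y 0%N w - f0 (X 0%N w)) ^+ 2)%:E) v &
     forall x, law_support P (X 0%N) x -> (v x <= (sigma ^+ 2)%:E)%E.
Notation S := (p.-tuple R * R)%type.

Lemma measurable_regression : measurable_fun setT f0.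
Proof. by have [/measurable_EFinP] := f0_reg. Qed.
Let mf0 := measurable_regression.

Let iY : P.-integrable setT (EFin \o Y 0%N).
Proof.
apply: (@le_integrable _ _ _ P setT measurableT _ (fun w => (1 + Y 0%N w ^+ 2)%:E)).
- exact/measurable_EFinP.
- move=> w _; rewrite lee_fin /= [leRHS]ger0_norm ?addr_ge0 ?sqr_ge0//.
  have := sqr_ge0 (`|Y 0%N w| - 1); rewrite -[Y 0%N w ^+ 2]real_normK ?num_real//.
  by have := normr_ge0 (Y 0%N w); move: `|_| => t t0; rewrite !expr2; nra.
- have mY2 : measurable_fun setT (fun w => Y 0%N w ^+ 2) by exact: measurable_funX.
  apply: ge0_integrable; first exact: measurable_funD.
    by move=> w; rewrite addr_ge0 ?sqr_ge0.
  rewrite ge0_integral_add//; last by move=> w; exact: sqr_ge0.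
  by rewrite integral_real_cst lte_add_pinfty// ltry.
Qed.

Let eps l w := Y l w - f0 (X l w).

Let meps l : measurable_fun setT (eps l).
Proof. by apply: measurable_funB => //; exact: measurableT_comp. Qed.

(** The variance bound holds on the support, hence almost surely; it passes to events of [X 0], then
    to weights in [X 0]. *)
Lemma noise_weighted (k : p.-tuple R -> R) : measurable_fun setT k -> (forall x, 0 <= k x) ->
  (\int[P]_w (k (X 0%N w) * (Y 0%N w - f0 (X 0%N w)) ^+ 2)%:E <=
   (sigma ^+ 2)%:E * \int[P]_w (k (X 0%N w))%:E)%E.
Proof.
move=> mk k0; have [v [mv cv] vle] := noise.
have mkX : measurable_fun setT (fun w => k (X 0%N w)) by exact: measurableT_comp.
rewrite -ge0_integral_scale ?sqr_ge0//.
under [leRHS]eq_integral do rewrite mulrC.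
apply: (@le_integral_of_preimages _ _ _ P _ _ (X 0%N) _ (fun w => eps 0%N w ^+ 2)
  (fun=> sigma ^+ 2)) => //.
- exact: measurable_funX.
- by move=> w; exact: sqr_ge0.
- by move=> w; exact: sqr_ge0.
move=> B mB.
have mXB : measurable (X 0%N @^-1` B).
  by rewrite -[X in measurable X]setTI; exact: (measurable_funP (X 0%N)).
rewrite (integral_cst _ mXB).
apply: (cond_exp_integral_le _ _ cv).
- by move=> A; apply: measurable_sigma_preimage; exact: measurable_funP.
- exact: sqr_ge0.
- by have := ae_in_law_support (X 0%N); apply: filterS => w; exact: vle.
- by exists B => //; rewrite setTI.
Qed.

(** Square integrability of [k] and of the noise makes the product integrable, and the regression
    property then gives mean zero. *)
Lemma noise_centered (k : p.-tuple R -> R) : measurable_fun setT k ->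
  (\int[P]_w (k (X 0%N w) ^+ 2)%:E < +oo)%E ->
  P.-integrable setT (fun w => (k (X 0%N w) * (Y 0%N w - f0 (X 0%N w)))%:E) /\
  (\int[P]_w (k (X 0%N w) * (Y 0%N w - f0 (X 0%N w)))%:E = 0)%E.
Proof.
move=> mk k2.
have mkX : measurable_fun setT (fun w => k (X 0%N w)) by exact: measurableT_comp.
suff ik : P.-integrable setT (fun w => (k (X 0%N w) * (Y 0%N w - f0 (X 0%N w)))%:E).
  by split => //; apply: (cond_exp_centered _ iY f0_reg mk ik); exact: measurable_funP.
have mk2 : measurable_fun setT (fun w => k (X 0%N w) ^+ 2) by exact: measurable_funX.
have me2 : measurable_fun setT (fun w => eps 0%N w ^+ 2) by exact: measurable_funX.
have e2 : (\int[P]_w (eps 0%N w ^+ 2)%:E < +oo)%E.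
  have := @noise_weighted (fun=> 1) (measurable_cst _) (fun=> ler01).
  under eq_integral do rewrite mul1r.
  by move=> /le_lt_trans; apply; rewrite integral_real_cst mule1 ltry.
apply: (@le_integrable _ _ _ P setT measurableT _
    (fun w => (k (X 0%N w) ^+ 2 + eps 0%N w ^+ 2)%:E)).
- by apply/measurable_EFinP; apply: measurable_funM => //; exact: meps.
- move=> w _; rewrite lee_fin normrM [leRHS]ger0_norm ?addr_ge0 ?sqr_ge0// -/(eps 0%N w).
  rewrite -[k _ ^+ 2]real_normK ?num_real// -[eps _ _ ^+ 2]real_normK ?num_real//.
  have := sqr_ge0 (`|k (X 0%N w)| - `|eps 0%N w|).
  have := normr_ge0 (k (X 0%N w)); have := normr_ge0 (eps 0%N w).
  by move: `|k _| `|eps _ _| => a b a0 b0; rewrite !expr2; nra.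
apply: ge0_integrable; first exact: measurable_funD.
  by move=> w; rewrite addr_ge0 ?sqr_ge0.
rewrite ge0_integral_add//; first by rewrite lte_add_pinfty.
  by move=> w; exact: sqr_ge0.
by move=> w; exact: sqr_ge0.
Qed.

(** With numbering from 0, sample [n] is the first one outside [data n]: it is independent of the
    data and has the law of [Xnew]. *)
Lemma ge0_integral_X_data n l (psi : n.-tuple S -> p.-tuple R -> R) :
  (l = n)%N ->
  measurable_fun setT (fun zx : n.-tuple S * p.-tuple R => psi zx.1 zx.2) ->
  (forall z x, 0 <= psi z x) ->
  (\int[P]_w (psi (data X Y n w) (X l w))%:E =
   \int[P]_w (psi (data X Y n w) (Xnew w))%:E)%E.
Proof.
move=> -> mpsi psi0.
have mp : measurable_fun setT (fun zs : n.-tuple S * S => (psi zs.1 zs.2.1)%:E).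
  apply/measurable_EFinP.
  have H : measurable_fun setT (fun zs : n.-tuple S * S => (zs.1, zs.2.1)).
    by apply/measurable_fun_pair => //=; exact: measurableT_comp.
  exact: (measurableT_comp mpsi H).
have p0 (z : n.-tuple S * S) : (0 <= (psi z.1 z.2.1)%:E)%E by rewrite lee_fin.
have e1 := ge0_integral_indep (@measurable_data _ _ _ _ _ X Y n)
  (@measurable_sample _ _ _ _ _ X Y n) (data_sample_indep iid (n:=n)) mp p0.
have e2 := ge0_integral_indep (@measurable_data _ _ _ _ _ X Y n)
  (@measurable_new_point _ _ _ _ _ Xnew) (data_new_indep iid (n:=n)) mp p0.
rewrite /= in e1 e2; rewrite e1 e2; apply: eq_integral => w _.
have mpz : measurable_fun setT (fun x => (psi (data X Y n w) x)%:E).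
  apply/measurable_EFinP.
  exact: (measurable_fun_pair2 (data X Y n w) mpsi).
rewrite (integral_new_law iid mpz).
apply: (@integral_sample_law _ _ _ _ _ _ _ _ _ _ iid n (fun s => (psi (data X Y n w) s.1)%:E)).
exact: (measurableT_comp mpz measurable_fst).
Qed.

Section OneEstimator.
Variable f : estimators R p.
Hypothesis f_seq : estimator_sequence f.

Lemma measurable_error n :
  measurable_fun setT (fun zx : n.-tuple S * p.-tuple R => f zx.1 zx.2 - f0 zx.2).
Proof.
apply: measurable_funB; first exact: f_seq.2.
exact: (measurableT_comp mf0 measurable_snd).
Qed.

Lemma measurable_error_z n (z : n.-tuple S) : measurable_fun setT (fun x => f z x - f0 x).
Proof. exact: (measurable_fun_pair2 z (@measurable_error n)). Qed.

Lemma riskE n (z : n.-tuple S) :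
  risk Xnew f0 (f z) = (\int[P]_w ((f z (Xnew w) - f0 (Xnew w)) ^+ 2)%:E)%E.
Proof.
rewrite /risk ge0_integral_distribution//; last by move=> y; rewrite lee_fin sqr_ge0.
by apply/measurable_EFinP; apply: measurable_funX; exact: measurable_error_z.
Qed.

Lemma measurable_risk n : measurable_fun setT (fun z : n.-tuple S => risk Xnew f0 (f z)).
Proof.
under eq_fun do rewrite riskE.
apply: (@measurable_fun_fubini_tonelli_F _ _ _ _ _ P (fun zw : n.-tuple S * T =>
  ((f zw.1 (Xnew zw.2) - f0 (Xnew zw.2)) ^+ 2)%:E)) => [|zw]; last by rewrite lee_fin sqr_ge0.
apply/measurable_EFinP; apply: measurable_funX.
have H : measurable_fun setT (fun zw : n.-tuple S * T => (zw.1, Xnew zw.2)).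
  by apply/measurable_fun_pair => //=; exact: measurableT_comp.
exact: (measurableT_comp (@measurable_error n) H).
Qed.

Lemma mean_riskE n : mean_risk X Y Xnew f0 f n =
  (\int[P]_w ((f (data X Y n w) (Xnew w) - f0 (Xnew w)) ^+ 2)%:E)%E.
Proof.
rewrite /mean_risk; under eq_integral do rewrite riskE.
have mp : measurable_fun setT (fun zs : n.-tuple S * S =>
    ((f zs.1 zs.2.1 - f0 zs.2.1) ^+ 2)%:E).
  apply/measurable_EFinP; apply: measurable_funX.
  have H : measurable_fun setT (fun zs : n.-tuple S * S => (zs.1, zs.2.1)).
    by apply/measurable_fun_pair => //=; exact: measurableT_comp.
  exact: (measurableT_comp (@measurable_error n) H).
have p0 (z : n.-tuple S * S) : (0 <= ((f z.1 z.2.1 - f0 z.2.1) ^+ 2)%:E)%E by rewrite lee_fin sqr_ge0.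
by have := ge0_integral_indep (@measurable_data _ _ _ _ _ X Y n)
  (@measurable_new_point _ _ _ _ _ Xnew) (data_new_indep iid (n:=n)) mp p0.
Qed.

Lemma risk_ge0 n (z : n.-tuple S) : (0 <= risk Xnew f0 (f z))%E.
Proof. by apply: integral_ge0 => x _; rewrite lee_fin sqr_ge0. Qed.

Lemma risk_data_finite n : (mean_risk X Y Xnew f0 f n < +oo)%E ->
  {ae P, forall w, risk Xnew f0 (f (data X Y n w)) \is a fin_num}.
Proof.
move=> fin; have : P.-integrable setT (fun w => risk Xnew f0 (f (data X Y n w))).
  apply/integrableP; split.
    exact: (measurableT_comp (@measurable_risk n) (@measurable_data _ _ _ _ _ X Y n)).
  by under eq_integral do rewrite gee0_abs ?risk_ge0//.
by move=> /(integrable_ae measurableT); apply: filterS => w; apply.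
Qed.

(** [f0] cancels in the difference of two errors, which is therefore [nabla]. Dividing the stability
    bound by its weight gives the constant c = C / n^(2b) of the variance bound. *)
Lemma stable_variance n b C (m : R) : (0 < n)%N -> 0 < C ->
  stable X Y X' Y' Xnew f b C ->
  (mean_error4 X Y Xnew f0 f n < +oo)%E -> mean_risk X Y Xnew f0 f n = m%:E ->
  (\int[P]_w ((fine (risk Xnew f0 (f (data X Y n w))) - m) ^+ 2)%:E
   <= (n%:R * (C / n%:R `^ (2 * b) * (4 * m)))%:E)%E.
Proof.
move=> n0 C0 st f4 mE.
have nb : 0 < n%:R `^ (2 * b) by apply: powR_gt0; rewrite ltr0n.
under eq_integral do rewrite riskE.
have := @variance_conditional_risk _ _ _ _ _ X Y X' Y' Xnew iid n (fun z x => f z x - f0 x)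
  (@measurable_error n) f4 (C / n%:R `^ (2 * b)).
rewrite -mean_riskE mE /=; apply; first by rewrite divr_gt0.
move=> j A jn mA pA.
have [W cW WC] := st n j jn.
have Ef w : ((f (data X Y n w) (Xnew w) - f0 (Xnew w) - (f (data_swap X Y X' Y' n j w) (Xnew w)
    - f0 (Xnew w))) ^+ 2)%:E = ((nabla X Y X' Y' f n j w (Xnew w)) ^+ 2)%:E.
  by congr (_ ^+ 2)%:E; rewrite /nabla; ring.
under eq_integral do rewrite Ef.
apply: (cond_exp_integral_le _ _ cW) => //.
- move=> B; apply: smallest_sub; first exact: sigma_algebra_measurable.
  apply: bigcup_sub => l _; apply: measurable_sigma_preimage; exact: measurable_sample.
- by rewrite ltW// divr_gt0.
- move: WC; apply: filterS => w H.
  by rewrite EFinM lee_pdivlMr// muleC.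
Qed.
End OneEstimator.
End Estimates.

(** * The centered loss difference *)

Section LossDifference.
Context d (T : measurableType d) (R : realType) (P : probability T R) (p : nat).
Variables (X : nat -> {RV P >-> p.-tuple R}) (Y : nat -> {RV P >-> R}).
Variables (X' : nat -> {RV P >-> p.-tuple R}) (Y' : nat -> {RV P >-> R}).
Variables (Xnew : {RV P >-> p.-tuple R}) (f0 : p.-tuple R -> R) (sigma : R).
Hypothesis iid : iid_sampling X Y X' Y' Xnew.
Hypothesis Y_L2 : (\int[P]_w ((Y 0%N w) ^+ 2)%:E < +oo)%E.
Hypothesis f0_reg : is_cond_exp_at P (X 0%N) (fun w => (Y 0%N w)%:E) (fun x => (f0 x)%:E).
Hypothesis noise : exists2 v : p.-tuple R -> \bar R,
     is_cond_exp_at P (X 0%N) (fun w => ((Y 0%N w - f0 (X 0%N w)) ^+ 2)%:E) v &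
     forall x, law_support P (X 0%N) x -> (v x <= (sigma ^+ 2)%:E)%E.
Notation S := (p.-tuple R * R)%type.
Variables h g : estimators R p.
Hypotheses (h_seq : estimator_sequence h) (g_seq : estimator_sequence g).
Let mf0 := measurable_regression f0_reg.

(** Equals 0 where the risk is infinite, a null event for the fitted estimator as soon as its mean
    risk is finite. *)
Definition real_risk (f : estimators R p) n (z : n.-tuple S) : R :=
  fine (risk Xnew f0 (f n z)).

(* Excess of the loss of [h] over that of [g] at the sample [s], centered by its
   conditional mean given the data [z]. *)
Definition loss_gap n (z : n.-tuple S) (s : S) : R :=
  (h z s.1 - s.2) ^+ 2 - (g z s.1 - s.2) ^+ 2 -
  (real_risk h z - real_risk g z).

Lemma measurable_real_risk f n : estimator_sequence f ->
  measurable_fun setT (fun z : n.-tuple S => real_risk f z).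
Proof.
by move=> f_seq; apply: (measurableT_comp _ (measurable_risk Xnew f0_reg f_seq (n:=n))).
Qed.

Let m_eval f n : estimator_sequence f ->
  measurable_fun setT (fun zs : n.-tuple S * S => f n zs.1 zs.2.1).
Proof.
move=> f_seq.
have H : measurable_fun setT (fun zs : n.-tuple S * S => (zs.1, zs.2.1)).
  by apply/measurable_fun_pair => //=; exact: measurableT_comp.
exact: (measurableT_comp (f_seq.2 n) H).
Qed.

Lemma measurable_loss_gap n :
  measurable_fun setT (fun zs : n.-tuple S * S => loss_gap zs.1 zs.2).
Proof.
have ms2 : measurable_fun setT (fun zs : n.-tuple S * S => zs.2.2) by exact: measurableT_comp.
apply: measurable_funB.
  apply: measurable_funB; apply: measurable_funX; apply: measurable_funB => //;
  exact: m_eval.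
apply: measurable_funB.
  exact: (measurableT_comp (measurable_real_risk (n:=n) h_seq) measurable_fst).
exact: (measurableT_comp (measurable_real_risk (n:=n) g_seq) measurable_fst).
Qed.

(** With errors a and b and noise e, (a - e)^2 - (b - e)^2 = a^2 - b^2 - 2 (a - b) e. The squares
    integrate to the two risks, and the product with the noise has mean zero. *)
Let gap_centered0 n (z : n.-tuple S) :
  risk Xnew f0 (h z) \is a fin_num -> risk Xnew f0 (g z) \is a fin_num ->
  P.-integrable setT (fun w => (loss_gap z (sample X Y 0%N w))%:E) /\
  (\int[P]_w (loss_gap z (sample X Y 0%N w))%:E = 0)%E.
Proof.
move=> fh fg.
pose a w := h z (X 0%N w) - f0 (X 0%N w).
pose b w := g z (X 0%N w) - f0 (X 0%N w).
have ma := measurableT_comp (measurable_error_z f0_reg h_seq z) (measurable_funP (X 0%N)).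
have mb := measurableT_comp (measurable_error_z f0_reg g_seq z) (measurable_funP (X 0%N)).
have ma2 : measurable_fun setT (fun w => a w ^+ 2) by exact: measurable_funX.
have mb2 : measurable_fun setT (fun w => b w ^+ 2) by exact: measurable_funX.
have Ef f : estimator_sequence f -> risk Xnew f0 (f n z) \is a fin_num ->
    (\int[P]_w ((f n z (X 0%N w) - f0 (X 0%N w)) ^+ 2)%:E = (real_risk f z)%:E)%E.
  move=> f_seq ff; rewrite /real_risk fineK// (riskE Xnew f0_reg f_seq).
  have mx : measurable_fun setT (fun x => ((f n z x - f0 x) ^+ 2)%:E).
    by apply/measurable_EFinP; apply: measurable_funX; exact: (measurable_error_z f0_reg f_seq z).
  by rewrite (integral_new_law iid mx).
have Ea : (\int[P]_w (a w ^+ 2)%:E = (real_risk h z)%:E)%E by exact: Ef.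
have Eb : (\int[P]_w (b w ^+ 2)%:E = (real_risk g z)%:E)%E by exact: Ef.
have ia : P.-integrable setT (fun w => (a w ^+ 2)%:E).
  by apply: ge0_integrable => //; [move=> w; exact: sqr_ge0|rewrite Ea ltry].
have ib : P.-integrable setT (fun w => (b w ^+ 2)%:E).
  by apply: ge0_integrable => //; [move=> w; exact: sqr_ge0|rewrite Eb ltry].
pose k x := h z x - g z x.
have mk : measurable_fun setT k.
  apply: measurable_funB; first exact: (measurable_fun_pair2 z (h_seq.2 n)).
  exact: (measurable_fun_pair2 z (g_seq.2 n)).
have k2 : (\int[P]_w (k (X 0%N w) ^+ 2)%:E < +oo)%E.
  apply: (@le_lt_trans _ _ (\int[P]_w (2 * a w ^+ 2 + 2 * b w ^+ 2)%:E)%E).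
    apply: ge0_integral_le.
    - by apply: measurable_funX; exact: measurableT_comp.
    - by move=> w; exact: sqr_ge0.
    - by apply: measurable_funD; exact: measurable_funM.
    - move=> w; have := sqr_ge0 (a w + b w).
      rewrite (_ : k (X 0%N w) = a w - b w); last by rewrite /k /a /b; ring.
      by rewrite !expr2; lra.
  rewrite ge0_integral_add//; last 4 first.
  - exact: measurable_funM.
  - by move=> w; rewrite mulr_ge0 ?sqr_ge0.
  - exact: measurable_funM.
  - by move=> w; rewrite mulr_ge0 ?sqr_ge0.
  rewrite !ge0_integral_scale//; try (by move=> w; exact: sqr_ge0).
  by rewrite Ea Eb -!EFinM -EFinD ltry.
have [ike ke0] := noise_centered Y_L2 f0_reg noise mk k2.
pose c := real_risk h z - real_risk g z.
have E w : (loss_gap z (sample X Y 0%N w))%:E =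
    (((a w ^+ 2)%:E - (b w ^+ 2)%:E) -
     (2%:E * (k (X 0%N w) * (Y 0%N w - f0 (X 0%N w)))%:E + c%:E))%E.
  transitivity ((a w ^+ 2 - b w ^+ 2 -
    (2 * (k (X 0%N w) * (Y 0%N w - f0 (X 0%N w))) + c))%:E) => //; congr (_%:E).
  by rewrite /loss_gap /sample /= -/c /k /a /b; ring.
have ic : P.-integrable setT (fun=> c%:E) by exact: finite_measure_integrable_cst.
have iab : P.-integrable setT (fun w => (a w ^+ 2)%:E - (b w ^+ 2)%:E)%E.
  exact: integrableB.
have i2 : P.-integrable setT (fun w => 2%:E * (k (X 0%N w) * (Y 0%N w - f0 (X 0%N w)))%:E)%E.
  exact: integrableZl.
have i2c : P.-integrable setT (fun w => 2%:E * (k (X 0%N w) * (Y 0%N w - f0 (X 0%N w)))%:E + c%:E)%E.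
  exact: integrableD.
split.
  under eq_fun do rewrite E.
  exact: integrableB.
under eq_integral do rewrite E.
rewrite integralB// integralB_EFin// Ea Eb integralD// integralZl// ke0 mule0 add0e.
by rewrite integral_real_cst -EFinB /c subrr.
Qed.

Lemma loss_gap_centered l n (z : n.-tuple S) :
  risk Xnew f0 (h z) \is a fin_num -> risk Xnew f0 (g z) \is a fin_num ->
  P.-integrable setT (fun w => (loss_gap z (sample X Y l w))%:E) /\
  (\int[P]_w (loss_gap z (sample X Y l w))%:E = 0)%E.
Proof.
move=> fh fg; have [i0 e0] := gap_centered0 fh fg.
have mg : measurable_fun setT (fun s => (loss_gap z s)%:E).
  by apply/measurable_EFinP; exact: (measurable_fun_pair2 z (@measurable_loss_gap n)).
split; last by rewrite (integral_sample_law iid l mg).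
have /integrableP[_ ioo] := i0.
apply/integrableP; split; first exact: (measurableT_comp mg (@measurable_sample _ _ _ _ _ X Y l)).
have mga : measurable_fun setT (fun s => `|(loss_gap z s)%:E|)%E.
  exact: (measurableT_comp _ mg).
by rewrite (integral_sample_law iid l mga).
Qed.

Lemma loss_gap_martingale l :
  (mean_risk X Y Xnew f0 h l < +oo)%E -> (mean_risk X Y Xnew f0 g l < +oo)%E ->
  {ae P, forall w,
    P.-integrable setT (fun w' => (loss_gap (data X Y l w) (sample X Y l w'))%:E) /\
    (\int[P]_w' (loss_gap (data X Y l w) (sample X Y l w'))%:E = 0)%E}.
Proof.
move=> fh fg.
have := risk_data_finite f0_reg h_seq fh.
have := risk_data_finite f0_reg g_seq fg.
by apply: filterS2 => w Hg Hh; exact: loss_gap_centered.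
Qed.
Let m_err f n : estimator_sequence f ->
  measurable_fun setT (fun w => f n (data X Y n w) (X n w) - f0 (X n w)).
Proof.
move=> f_seq.
have H : measurable_fun setT (fun w => (data X Y n w, X n w)).
  by apply: measurable_fun_pair => //; exact: measurable_data.
exact: (measurableT_comp (measurable_error f0_reg f_seq (n:=n)) H).
Qed.

Lemma sqr_error_X_data f l : estimator_sequence f ->
  (\int[P]_w ((f l (data X Y l w) (X l w) - f0 (X l w)) ^+ 2)%:E =
   mean_risk X Y Xnew f0 f l)%E.
Proof.
move=> f_seq; rewrite (mean_riskE iid f0_reg f_seq).
apply: (ge0_integral_X_data iid (psi := fun z x => (f l z x - f0 x) ^+ 2) erefl).
  by apply: measurable_funX; exact: (measurable_error f0_reg f_seq (n:=l)).
by move=> z x; exact: sqr_ge0.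
Qed.

Lemma error4_X_data f l : estimator_sequence f ->
  (\int[P]_w (((f l (data X Y l w) (X l w) - f0 (X l w)) ^+ 2) ^+ 2)%:E =
   mean_error4 X Y Xnew f0 f l)%E.
Proof.
move=> f_seq; under eq_integral do rewrite -exprM.
apply: (ge0_integral_X_data iid (psi := fun z x => (f l z x - f0 x) ^+ 4) erefl).
  by apply: measurable_funX; exact: (measurable_error f0_reg f_seq (n:=l)).
by move=> z x; rewrite (_ : 4 = 2 * 2)%N// exprM sqr_ge0.
Qed.

Lemma real_risk_sqr_le f l : estimator_sequence f ->
  (\int[P]_w (real_risk f (data X Y l w) ^+ 2)%:E <= mean_error4 X Y Xnew f0 f l)%E.
Proof.
move=> f_seq.
have mp : measurable_fun setT (fun zs : l.-tuple S * S =>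
    (((f l zs.1 zs.2.1 - f0 zs.2.1) ^+ 2) ^+ 2)%:E).
  apply/measurable_EFinP; do 2 apply: measurable_funX.
  apply: measurable_funB; first exact: m_eval.
  by apply: measurableT_comp => //; exact: measurableT_comp.
have p0 (z : l.-tuple S * S) : (0 <= (((f l z.1 z.2.1 - f0 z.2.1) ^+ 2) ^+ 2)%:E)%E.
  by rewrite lee_fin sqr_ge0.
have := ge0_integral_indep (@measurable_data _ _ _ _ _ X Y l)
  (@measurable_new_point _ _ _ _ _ Xnew) (data_new_indep iid (n:=l)) mp p0.
have -> : (\int[P]_w (((f l (data X Y l w, new_point Xnew w).1
   (data X Y l w, new_point Xnew w).2.1 -
   f0 (data X Y l w, new_point Xnew w).2.1) ^+ 2) ^+ 2)%:E)%E = mean_error4 X Y Xnew f0 f l.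
  by apply: eq_integral => w _; rewrite -exprM.
move=> ->; apply: ge0_le_integral => //.
- by move=> w _; rewrite lee_fin sqr_ge0.
- apply/measurable_EFinP; apply: measurable_funX.
  exact: (measurableT_comp (measurable_real_risk (n:=l) f_seq) (@measurable_data _ _ _ _ _ X Y l)).
- apply: (@measurable_fun_fubini_tonelli_F _ _ _ _ _ P (fun ww : T * T =>
    (((f l (data X Y l ww.1) (Xnew ww.2) - f0 (Xnew ww.2)) ^+ 2) ^+ 2)%:E)) => [|ww]; last first.
    by rewrite lee_fin sqr_ge0.
  have H : measurable_fun setT (fun ww : T * T => (data X Y l ww.1, new_point Xnew ww.2)).
    apply: measurable_fun_pair.
      exact: (measurableT_comp (@measurable_data _ _ _ _ _ X Y l) measurable_fst).
    exact: (measurableT_comp (@measurable_new_point _ _ _ _ _ Xnew) measurable_snd).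
  exact: (measurableT_comp mp H).
move=> w _; rewrite /real_risk (riskE Xnew f0_reg f_seq).
apply: fine_integral_sqr_le; last by move=> w'; exact: sqr_ge0.
apply: measurable_funX; exact: (measurableT_comp (measurable_error_z f0_reg f_seq _)).
Qed.

(** For fixed data the weight is a function of the fresh covariate alone, so the bound for such
    weights applies inside the integral over the data. *)
Lemma noise_weighted_data l :
  (\int[P]_w ((h (data X Y l w) (X l w) - g (data X Y l w) (X l w)) ^+ 2 *
     (Y l w - f0 (X l w)) ^+ 2)%:E <=
   (sigma ^+ 2)%:E *
   \int[P]_w ((h (data X Y l w) (X l w) - g (data X Y l w) (X l w)) ^+ 2)%:E)%E.
Proof.
pose k (z : l.-tuple S) x := (h z x - g z x) ^+ 2.
have mkz : measurable_fun setT (fun zs : l.-tuple S * S => k zs.1 zs.2.1).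
  by apply: measurable_funX; apply: measurable_funB; exact: m_eval.
have me : measurable_fun setT (fun zs : l.-tuple S * S => zs.2.2 - f0 zs.2.1).
  apply: measurable_funB; first exact: measurableT_comp.
  by apply: measurableT_comp => //; exact: measurableT_comp.
have k0 z x : 0 <= k z x by exact: sqr_ge0.
have mp1 : measurable_fun setT (fun zs : l.-tuple S * S =>
    (k zs.1 zs.2.1 * (zs.2.2 - f0 zs.2.1) ^+ 2)%:E).
  apply/measurable_EFinP; apply: measurable_funM => //; exact: measurable_funX.
have mp2 : measurable_fun setT (fun zs : l.-tuple S * S => (k zs.1 zs.2.1)%:E).
  exact/measurable_EFinP.
have p1 (z : l.-tuple S * S) : (0 <= (k z.1 z.2.1 * (z.2.2 - f0 z.2.1) ^+ 2)%:E)%E.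
  by rewrite lee_fin mulr_ge0 ?sqr_ge0.
have p2 (z : l.-tuple S * S) : (0 <= (k z.1 z.2.1)%:E)%E by rewrite lee_fin.
have md := @measurable_data _ _ _ _ _ X Y l.
have ms := @measurable_sample _ _ _ _ _ X Y l.
have e1 := ge0_integral_indep md ms (data_sample_indep iid (n:=l)) mp1 p1.
have e2 := ge0_integral_indep md ms (data_sample_indep iid (n:=l)) mp2 p2.
rewrite /= in e1 e2.
rewrite [leLHS]e1 [X in (_ <= _ * X)%E]e2.
have mi2 : measurable_fun setT (fun w => \int[P]_w' (k (data X Y l w) (X l w'))%:E)%E.
  apply: (@measurable_fun_fubini_tonelli_F _ _ _ _ _ P (fun ww : T * T =>
    (k (data X Y l ww.1) (X l ww.2))%:E)) => [|ww]; last by rewrite lee_fin.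
  have H : measurable_fun setT (fun ww : T * T => (data X Y l ww.1, sample X Y l ww.2)).
    apply: measurable_fun_pair; first exact: (measurableT_comp md measurable_fst).
    exact: (measurableT_comp ms measurable_snd).
  exact: (measurableT_comp mp2 H).
rewrite -ge0_integralZl_EFin ?sqr_ge0//; last first.
  by move=> w _; exact: integral_ge0_real.
apply: ge0_le_integral => //.
- by move=> w _; apply: integral_ge0_real => w'; rewrite mulr_ge0 ?sqr_ge0.
- apply: (@measurable_fun_fubini_tonelli_F _ _ _ _ _ P (fun ww : T * T =>
    (k (data X Y l ww.1) (X l ww.2) * (Y l ww.2 - f0 (X l ww.2)) ^+ 2)%:E)) => [|ww]; last first.
    by rewrite lee_fin mulr_ge0 ?sqr_ge0.
  have H : measurable_fun setT (fun ww : T * T => (data X Y l ww.1, sample X Y l ww.2)).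
    apply: measurable_fun_pair; first exact: (measurableT_comp md measurable_fst).
    exact: (measurableT_comp ms measurable_snd).
  exact: (measurableT_comp mp1 H).
- exact: measurable_funeM.
move=> w _; set z := data X Y l w.
rewrite (integral_sample_law iid l (measurable_fun_pair2 z mp1)).
rewrite (integral_sample_law iid l (measurable_fun_pair2 z mp2)).
apply: (noise_weighted f0_reg noise (k := k z)) => //.
apply: measurable_funX; apply: measurable_funB.
  exact: (measurable_fun_pair2 z (h_seq.2 l)).
exact: (measurable_fun_pair2 z (g_seq.2 l)).
Qed.

(** The gap is x - y - 2 N: x and y are the squared errors of [h] and [g] minus their risks, N is
    [k * e]. Its square is at most 3 x^2 + 3 y^2 + 12 N^2. A squared error and a risk are
    non-negative, so x^2 costs two terms bounded by [qh], whence 6; E[N^2] <= 2 sigma^2 (rh + rg)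
    gives 24. *)
Lemma loss_gap_sqr_le l (rh rg qh qg : R) :
  (mean_risk X Y Xnew f0 h l <= rh%:E)%E -> (mean_risk X Y Xnew f0 g l <= rg%:E)%E ->
  (mean_error4 X Y Xnew f0 h l <= qh%:E)%E -> (mean_error4 X Y Xnew f0 g l <= qg%:E)%E ->
  (\int[P]_w (loss_gap (data X Y l w) (sample X Y l w) ^+ 2)%:E <=
   (6 * qh + 6 * qg + 24 * sigma ^+ 2 * (rh + rg))%:E)%E.
Proof.
move=> Hrh Hrg Hqh Hqg.
pose a w := h (data X Y l w) (X l w) - f0 (X l w).
pose b w := g (data X Y l w) (X l w) - f0 (X l w).
pose e w := Y l w - f0 (X l w).
pose k w := h (data X Y l w) (X l w) - g (data X Y l w) (X l w).
pose u w := real_risk h (data X Y l w).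
pose v w := real_risk g (data X Y l w).
have ma : measurable_fun setT a by exact: m_err.
have mb : measurable_fun setT b by exact: m_err.
have me : measurable_fun setT e by apply: measurable_funB => //; exact: measurableT_comp.
have kE w : k w = a w - b w by rewrite /k /a /b; ring.
have mk : measurable_fun setT k.
  by rewrite (_ : k = fun w => a w - b w); [exact: measurable_funB|apply/funext].
have mu : measurable_fun setT u.
  exact: (measurableT_comp (measurable_real_risk (n:=l) h_seq) (@measurable_data _ _ _ _ _ X Y l)).
have mv : measurable_fun setT v.
  exact: (measurableT_comp (measurable_real_risk (n:=l) g_seq) (@measurable_data _ _ _ _ _ X Y l)).
have u0 w : 0 <= u w by exact/fine_ge0/risk_ge0.
have v0 w : 0 <= v w by exact/fine_ge0/risk_ge0.
pose t1 w := (a w ^+ 2) ^+ 2; pose t2 w := (b w ^+ 2) ^+ 2.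
pose t3 w := u w ^+ 2; pose t4 w := v w ^+ 2.
pose t5 w := k w ^+ 2 * e w ^+ 2.
have mt1 : measurable_fun setT t1 by do 2 apply: measurable_funX.
have mt2 : measurable_fun setT t2 by do 2 apply: measurable_funX.
have mt3 : measurable_fun setT t3 by apply: measurable_funX.
have mt4 : measurable_fun setT t4 by apply: measurable_funX.
have mt5 : measurable_fun setT t5 by apply: measurable_funM; exact: measurable_funX.
have t10 w : 0 <= t1 w by exact: sqr_ge0.
have t20 w : 0 <= t2 w by exact: sqr_ge0.
have t30 w : 0 <= t3 w by exact: sqr_ge0.
have t40 w : 0 <= t4 w by exact: sqr_ge0.
have t50 w : 0 <= t5 w by rewrite mulr_ge0 ?sqr_ge0.
have I1 : (\int[P]_w (t1 w)%:E <= qh%:E)%E by rewrite (error4_X_data l h_seq).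
have I2 : (\int[P]_w (t2 w)%:E <= qg%:E)%E by rewrite (error4_X_data l g_seq).
have I3 : (\int[P]_w (t3 w)%:E <= qh%:E)%E by apply: le_trans Hqh; exact: real_risk_sqr_le.
have I4 : (\int[P]_w (t4 w)%:E <= qg%:E)%E by apply: le_trans Hqg; exact: real_risk_sqr_le.
have Ik : (\int[P]_w (k w ^+ 2)%:E <= (2 * (rh + rg))%:E)%E.
  apply: (@le_trans _ _ (\int[P]_w (2 * (a w ^+ 2 + b w ^+ 2))%:E)%E).
    apply: ge0_integral_le.
    - exact: measurable_funX.
    - by move=> w; exact: sqr_ge0.
    - by apply: measurable_funM => //; apply: measurable_funD; exact: measurable_funX.
    - move=> w; rewrite kE; have := sqr_ge0 (a w + b w).
      by rewrite !expr2; lra.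
  have ma2 : measurable_fun setT (fun w => a w ^+ 2) by exact: measurable_funX.
  have mb2 : measurable_fun setT (fun w => b w ^+ 2) by exact: measurable_funX.
  rewrite ge0_integral_scale//; last 2 first.
  - exact: measurable_funD.
  - by move=> w; rewrite addr_ge0 ?sqr_ge0.
  rewrite EFinM; apply: lee_wpmul2l => //.
  rewrite ge0_integral_add//; try (by move=> w; exact: sqr_ge0).
  by rewrite EFinD; apply: leeD; rewrite sqr_error_X_data.
have I5 : (\int[P]_w (t5 w)%:E <= (sigma ^+ 2 * (2 * (rh + rg)))%:E)%E.
  apply: (le_trans (noise_weighted_data l)); rewrite [leRHS]EFinM.
  by apply: lee_wpmul2l; rewrite ?lee_fin ?sqr_ge0.
apply: (@le_trans _ _ (\int[P]_w (3 * (t1 w + t3 w) + 3 * (t2 w + t4 w) + 12 * t5 w)%:E)%E).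
  apply: ge0_integral_le.
  - apply: measurable_funX.
    have H : measurable_fun setT (fun w => (data X Y l w, sample X Y l w)).
      by apply: measurable_fun_pair; [exact: measurable_data|exact: measurable_sample].
    exact: (measurableT_comp (@measurable_loss_gap l) H).
  - by move=> w; exact: sqr_ge0.
  - apply: measurable_funD; last exact: measurable_funM.
    by apply: measurable_funD; apply: measurable_funM => //; exact: measurable_funD.
  - move=> w; rewrite /t1 /t2 /t3 /t4 /t5.
    rewrite (_ : loss_gap _ _ = (a w ^+ 2 - u w) - (b w ^+ 2 - v w) - 2 * (k w * e w)); last first.
      by rewrite /loss_gap /sample /= -/(u w) -/(v w) /k /a /b /e; ring.
    rewrite -exprMn; have := u0 w; have := v0 w.
    have := sqr_ge0 (a w); have := sqr_ge0 (b w).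
    move: (a w ^+ 2) (b w ^+ 2) (u w) (v w) (k w * e w) => A B U V N B0 A0 V0 U0.
    have H1 : (A - U) ^+ 2 <= A ^+ 2 + U ^+ 2.
      by have := mulr_ge0 A0 U0; rewrite !expr2; lra.
    have H2 : (B - V) ^+ 2 <= B ^+ 2 + V ^+ 2.
      by have := mulr_ge0 B0 V0; rewrite !expr2; lra.
    move: H1 H2; move: (A ^+ 2 + U ^+ 2) (B ^+ 2 + V ^+ 2) (A - U) (B - V) => s1 s2 x y.
    (* With z = 2 N, 3 (x^2 + y^2 + z^2) - (x - y - z)^2 is the sum of these three squares. *)
    have := sqr_ge0 (x + y); have := sqr_ge0 (x + 2 * N); have := sqr_ge0 (y - 2 * N).
    by rewrite !expr2; lra.
have m13 : measurable_fun setT (fun w => t1 w + t3 w) by exact: measurable_funD.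
have m24 : measurable_fun setT (fun w => t2 w + t4 w) by exact: measurable_funD.
have p13 w : 0 <= t1 w + t3 w by rewrite addr_ge0.
have p24 w : 0 <= t2 w + t4 w by rewrite addr_ge0.
rewrite ge0_integral_add; [|by apply: measurable_funD; exact: measurable_funM|
  by move=> w; rewrite addr_ge0// mulr_ge0|exact: measurable_funM|by move=> w; rewrite mulr_ge0].
rewrite ge0_integral_add; [|exact: measurable_funM|by move=> w; rewrite mulr_ge0|
  exact: measurable_funM|by move=> w; rewrite mulr_ge0].
rewrite (ge0_integral_scale P _ m13 p13)// (ge0_integral_scale P _ m24 p24)//.
rewrite (ge0_integral_scale P _ mt5 t50)//.
rewrite (ge0_integral_add P mt1 t10 mt3 t30) (ge0_integral_add P mt2 t20 mt4 t40).
apply: (@le_trans _ _ (3%:E * (qh%:E + qh%:E) + 3%:E * (qg%:E + qg%:E) +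
    12%:E * (sigma ^+ 2 * (2 * (rh + rg)))%:E)%E).
  by apply: leeD; first apply: leeD; apply: lee_wpmul2l => //; apply: leeD.
rewrite [leLHS](_ : _ = (3 * (qh + qh) + 3 * (qg + qg) +
  12 * (sigma ^+ 2 * (2 * (rh + rg))))%:E)// lee_fin; lra.
Qed.
End LossDifference.

(** * Tail bounds *)

Section Tails.
Context d (T : measurableType d) (R : realType) (P : probability T R).

Lemma measurable_ge_set (f : T -> R) t : measurable_fun setT f ->
  measurable [set w | t <= f w].
Proof.
move=> mf; rewrite -[X in measurable X]setTI.
exact: (measurable_fun_ler (measurable_cst t) mf measurableT).
Qed.

Lemma tail_le_integral (f : T -> R) (m t : R) : 0 < t ->
  measurable_fun setT f -> (forall w, 0 <= f w) ->
  (\int[P]_w (f w)%:E <= m%:E)%E -> (P [set w | (t <= f w)%R] <= (m / t)%:E)%E.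
Proof.
move=> t0 mf f0 fm; rewrite EFinM lee_pdivlMr//.
have mA := measurable_ge_set t mf.
apply: le_trans fm.
rewrite -[[set w | _]]setIT -(integral_indic P measurableT mA) -ge0_integralZr//; last first.
- by rewrite lee_fin ltW.
- exact/measurable_EFinP.
apply: ge0_le_integral => //.
- by move=> w _; rewrite mule_ge0// ?lee_fin// ltW.
- by apply: emeasurable_funM => //; exact/measurable_EFinP.
- exact/measurable_EFinP.
move=> w _; rewrite -EFinM lee_fin indicE.
have [|_] := boolP (w \in _); last by rewrite mul0r.
by rewrite inE /= mul1r.
Qed.

(** Continuity from below along the events |f| < n. Meant for the finitely many initial terms, over
    which no moment is controlled. *)
Lemma tail_small (f : T -> R) (e : R) : 0 < e -> measurable_fun setT f ->
  exists N : nat, (P [set w | (N%:R <= `|f w|)%R] <= e%:E)%E.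
Proof.
move=> e0 mf.
have mnf : measurable_fun setT (fun w => `|f w|) by exact: measurableT_comp.
pose F (n : nat) := ~` [set w | n%:R <= `|f w|].
have mF n : measurable (F n) by apply: measurableC; exact: measurable_ge_set.
have UF : \bigcup_n F n = setT.
  apply/seteqP; split => // w _.
  have [n nf] : exists n : nat, `|f w| < n%:R.
    by exists (Num.bound `|f w|); apply: archi_boundP.
  by exists n => //=; apply/negP; rewrite -ltNge.
have ndF : nondecreasing_seq F.
  move=> n m nm; apply/subsetPset => w /=; rewrite /F /=; apply: contra_not.
  by apply: le_trans; rewrite ler_nat.
have := @nondecreasing_cvg_mu _ _ _ P F mF; rewrite UF => /(_ measurableT ndF).
rewrite [X in _ --> X](@probability_setT _ _ _ P) => /fine_cvg /cvgrPdist_le /(_ _ e0)[N _ HN].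
exists N; have := HN N (leqnn N); rewrite /= => H.
have mA := measurable_ge_set N%:R mnf.
have PA : P [set w | (N%:R <= `|f w|)%R] = (1 - P (F N))%E.
  by rewrite -(probability_setC _ (mF N)) /F setCK.
have PF : P (F N) \is a fin_num by exact: fin_num_measure.
rewrite PA -(fineK PF) -EFinB lee_fin.
by apply: le_trans H; exact: ler_norm.
Qed.

(** For [D] to be non-positive, one of [H], [U], [W] must reach [kappa * s n / 3] in absolute value.
    Each does so with probability at most e / 3 eventually: [H] because it is fixed while [s]
    diverges, [U] by Chebyshev, [W] by Markov. *)
Lemma probability_positive_cvg1 (D : nat -> T -> R) (H : T -> R) (U W : nat -> T -> R)
    (c s u v : nat -> R) (kappa : R) : 0 < kappa ->
  measurable_fun setT H -> (forall n, measurable_fun setT (U n)) ->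
  (forall n, measurable_fun setT (W n)) ->
  (\forall n \near \oo, forall w, D n w = H w + U n w + W n w + c n) ->
  (\forall n \near \oo, kappa * s n <= c n) ->
  (\forall n \near \oo, \int[P]_w (U n w ^+ 2)%:E <= (u n)%:E)%E ->
  (\forall n \near \oo, \int[P]_w (`|W n w|)%:E <= (v n)%:E)%E ->
  s @ \oo --> +oo ->
  (forall e, 0 < e -> \forall n \near \oo, u n <= e * s n ^+ 2) ->
  (forall e, 0 < e -> \forall n \near \oo, v n <= e * s n) ->
  (fun n => P [set w | 0 < D n w]) @ \oo --> (1%:E : \bar R).
Proof.
move=> k0 mH mU mW DE cs Uu Wv soo us vs.
have mDn : \forall n \near \oo, measurable_fun setT (D n).
  near=> n; have E : forall w, D n w = H w + U n w + W n w + c n by near: n.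
  rewrite (_ : D n = fun w => H w + U n w + W n w + c n); last exact/funext.
  by do 3 (apply: measurable_funD => //).
have mpos n : measurable_fun setT (D n) -> measurable [set w | 0 < D n w].
  move=> mD; rewrite (_ : [set w | _] = ~` [set w | 0 <= - D n w]).
    by apply/measurableC/measurable_ge_set; exact: measurable_funN.
  apply/seteqP; split => w /=; rewrite oppr_ge0.
    by move=> H0; apply/negP; rewrite -ltNge.
  by move/negP; rewrite -ltNge.
apply: cvg_EFin.
  by near=> n; apply: fin_num_measure; apply: mpos; near: n.
apply/cvgrPdist_le => e e0.
have e3 : 0 < e / 3 by rewrite divr_gt0.
have [N HN] := tail_small e3 mH.
pose k3 := kappa / 3.
have k30 : 0 < k3 by rewrite divr_gt0.
near=> n.
have mD : measurable_fun setT (D n) by near: n.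
have DEn : forall w, D n w = H w + U n w + W n w + c n by near: n.
have sn : 0 < s n by near: n; move/cvgryPgt : soo; apply.
have ks : 0 < k3 * s n by rewrite mulr_gt0.
pose A1 := [set w | N%:R <= `|H w|].
pose A2 := [set w | (k3 * s n) ^+ 2 <= U n w ^+ 2].
pose A3 := [set w | k3 * s n <= `|W n w|].
have mA1 : measurable A1 by apply: measurable_ge_set; exact: measurableT_comp.
have mA2 : measurable A2 by apply: measurable_ge_set; exact: measurable_funX.
have mA3 : measurable A3 by apply: measurable_ge_set; exact: measurableT_comp.
have P2 : (P A2 <= (e / 3)%:E)%E.
  have Un : (\int[P]_w (U n w ^+ 2)%:E <= (u n)%:E)%E by near: n.
  have := tail_le_integral (exprn_gt0 2 ks) (measurable_funX 2 (mU n)) (fun=> sqr_ge0 _) Un.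
  move=> /le_trans; apply; rewrite lee_fin ler_pdivrMr ?exprn_gt0//.
  have -> : e / 3 * (k3 * s n) ^+ 2 = (e / 3 * k3 ^+ 2) * s n ^+ 2 by ring.
  by near: n; apply: us; rewrite mulr_gt0// exprn_gt0.
have P3 : (P A3 <= (e / 3)%:E)%E.
  have Wn : (\int[P]_w (`|W n w|)%:E <= (v n)%:E)%E by near: n.
  have mWn : measurable_fun setT (fun w => `|W n w|) by exact: measurableT_comp.
  have := tail_le_integral ks mWn (fun=> normr_ge0 _) Wn.
  move=> /le_trans; apply; rewrite lee_fin ler_pdivrMr//.
  have -> : e / 3 * (k3 * s n) = (e / 3 * k3) * s n by ring.
  by near: n; apply: vs; rewrite mulr_gt0.
have sub : ~` [set w | 0 < D n w] `<=` A1 `|` A2 `|` A3.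
  move=> w /= /negP; rewrite -leNgt => Dn.
  apply: contrapT => /not_orP[/not_orP[/negP N1 /negP N2] /negP N3].
  move: N1 N2 N3; rewrite -!ltNge => N1 N2 N3.
  have U2 : `|U n w| < k3 * s n.
    by rewrite -(ltr_pXn2r (n:=2))// ?nnegrE ?ltW// real_normK ?num_real.
  have Nk : N%:R < k3 * s n.
    have : N%:R / k3 < s n by near: n; move/cvgryPgt : soo; apply.
    by rewrite ltr_pdivrMr// mulrC.
  have cn : kappa * s n <= c n by near: n.
  have kE : kappa * s n = 3 * (k3 * s n) by rewrite /k3; field.
  move: Dn; rewrite DEn leNgt => /negP; apply.
  move: N1 N3 U2; rewrite !ltr_norml => /andP[h1 _] /andP[h2 _] /andP[h3 _].
  by move: Nk cn h1 h2 h3; rewrite kE; move: (k3 * s n) => t; lra.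
have Pbad : (P (~` [set w | (0 < D n w)%R]) <= e%:E)%E.
  have mpn := mpos _ mD.
  apply: (@le_trans _ _ (P (A1 `|` A2 `|` A3))).
    apply: le_measure; rewrite ?inE//; first exact: measurableC.
    by apply: measurableU => //; exact: measurableU.
  apply: (le_trans (measureU2 _ _ _)) => //; first exact: measurableU.
  apply: (@le_trans _ _ ((e / 3)%:E + (e / 3)%:E + (e / 3)%:E)%E).
    apply: leeD => //; apply: (le_trans (measureU2 _ _ _)) => //; exact: leeD.
  rewrite -!EFinD lee_fin; lra.
have mpn := mpos _ mD.
have Pfin : P [set w | 0 < D n w] \is a fin_num by exact: fin_num_measure.
move: Pbad; rewrite probability_setC//= -(fineK Pfin) -EFinB lee_fin => H1.
rewrite ger0_norm// subr_ge0 -lee_fin fineK//; exact: probability_le1.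
Unshelve. all: by end_near. Qed.
End Tails.

(** * Power sums *)

Section PowerSums.
Variable R : realType.
Implicit Types (a xi e : R) (x r : nat -> R).

(** A weighted Cesaro argument: past some [N] the factor [r] is at most e / 2, while the terms
    before [N] contribute at most a constant [C], eventually below half of [e] times the diverging
    sum. *)
Lemma sum_weighted_small x r L : (forall l, 0 <= x l) ->
  (forall e, 0 < e -> \forall l \near \oo, r l <= e) ->
  (fun n => \sum_(L <= l < n.+1) x l) @ \oo --> +oo ->
  forall e, 0 < e -> \forall n \near \oo,
    \sum_(L <= l < n.+1) x l * r l <= e * \sum_(L <= l < n.+1) x l.
Proof.
move=> x0 r0 soo e e0.
have e2 : 0 < e / 2 by rewrite divr_gt0.
have [N _ HN] := r0 _ e2.
pose F l := if (l < N)%N then x l * `|r l| else 0.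
pose C := \sum_(0 <= l < N) x l * `|r l|.
have F0 l : 0 <= F l by rewrite /F; case: ifP => // _; rewrite mulr_ge0.
have FC n : (L <= n)%N -> \sum_(L <= l < n) F l <= C.
  move=> Ln; apply: (@le_trans _ _ (\sum_(0 <= l < N + n) F l)).
    have LN : (L <= N + n)%N by rewrite (leq_trans Ln)// leq_addl.
    rewrite [leRHS](@big_cat_nat _ _ _ L)//=.
    rewrite [X in _ <= _ + X](@big_cat_nat _ _ _ n)// ?leq_addl//=.
    rewrite addrCA lerDl addr_ge0// sumr_ge0//.
  rewrite (@big_cat_nat _ _ _ N) ?leq_addr//= [X in _ + X]big_nat_cond.
  rewrite [X in _ + X]big1 ?addr0; last first.
    by move=> l /andP[/andP[Nl _] _]; rewrite /F ltnNge Nl.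
  rewrite /C big_nat_cond [leRHS]big_nat_cond; apply: ler_sum => l /andP[/andP[_ lN] _].
  by rewrite /F lN.
near=> n.
have Ln : (L <= n.+1)%N by apply: leqW; near: n; exact: nbhs_infty_ge.
have sC : 2 * C / e <= \sum_(L <= l < n.+1) x l by near: n; move/cvgryPge : soo; apply.
apply: (@le_trans _ _ (\sum_(L <= l < n.+1) (F l + e / 2 * x l))).
  apply: ler_sum => l _; rewrite /F; case: ltnP => lN.
    rewrite -[leLHS]addr0; apply: lerD; last by rewrite mulr_ge0// ltW.
    by rewrite ler_wpM2l// ler_norm.
  by rewrite add0r mulrC ler_wpM2r//; exact: HN.
rewrite big_split/= -mulr_sumr.
apply: (@le_trans _ _ (C + e / 2 * \sum_(L <= l < n.+1) x l)).
  by rewrite lerD2r FC.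
move: sC; rewrite ler_pdivrMr//; move: (\sum_(_ <= _ < _) _) => s; lra.
Unshelve. all: by end_near. Qed.

Lemma powR_infty a : 0 < a -> forall A : R, \forall n \near \oo, A <= n%:R `^ a.
Proof.
move=> a0 A; near=> n.
have [A0|A0] := leP A 0; first exact: le_trans A0 (powR_ge0 _ _).
have : A `^ a^-1 <= n%:R by near: n; exact: nbhs_infty_ger.
move=> H; have -> : A = (A `^ a^-1) `^ a.
  by rewrite -powRrM mulVf ?gt_eqF// powRr1// ltW.
by apply: (ge0_ler_powR (ltW a0)); rewrite ?nnegrE ?powR_ge0.
Unshelve. all: by end_near. Qed.

Lemma powR_small a : 0 < a -> forall K e, 0 <= K -> 0 < e ->
  \forall n \near \oo, K * n%:R `^ (- a) <= e.
Proof.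
move=> a0 K e K0 e0; near=> n.
have n0 : (0 : R) < n%:R by rewrite ltr0n; near: n; exact: nbhs_infty_gt.
rewrite powRN ler_pdivrMr ?powR_gt0// mulrC -ler_pdivrMr//.
by near: n; exact: powR_infty.
Unshelve. all: by end_near. Qed.

(** Only the indices from n / 2 on are kept: there are at least n / 2 of them, each contributing at
    least (n / 2)^xi n^(-a). *)
Lemma power_sum_ge a xi L : 0 <= a -> 0 <= xi ->
  \forall n \near \oo, 2^-1 `^ xi / 2 * (n%:R `^ xi * n%:R `^ (1 - a)) <=
    \sum_(L <= l < n.+1) l%:R `^ xi * l%:R `^ (- a) :> R.
Proof.
move=> a0 xi0; near=> n.
have Ln : (2 * L <= n)%N by near: n; exact: nbhs_infty_ge.
have n1 : (0 < n)%N by near: n; exact: nbhs_infty_gt.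
have n0 : (0 : R) < n%:R by rewrite ltr0n.
pose m := uphalf n.
have nm : (n <= m.*2)%N by rewrite /m uphalf_half -addnn; have := odd_double_half n; lia.
have mn : (m.*2 <= n.+1)%N by rewrite /m uphalf_half; have := odd_double_half n; lia.
have Lm : (L <= m)%N by lia.
have mn1 : (m <= n.+1)%N by lia.
rewrite (@big_cat_nat _ _ _ m)//=.
apply: (@le_trans _ _ (\sum_(m <= l < n.+1) 2^-1 `^ xi * n%:R `^ xi * n%:R `^ (- a))); last first.
  rewrite -[leLHS]add0r lerD//.
    by rewrite sumr_ge0// => l _; rewrite mulr_ge0 ?powR_ge0.
  apply: ler_sum_nat => l /andP[ml ln].
  have l0 : (0 : R) < l%:R by rewrite ltr0n; lia.
  apply: ler_pM; rewrite ?mulr_ge0 ?powR_ge0//.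
    rewrite -powRM//.
    apply: (ge0_ler_powR xi0); rewrite ?nnegrE ?mulr_ge0//.
    rewrite mulrC ler_pdivrMr// -natrM ler_nat; lia.
  rewrite !powRN lef_pV2 ?posrE ?powR_gt0//.
  apply: (ge0_ler_powR a0); rewrite ?nnegrE//.
  by rewrite ler_nat; lia.
rewrite sumr_const_nat -[leRHS]mulr_natr powRD; last by rewrite (gt_eqF n0) implybT.
rewrite powRr1 ?(ltW n0)//.
have H : n%:R / 2 <= (n.+1 - m)%:R :> R.
  by rewrite ler_pdivrMr// -natrM ler_nat; lia.
rewrite [leLHS](_ : _ = 2^-1 `^ xi * n%:R `^ xi * n%:R `^ (- a) * (n%:R / 2)); last by ring.
by rewrite ler_wpM2l// !mulr_ge0 ?powR_ge0.
Unshelve. all: by end_near. Qed.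
End PowerSums.

(** * Rates and conclusion *)

Section LimSup.
Variable R : realType.
Implicit Types u : (\bar R)^nat.

Lemma near_of_limn_esup u (c : \bar R) : (limn_esup u < c)%E ->
  \forall i \near \oo, (u i < c)%E.
Proof.
rewrite limn_esup_lim (cvg_lim _ (@cvg_esups_inf _ u))// => /ereal_inf_lt[_ [n _ <-] un].
exists n => // i /= ni; apply: le_lt_trans un.
by apply: ereal_sup_ubound; exists i.
Qed.

Lemma near_of_limn_einf u (c : \bar R) : (c < limn_einf u)%E ->
  \forall i \near \oo, (c < u i)%E.
Proof.
rewrite limn_einf_lim (cvg_lim _ (@cvg_einfs_sup _ u))// => /ereal_sup_gt[_ [n _ <-] un].
exists n => // i /= ni; apply: lt_le_trans un _.
by apply: ereal_inf_lbound; exists i.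
Qed.
End LimSup.

Section Rates.
Context d (T : measurableType d) (R : realType) (P : probability T R) (p : nat).
Variables (X : nat -> {RV P >-> p.-tuple R}) (Y : nat -> {RV P >-> R}).
Variables (X' : nat -> {RV P >-> p.-tuple R}) (Y' : nat -> {RV P >-> R}).
Variables (Xnew : {RV P >-> p.-tuple R}) (f0 : p.-tuple R -> R).
Hypothesis iid : iid_sampling X Y X' Y' Xnew.
Hypothesis f0_reg : is_cond_exp_at P (X 0%N) (fun w => (Y 0%N w)%:E) (fun x => (f0 x)%:E).
Variable f : estimators R p.
Hypothesis f_seq : estimator_sequence f.

(** Integrates the pointwise bound |u| <= t + u^2 / t; a form of Cauchy-Schwarz without square
    roots. *)
Lemma integral_le_of_sqr (u : T -> R) (K t : R) : measurable_fun setT u -> 0 < t ->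
  (\int[P]_w (u w ^+ 2)%:E <= (K * t ^+ 2)%:E)%E ->
  (\int[P]_w (`|u w|)%:E <= ((1 + K) * t)%:E)%E.
Proof.
move=> mu t0 uK.
have mu2 : measurable_fun setT (fun w => u w ^+ 2) by exact: measurable_funX.
apply: (@le_trans _ _ (\int[P]_w (t + t^-1 * u w ^+ 2)%:E)%E).
  apply: ge0_integral_le => //.
  - exact: measurableT_comp.
  - by apply: measurable_funD => //; exact: measurable_funM.
  - move=> w; rewrite -[u w ^+ 2]real_normK ?num_real//.
    have := normr_ge0 (u w); move: `|u w| => y y0.
    rewrite -(ler_pM2l t0) mulrDr mulVKf ?gt_eqF//.
    have := sqr_ge0 (t - y); rewrite !expr2; nra.
have ti : 0 <= t^-1 by rewrite invr_ge0 ltW.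
rewrite ge0_integral_add//; last 3 first.
- by move=> _; exact: ltW.
- exact: measurable_funM.
- by move=> w; rewrite mulr_ge0 ?sqr_ge0.
rewrite integral_real_cst ge0_integral_scale//; last by move=> w; exact: sqr_ge0.
apply: (@le_trans _ _ (t%:E + t^-1%:E * (K * t ^+ 2)%:E)%E).
  by apply: leeD => //; apply: lee_wpmul2l.
rewrite -EFinM -EFinD lee_fin mulrCA expr2 mulKf ?gt_eqF//; lra.
Qed.

Let rho l w := real_risk Xnew f0 f (data X Y l w).

Lemma mean_risk_finite :
  (ereal_sup (range (mean_risk X Y Xnew f0 f)) < +oo)%E ->
  forall l, mean_risk X Y Xnew f0 f l = (fine (mean_risk X Y Xnew f0 f l))%:E.
Proof.
move=> sup l; rewrite fineK// ge0_fin_numE.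
  by apply: le_lt_trans sup; apply: ereal_sup_ubound; exists l.
by apply: integral_ge0 => w _; exact: risk_ge0.
Qed.

(** The estimator has its own exponent [a_f], but its rates are stated with the slower [a], the
    common scale of the comparison. The bound on the mean risk also comes from the fourth moment. *)
Lemma estimator_rates (a a_f b C C1 : R) :
  0 <= a -> a <= a_f -> 2^-1 + a - a_f / 2 < b -> 0 < C ->
  stable X Y X' Y' Xnew f b C ->
  (ereal_sup (range (mean_risk X Y Xnew f0 f)) < +oo)%E ->
  limn_esup (fun i => ((i%:R `^ (2 * a_f))%:E * mean_error4 X Y Xnew f0 f i)%E) = C1%:E ->
  exists K del : R, [/\ 0 <= K, 0 < del & \forall l \near \oo,
    [/\ fine (mean_risk X Y Xnew f0 f l) <= K * l%:R `^ (- a),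
        (mean_error4 X Y Xnew f0 f l <= (K * l%:R `^ (- a))%:E)%E &
        (\int[P]_w (`|rho l w - fine (mean_risk X Y Xnew f0 f l)|)%:E <=
         (K * (l%:R `^ (- a) * l%:R `^ (- del)))%:E)%E]].
Proof.
move=> a0 aaf bgt C0 st sup lim.
pose K1 := `|C1| + 1.
have K10 : 0 <= K1 by rewrite addr_ge0.
pose K2 := 1 + K1; pose K3 := 4 * C * K2.
have K20 : 0 <= K2 by rewrite addr_ge0.
have K30 : 0 <= K3 by rewrite !mulr_ge0// ltW.
(* Chosen so that the variance order l^(1 - 2b - a_f) is the square of l^(-a) l^(-del). *)
pose del := b + a_f / 2 - 2^-1 - a.
have del0 : 0 < del by rewrite /del; lra.
exists (K1 + K2 + (1 + K3)), del; split => //; first by rewrite !addr_ge0.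
have lt1 : (limn_esup (fun i => ((i%:R `^ (2 * a_f))%:E * mean_error4 X Y Xnew f0 f i)%E) < K1%:E)%E.
  by rewrite lim lte_fin /K1 (le_lt_trans (ler_norm _))// ltrDl.
have near1 := near_of_limn_esup lt1.
near=> l.
have l0 : (0 < l)%N by near: l; exact: nbhs_infty_gt.
have lR0 : (0 : R) < l%:R by rewrite ltr0n.
have lR1 : (1 : R) <= l%:R by rewrite ler1n.
pose t := l%:R `^ (- a_f) : R.
have t0 : 0 < t by exact: powR_gt0.
have ta : t <= l%:R `^ (- a) by apply: ler_powR => //; rewrite lerN2.
have a1 : l%:R `^ (- a) <= 1 :> R by rewrite -[leRHS](powRr0 l%:R); apply: ler_powR => //; rewrite oppr_le0.
have t1 : t <= 1 by exact: le_trans ta a1.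
have t2 : t ^+ 2 = (l%:R `^ (2 * a_f))^-1.
  by rewrite /t powRN exprVn -powR_mulrn ?powR_ge0// -powRrM mulrC.
have e4 : (mean_error4 X Y Xnew f0 f l <= (K1 * t ^+ 2)%:E)%E.
  have H : ((l%:R `^ (2 * a_f))%:E * mean_error4 X Y Xnew f0 f l < K1%:E)%E by near: l.
  by rewrite t2 EFinM lee_pdivlMr ?powR_gt0// muleC ltW.
have rl := mean_risk_finite sup l.
set r := fine _ in rl *.
have r0 : 0 <= r by apply: fine_ge0; apply: integral_ge0 => w _; exact: risk_ge0.
have mF : measurable_fun setT (fun w => f (data X Y l w) (Xnew w) - f0 (Xnew w)).
  have H : measurable_fun setT (fun w => (data X Y l w, Xnew w)).
    by apply: measurable_fun_pair => //; exact: measurable_data.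
  exact: (measurableT_comp (measurable_error f0_reg f_seq (n:=l)) H).
have rK : r <= K2 * t.
  rewrite -lee_fin -rl (mean_riskE iid f0_reg f_seq).
  have mF2 : measurable_fun setT (fun w => (f (data X Y l w) (Xnew w) - f0 (Xnew w)) ^+ 2).
    exact: measurable_funX.
  have := @integral_le_of_sqr _ K1 t mF2 t0.
  under [X in (_ -> X <= _)%E -> _]eq_integral do rewrite ger0_norm ?sqr_ge0//.
  apply; apply: le_trans e4.
  by under eq_integral do rewrite -exprM.
have rho2 : (\int[P]_w ((rho l w - r) ^+ 2)%:E <= (K3 * (l%:R `^ (- a) * l%:R `^ (- del)) ^+ 2)%:E)%E.
  have e4oo : (mean_error4 X Y Xnew f0 f l < +oo)%E by apply: le_lt_trans e4 _; rewrite ltry.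
  apply: (le_trans (stable_variance iid f0_reg f_seq l0 C0 st e4oo rl)).
  rewrite lee_fin.
  have -> : (l%:R `^ (- a) * l%:R `^ (- del)) ^+ 2 = l%:R * (l%:R `^ (2 * b))^-1 * t.
    rewrite -powRD; last by rewrite (gt_eqF lR0) implybT.
    rewrite -powR_mulrn ?powR_ge0// -powRrM -powRN -[X in _ = X * _ * _](powRr1 (ltW lR0)).
    rewrite /t -!powRD ?(gt_eqF lR0) ?implybT//; by congr (_ `^ _); rewrite /del; lra.
  have -> : l%:R * (C / l%:R `^ (2 * b) * (4 * r)) =
      (4 * C * (l%:R * (l%:R `^ (2 * b))^-1)) * r by ring.
  have -> : K3 * (l%:R / l%:R `^ (2 * b) * t) =
      (4 * C * (l%:R * (l%:R `^ (2 * b))^-1)) * (K2 * t) by rewrite /K3; ring.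
  by rewrite ler_wpM2l// !mulr_ge0 ?invr_ge0 ?powR_ge0// ltW.
have s0 : 0 < l%:R `^ (- a) * l%:R `^ (- del) :> R by rewrite mulr_gt0// powR_gt0.
have mrho : measurable_fun setT (fun w => rho l w - r).
  apply: measurable_funB => //.
  exact: (measurableT_comp (measurable_real_risk Xnew f0_reg (n:=l) f_seq) (@measurable_data _ _ _ _ _ X Y l)).
split.
- apply: (le_trans rK); apply: ler_pM => //; first exact: ltW.
  lra.
- apply: (le_trans e4); rewrite lee_fin; apply: ler_pM => //.
    exact: sqr_ge0.
    lra.
  by apply: le_trans ta; rewrite expr2 ger_pMr.
- apply: (le_trans (integral_le_of_sqr mrho s0 rho2)); rewrite lee_fin ler_wpM2r//.
  lra.
Unshelve. all: by end_near. Qed.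
End Rates.

Lemma integral_sum_le d (T : measurableType d) (R : realType) (P : probability T R)
    (F : nat -> T -> R) (v : nat -> R) L n :
  (forall l, measurable_fun setT (F l)) -> (forall l w, 0 <= F l w) ->
  (forall l, (L <= l)%N -> (\int[P]_w (F l w)%:E <= (v l)%:E)%E) ->
  (\int[P]_w (\sum_(L <= l < n) F l w)%:E <= (\sum_(L <= l < n) v l)%:E)%E.
Proof.
move=> mF F0 Fv; elim: n => [|n IH].
  by rewrite big_geq//; under eq_integral do rewrite big_geq//; rewrite integral0.
have [Ln|nL] := leqP L n; last first.
  by rewrite big_geq//; under eq_integral do rewrite big_geq//; rewrite integral0.
rewrite big_nat_recr//=; under eq_integral do rewrite big_nat_recr//=.
rewrite ge0_integral_add//; last 2 first.
- exact: measurable_sum.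
- by move=> w; exact: sumr_ge0.
by rewrite EFinD; apply: leeD => //; exact: Fv.
Qed.

Section RiskGap.
Context (R : realType).

(** With c strictly between the limsup of the ratio and 1, eventually rh - rg >= (1 - c) rh, and rh
    exceeds M i^(-a). *)
Lemma near_gap (a M : R) (rh rg : nat -> R) : 0 < M ->
  (M%:E < limn_einf (fun i => ((i%:R `^ a)%:E * (rh i)%:E)%E))%E ->
  (limn_esup (fun i => ((rg i)%:E / (rh i)%:E)%E) < 1)%E ->
  exists2 kappa : R, 0 < kappa &
    \forall i \near \oo, kappa * i%:R `^ (- a) <= rh i - rg i.
Proof.
move=> M0 /near_of_limn_einf near1 ratio.
have [c c1 cr] : exists2 c : R, c < 1 &
    (limn_esup (fun i => ((rg i)%:E / (rh i)%:E)%E) < c%:E)%E.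
  move: ratio; case: (limn_esup _) => [x| |] //.
  - rewrite !lte_fin => x1; exists ((x + 1) / 2); rewrite ?lte_fin; lra.
  - by move=> _; exists 0 => //; rewrite ltNyr.
have near2 := near_of_limn_esup cr.
exists ((1 - c) * M); first by rewrite mulr_gt0// subr_gt0.
near=> i.
have i0 : (0 : R) < i%:R by rewrite ltr0n; near: i; exact: nbhs_infty_gt.
have ia : (0 : R) < i%:R `^ a by exact: powR_gt0.
have H1 : (M%:E < (i%:R `^ a)%:E * (rh i)%:E)%E by near: i.
have Mr : M * i%:R `^ (- a) < rh i.
  by rewrite powRN ltr_pdivrMr// mulrC -lte_fin EFinM.
have r0 : 0 < rh i by apply: lt_trans Mr; rewrite mulr_gt0// powR_gt0.
have H2 : ((rg i)%:E / (rh i)%:E < c%:E)%E by near: i.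
have H3 : rg i < c * rh i.
  by move: H2; rewrite inver (gt_eqF r0) -EFinM lte_fin ltr_pdivrMr.
have : (1 - c) * (M * i%:R `^ (- a)) <= (1 - c) * rh i.
  by rewrite ler_wpM2l ?ltW// subr_gt0.
rewrite mulrA; lra.
Unshelve. all: by end_near. Qed.
End RiskGap.

Theorem theorem4p1 (d : measure_display) (T : measurableType d) (R : realType)
  (P : probability T R) (p : nat)
  (X : nat -> {RV P >-> p.-tuple R}) (Y : nat -> {RV P >-> R})
  (X' : nat -> {RV P >-> p.-tuple R}) (Y' : nat -> {RV P >-> R})
  (Xnew : {RV P >-> p.-tuple R})
  (f0 : p.-tuple R -> R) (sigma : R)
  (h g : estimators R p)
  (a_h M_h C1_h C2_h b_h a_g M_g C1_g C2_g b_g : R) (xi : R)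
  (iid : iid_sampling X Y X' Y' Xnew)
  (Y_L2 : (\int[P]_w ((Y 0%N w) ^+ 2)%:E < +oo)%E)
  (f0_reg : is_cond_exp_at P (X 0%N) (fun w => (Y 0%N w)%:E) (fun x => (f0 x)%:E))
  (noise : exists2 v : p.-tuple R -> \bar R,
     is_cond_exp_at P (X 0%N) (fun w => ((Y 0%N w - f0 (X 0%N w)) ^+ 2)%:E) v &
     forall x, law_support P (X 0%N) x -> (v x <= (sigma ^+ 2)%:E)%E)
  (h_seq : estimator_sequence h)
  (a_h_range : 0 <= a_h < 1) (M_h_gt0 : 0 < M_h) (C1_h_gt0 : 0 < C1_h)
  (C2_h_gt0 : 0 < C2_h) (b_h_gt : 2^-1 + a_h / 2 < b_h)
  (h_risk : limn_einf (fun i =>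
     ((i%:R `^ a_h)%:E * mean_risk X Y Xnew f0 h i)%E) = M_h%:E)
  (h_risk_sup : (ereal_sup (range (mean_risk X Y Xnew f0 h)) < +oo)%E)
  (h_error4 : limn_esup (fun i =>
     ((i%:R `^ (2 * a_h))%:E * mean_error4 X Y Xnew f0 h i)%E) = C1_h%:E)
  (h_stable : stable X Y X' Y' Xnew h b_h C2_h)
  (g_seq : estimator_sequence g)
  (ratio : (limn_esup (fun i =>
     (mean_risk X Y Xnew f0 g i / mean_risk X Y Xnew f0 h i)%E) < 1)%E)
  (a_g_range : 0 <= a_g <= 1) (M_g_gt0 : 0 < M_g) (C1_g_gt0 : 0 < C1_g)
  (C2_g_gt0 : 0 < C2_g) (b_g_gt : 2^-1 + a_h - a_g / 2 < b_g)
  (g_risk : limn_esup (fun i =>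
     ((i%:R `^ a_g)%:E * mean_risk X Y Xnew f0 g i)%E) = M_g%:E)
  (g_risk_sup : (ereal_sup (range (mean_risk X Y Xnew f0 g)) < +oo)%E)
  (g_error4 : limn_esup (fun i =>
     ((i%:R `^ (2 * a_g))%:E * mean_error4 X Y Xnew f0 g i)%E) = C1_g%:E)
  (g_stable : stable X Y X' Y' Xnew g b_g C2_g)
  (cases : a_h < a_g <= 1 \/ [/\ a_g = a_h, a_h < 1 & M_g < M_h])
  (xi_ge0 : 0 <= xi) :
  (fun n => P [set w | RV X Y g xi n w < RV X Y h xi n w]) @ \oo --> (1%:E : \bar R).
Proof.
have /andP[a0 a1] := a_h_range; set a := a_h in a0 a1 *.
(* Either case gives this order, which allows the rates of [g] to be stated with the exponent of
   [h]. *)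
have aag : a <= a_g.
  by case: cases => [/andP[/ltW]//|[-> _ _]].
pose rh l := fine (mean_risk X Y Xnew f0 h l).
pose rg l := fine (mean_risk X Y Xnew f0 g l).
have rhE := mean_risk_finite h_risk_sup.
have rgE := mean_risk_finite g_risk_sup.
have [kappa kappa0 gap] : exists2 kappa : R, 0 < kappa &
    \forall i \near \oo, kappa * i%:R `^ (- a) <= rh i - rg i.
  apply: (@near_gap _ a (M_h / 2)); first by rewrite divr_gt0.
    rewrite (_ : (fun i => _) = (fun i =>
      ((i%:R `^ a_h)%:E * mean_risk X Y Xnew f0 h i)%E)).
      by rewrite h_risk lte_fin ltr_pdivrMr// ltr_pMr// ltr1n.
    by apply/funext => i; rewrite rhE.
  rewrite (_ : (fun i => _) = (fun i =>
     (mean_risk X Y Xnew f0 g i / mean_risk X Y Xnew f0 h i)%E))//.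
  by apply/funext => i; rewrite rhE rgE.
(* The threshold with [a_f = a_h], where a - a / 2 = a / 2. *)
have b_h_gt' : 2^-1 + a - a_h / 2 < b_h by apply: le_lt_trans b_h_gt; rewrite /a; lra.
have [Kh [dh [Kh0 dh0 Hh]]] := estimator_rates iid f0_reg h_seq a0 (lexx a)
  b_h_gt' C2_h_gt0 h_stable h_risk_sup h_error4.
have [Kg [dg [Kg0 dg0 Hg]]] := estimator_rates iid f0_reg g_seq a0 aag
  b_g_gt C2_g_gt0 g_stable g_risk_sup g_error4.
(* Gap and rates hold from [L0] on; the terms below [L] are collected in [H] and the others split
   into [M], [dev] and the mean gap. *)
have [L0 _ HL] := filterI gap (filterI Hh Hg).
pose L := L0.+1.
have L1 l : (L <= l)%N -> (0 < l)%N by move=> /(leq_trans _); apply.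
have HLl l : (L <= l)%N -> _ := fun Ll => HL l (ltnW Ll).
pose x l : R := l%:R `^ xi.
pose y l : R := l%:R `^ (- a).
have x0 l : 0 <= x l by exact: powR_ge0.
have y0 l : 0 <= y l by exact: powR_ge0.
pose s n := \sum_(L <= l < n.+1) x l * y l.
pose c0 : R := 2^-1 `^ xi / 2.
have c00 : 0 < c0 by rewrite divr_gt0// powR_gt0.
have s_ge : \forall n \near \oo, c0 * (n%:R `^ xi * n%:R `^ (1 - a)) <= s n.
  exact: power_sum_ge.
have a1' : 0 < 1 - a by rewrite subr_gt0.
(* [s n] has order at least n^xi n^(1 - a), and 1 - a > 0. This yields both the divergence of [s]
   and the negligible variance. *)
have s_big K : \forall n \near \oo, K * x n <= s n.
  near=> n.
  have H1 : c0 * (n%:R `^ xi * n%:R `^ (1 - a)) <= s n by near: n.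
  have H2 : K / c0 <= n%:R `^ (1 - a) by near: n; exact: powR_infty.
  apply: le_trans H1; rewrite mulrCA mulrC ler_wpM2l// mulrC.
  by move: H2; rewrite ler_pdivrMr.
have soo : s @ \oo --> +oo.
  apply/cvgryPge => A; near=> n.
  have sn : `|A| * x n <= s n by near: n; exact: s_big.
  apply: le_trans sn; apply: le_trans (ler_norm A) _; rewrite ler_peMr//.
  rewrite -[leLHS](powRr0 n%:R); apply: ler_powR => //.
  by rewrite ler1n; near: n; exact: nbhs_infty_gt.
pose K3 := 6 * Kh + 6 * Kg + 24 * sigma ^+ 2 * (Kh + Kg).
have K30 : 0 <= K3.
  apply: addr_ge0; first by rewrite addr_ge0// mulr_ge0.
  by rewrite mulr_ge0 ?addr_ge0// mulr_ge0 ?sqr_ge0.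
(* Differences of index below [L] are set to 0, so that the second moment bound holds at every
   index. *)
pose m l (z : l.-tuple (p.-tuple R * R)) s : R :=
  if (l < L)%N then 0 else x l * loss_gap Xnew f0 h g z s.
pose q l : R := if (l < L)%N then 0 else x l ^+ 2 * (K3 * y l).
pose M l w := m l (data X Y l w) (sample X Y l w).
have mgap l : measurable_fun setT (fun w => loss_gap Xnew f0 h g (data X Y l w) (sample X Y l w)).
  have H : measurable_fun setT (fun w => (data X Y l w, sample X Y l w)).
    by apply: measurable_fun_pair; [exact: measurable_data|exact: measurable_sample].
  exact: (measurableT_comp (measurable_loss_gap Xnew f0_reg h_seq g_seq (n:=l)) H).
have mM l : measurable_fun setT (M l).
  rewrite /M /m; case: (l < L)%N => //; exact: measurable_funM.
have mm l : measurable_fun setT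
    (fun zs : l.-tuple (p.-tuple R * R) * (p.-tuple R * R) => m l zs.1 zs.2).
  rewrite /m; case: (l < L)%N; first exact: measurable_cst.
  apply: measurable_funM; first exact: measurable_cst.
  exact: (measurable_loss_gap Xnew f0_reg h_seq g_seq (n:=l)).
have Mq l : (\int[P]_w (M l w ^+ 2)%:E <= (q l)%:E)%E.
  rewrite /M /m /q; case: ltnP => lL.
    by under eq_integral do rewrite expr0n /=; rewrite integral0.
  have [_ [[h1 h2 _] [g1 g2 _]]] := HLl l lL.
  have rhl : (mean_risk X Y Xnew f0 h l <= (Kh * y l)%:E)%E by rewrite rhE lee_fin.
  have rgl : (mean_risk X Y Xnew f0 g l <= (Kg * y l)%:E)%E by rewrite rgE lee_fin.
  have H := loss_gap_sqr_le iid f0_reg noise h_seq g_seq rhl rgl h2 g2.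
  under eq_integral do rewrite exprMn.
  rewrite ge0_integral_scale ?sqr_ge0//; last 2 first.
  - exact: measurable_funX.
  - by move=> w; exact: sqr_ge0.
  rewrite [leRHS]EFinM; apply: lee_wpmul2l; first by rewrite lee_fin sqr_ge0.
  apply: (le_trans H); rewrite lee_fin -/(y l).
  by rewrite [leLHS](_ : _ = K3 * y l)// /K3; ring.
have M0 l : {ae P, forall w,
  P.-integrable setT (fun w' => (m l (data X Y l w) (sample X Y l w'))%:E) /\
  (\int[P]_w' (m l (data X Y l w) (sample X Y l w'))%:E = 0)%E}.
  have rhoo : (mean_risk X Y Xnew f0 h l < +oo)%E by rewrite rhE ltry.
  have rgoo : (mean_risk X Y Xnew f0 g l < +oo)%E by rewrite rgE ltry.
  have := loss_gap_martingale iid Y_L2 f0_reg noise h_seq g_seq rhoo rgoo.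
  apply: filterS => w [iw ew]; rewrite /m; case: ltnP => lL.
    by split; [exact: integrable0|rewrite integral0].
  split; first by under eq_fun do rewrite EFinM; exact: integrableZl.
  by under eq_integral do rewrite EFinM; rewrite integralZl// ew mule0.
pose U n w := \sum_(0 <= l < n.+1) M l w.
pose dev l w := (real_risk Xnew f0 h (data X Y l w) - rh l) -
  (real_risk Xnew f0 g (data X Y l w) - rg l).
have mrho f l : estimator_sequence f ->
    measurable_fun setT (fun w => real_risk Xnew f0 f (data X Y l w)).
  move=> f_seq.
  exact: (measurableT_comp (measurable_real_risk Xnew f0_reg (n:=l) f_seq) (@measurable_data _ _ _ _ _ X Y l)).
have mdh l : measurable_fun setT (fun w => real_risk Xnew f0 h (data X Y l w) - rh l).
  by apply: measurable_funB => //; exact: mrho.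
have mdg l : measurable_fun setT (fun w => real_risk Xnew f0 g (data X Y l w) - rg l).
  by apply: measurable_funB => //; exact: mrho.
have mdev l : measurable_fun setT (dev l) by exact: measurable_funB.
pose W n w := \sum_(L <= l < n.+1) x l * dev l w.
pose loss l w := (h l (data X Y l w) (X l w) - Y l w) ^+ 2 -
   (g l (data X Y l w) (X l w) - Y l w) ^+ 2.
pose H w := \sum_(0 <= l < L) x l * loss l w.
pose r l := Kh * l%:R `^ (- dh) + Kg * l%:R `^ (- dg).
have meval f l : estimator_sequence f ->
    measurable_fun setT (fun w => f l (data X Y l w) (X l w)).
  move=> f_seq; have H' : measurable_fun setT (fun w => (data X Y l w, X l w)).
    by apply: measurable_fun_pair => //; exact: measurable_data.
  exact: (measurableT_comp (f_seq.2 l) H').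
rewrite (_ : (fun n => _) = fun n => P [set w | 0 < RV X Y h xi n w - RV X Y g xi n w]); last first.
  by apply/funext => n; congr (P _); apply/seteqP; split => w /=; rewrite subr_gt0.
apply: (@probability_positive_cvg1 _ _ _ P _ H U W
  (fun n => \sum_(L <= l < n.+1) x l * (rh l - rg l)) s
  (fun n => \sum_(0 <= l < n.+1) q l)
  (fun n => \sum_(L <= l < n.+1) x l * y l * r l) kappa kappa0).
- apply: measurable_sum => l; apply: measurable_funM => //.
  by apply: measurable_funB; apply: measurable_funX; apply: measurable_funB => //; exact: meval.
- by move=> n; apply: measurable_sum.
- by move=> n; apply: measurable_sum => l; exact: measurable_funM.
- near=> n => w.
  have Ln : (L <= n.+1)%N by apply: leqW; near: n; exact: nbhs_infty_ge.
  have -> : RV X Y h xi n w - RV X Y g xi n w = \sum_(0 <= l < n.+1) x l * loss l w.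
    rewrite /RV -sumrB; apply: eq_bigr => l _.
    by rewrite /loss mulrBr.
  rewrite (big_cat_nat _ Ln)//= -/(H w) -!addrA; congr (_ + _).
  have -> : U n w = \sum_(L <= l < n.+1) M l w.
    rewrite /U (big_cat_nat _ Ln)//= [X in X + _]big_nat_cond big1 ?add0r//.
    by move=> l /andP[/andP[_ lL] _]; rewrite /M /m lL.
  rewrite -!big_split/= big_nat_cond [RHS]big_nat_cond.
  apply: eq_bigr => l /andP[/andP[Ll _] _].
  by rewrite /M /m ltnNge Ll /= /loss_gap /dev /loss /sample /=; ring.
- near=> n; rewrite mulr_sumr; apply: ler_sum_nat => l /andP[Ll _].
  have [+ _] := HLl l Ll => Hgap.
  by rewrite mulrCA ler_wpM2l.
- near=> n; exact: (integral_sqr_martingale iid mm Mq M0 n.+1).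
- near=> n.
  apply: (@le_trans _ _ (\int[P]_w (\sum_(L <= l < n.+1) `|x l * dev l w|)%:E)%E).
    apply: ge0_integral_le => //.
    + by apply: measurableT_comp => //; apply: measurable_sum => l; exact: measurable_funM.
    + by apply: measurable_sum => l; apply: measurableT_comp => //; exact: measurable_funM.
    + by move=> w; exact: ler_norm_sum.
  apply: integral_sum_le => [l|l w|l Ll] //.
    by apply: measurableT_comp => //; exact: measurable_funM.
  have [_ [[_ _ h3] [_ _ g3]]] := HLl l Ll.
  under eq_integral do rewrite normrM (ger0_norm (x0 l)).
  rewrite ge0_integral_scale//; last exact: measurableT_comp.
  rewrite -mulrA EFinM; apply: lee_wpmul2l; first by rewrite lee_fin.
  apply: (@le_trans _ _ (\int[P]_w (`|real_risk Xnew f0 h (data X Y l w) - rh l| +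
      `|real_risk Xnew f0 g (data X Y l w) - rg l|)%:E)%E).
    apply: ge0_integral_le => //.
    + exact: measurableT_comp.
    + by apply: measurable_funD; exact: measurableT_comp.
    + by move=> w; rewrite /dev; exact: ler_normB.
  rewrite ge0_integral_add//; [|exact: measurableT_comp|exact: measurableT_comp].
  apply: (le_trans (leeD h3 g3)).
  by rewrite -EFinD lee_fin /r mulrDr -/(y l); lra.
- exact: soo.
- move=> e e0; near=> n.
  have sn0 : 0 < s n by near: n; move/cvgryPgt : soo; apply.
  have Ln : (L <= n.+1)%N by apply: leqW; near: n; exact: nbhs_infty_ge.
  have H1 : K3 / e * x n <= s n by near: n; exact: s_big.
  (* As [xi >= 0] the weights increase, so one factor [x l] of [x l ^+ 2] is bounded by [x n]; what
     remains sums to [s n]. *)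
  apply: (@le_trans _ _ (K3 * x n * s n)); last first.
    rewrite expr2 mulrA; apply: ler_wpM2r; first exact: ltW.
    have -> : K3 * x n = e * (K3 / e * x n) by field; rewrite gt_eqF.
    by rewrite ler_wpM2l// ltW.
  rewrite /s mulr_sumr (big_cat_nat _ Ln)//= [X in X + _]big_nat_cond big1 ?add0r; last first.
    by move=> l /andP[/andP[_ lL] _]; rewrite /q lL.
  apply: ler_sum_nat => l /andP[Ll ln]; rewrite /q ltnNge Ll /=.
  have xln : x l <= x n.
    by apply: (ge0_ler_powR xi_ge0); rewrite ?nnegrE// ler_nat.
  rewrite (_ : x l ^+ 2 * (K3 * y l) = x l * (K3 * (x l * y l))); last by ring.
  rewrite (_ : K3 * x n * (x l * y l) = x n * (K3 * (x l * y l))); last by ring.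
  by rewrite ler_wpM2r// !mulr_ge0.
- apply: (@sum_weighted_small _ (fun l => x l * y l)) => //.
    by move=> l; rewrite mulr_ge0.
  move=> e e0; have e2 : 0 < e / 2 by rewrite divr_gt0.
  near=> l; rewrite /r.
  have H1 : Kh * l%:R `^ (- dh) <= e / 2 by near: l; exact: powR_small.
  have H2 : Kg * l%:R `^ (- dg) <= e / 2 by near: l; exact: powR_small.
  lra.
Unshelve. all: by end_near. Qed.
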